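(* Let $(X,S)$ be jointly Gaussian with $X\sim\mathcal N(\mu_x,\sigma_x^2)$, $S\sim\mathcal N(\mu_s,\sigma_s^2)$, $\sigma_x,\sigma_s>0$, and covariance $\mathrm{Cov}(X,S)=\theta_1\neq 0$. Put $\rho=\frac{\theta_1}{\sigma_s\sigma_x}$. For $D>0$ and $C\in\mathbb R$ consider $$R(D,C)=\min_{p_{\hat X|X}} I(X;\hat X)\quad\text{s.t.}\quad \mathbb E[(X-\hat X)^2]\le D,\quad h(S|\hat X)\le C,$$ where $\hat X$ is real-valued and $S-X-\hat X$ is a Markov chain. If $C<\frac12\log\left(1-\frac{\theta_1^2}{\sigma_s^2\sigma_x^2}\right)+h(S)$, the problem is infeasible. Otherwise: (i) if $C>h(S)$ and $D>\sigma_x^2$, then $R(D,C)=0$; (ii) in all remaining cases, $$R(D,C)=\begin{cases}\frac12\log\frac{\sigma_x^2}{D} & \text{for } D\le\sigma_x^2\left(1-\frac1{\rho^2}\left(1-e^{-2h(S)+2C}\right)\right),\\[4pt] -\frac12\log\left(1-\frac1{\rho^2}\left(1-e^{-2h(S)+2C}\right)\right) & \text{for } D>\sigma_x^2\left(1-\frac1{\rho^2}\left(1-e^{-2h(S)+2C}\right)\right).\end{cases}$$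
   Context: Logarithms, entropies and mutual information use the natural base. $h(\cdot)$ is differential entropy and $h(S|\hat X)$ conditional differential entropy. The Markov chain condition means that $\hat X$ is generated from $X$ through $p_{\hat X|X}$, conditionally independently of $S$ given $X$. ''Infeasible'' means that no $p_{\hat X|X}$ satisfies the constraints. Convention: $-\frac12\log 0=+\infty$. *)

(* Defs.v *)
From HB Require Import structures.
From mathcomp Require Import all_boot all_order all_algebra.
From mathcomp Require Import all_classical all_reals all_analysis.
From mathcomp Require Import measurable_realfun.

Set Implicit Arguments.
Unset Strict Implicit.
Unset Printing Implicit Defensive.

Import Order.TTheory GRing.Theory Num.Theory.
Import numFieldNormedType.Exports.

Local Open Scope classical_set_scope.
Local Open Scope ring_scope.
Local Open Scope charge_scope.
Local Open Scope ereal_scope.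

Section random_variables.
Context d1 d2 d (T1 : measurableType d1) (T2 : measurableType d2)
  (T : measurableType d).

HB.instance Definition _ :=
  isMeasurableFun.Build _ _ (T1 * T2)%type T1 (@fst T1 T2) measurable_fst.

HB.instance Definition _ :=
  isMeasurableFun.Build _ _ (T1 * T2)%type T2 (@snd T1 T2) measurable_snd.

Definition rv_pair (U : T -> T1) (V : T -> T2) : T -> T1 * T2 :=
  fun w => (U w, V w).

Context (U : {mfun T >-> T1}) (V : {mfun T >-> T2}).

Let measurable_rv_pair : measurable_fun [set: T] (rv_pair U V).
Proof. by apply: measurable_fun_pair. Qed.

HB.instance Definition _ :=
  isMeasurableFun.Build _ _ T (T1 * T2)%type (rv_pair U V) measurable_rv_pair.

End random_variables.

Section channel.
Context d d1 d2 (T : measurableType d) (T1 : measurableType d1)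
  (T2 : measurableType d2) (R : realType).
Context (P : probability T R) (X : {mfun T >-> T1}) (k : R.-pker T1 ~> T2).

(* Law on T * T2 of (w, Y), where w has law P and, given w, the variable Y has
   law k (X w).  Under it Y is conditionally independent of every variable on T
   given X, and k is the conditional law of Y given X. *)
Definition channel_law (A : set (T * T2)) : \bar R :=
  \int[P]_w k (X w) (xsection A w).

Let kX (w : T) : {measure set T2 -> \bar R} := k (X w).

Let measurable_kX A : measurable A -> measurable_fun [set: T] (kX ^~ A).
Proof.
move=> mA; apply: (measurableT_comp (f := k ^~ A)).
  exact: measurable_kernel.
exact: measurable_funPT.
Qed.

HB.instance Definition _ := isKernel.Build _ _ T T2 R kX measurable_kX.

Let kX_prob w : kX w [set: T2] = 1.
Proof. exact: prob_kernel. Qed.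

HB.instance Definition _ := Kernel_isProbability.Build _ _ T T2 R kX kX_prob.

Let measurable_channel A : measurable A ->
  measurable_fun [set: T] (fun w => k (X w) (xsection A w)).
Proof.
move=> mA.
by apply: (@measurable_fun_xsection_finite_kernel _ _ _ _ _ kX); rewrite inE.
Qed.

Let channel_law0 : channel_law set0 = 0.
Proof. by apply: integral0_eq => w _; rewrite xsection0 measure0. Qed.

Let channel_law_ge0 A : 0 <= channel_law A.
Proof. exact: integral_ge0. Qed.

Let channel_law_sigma_additive : semi_sigma_additive channel_law.
Proof.
move=> F mF tF mUF; rewrite [X in _ --> X](_ : _ =
    \int[P]_w (\sum_(n <oo) k (X w) (xsection (F n) w))); last first.
  apply: eq_integral => w _; rewrite xsection_bigcup.
  apply/esym/cvg_lim => //; apply: measure_sigma_additive.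
    by move=> i; exact: measurable_xsection.
  exact: trivIset_xsection.
apply/cvg_closeP; split.
  by apply: is_cvg_nneseries => n _ _; exact: integral_ge0.
by rewrite closeE// integral_nneseries// => n; exact: measurable_channel.
Qed.

HB.instance Definition _ := isMeasure.Build _ _ _ channel_law
  channel_law0 channel_law_ge0 channel_law_sigma_additive.

Let channel_law_setT : channel_law [set: _] = 1.
Proof.
rewrite /channel_law (eq_integral (cst 1)).
  by rewrite integral_cst// mul1e; exact: probability_setT.
move=> w _; rewrite (_ : xsection _ w = [set: T2]) ?prob_kernel//.
by apply/seteqP; split => // y _; rewrite /xsection /= inE.
Qed.

HB.instance Definition _ :=
  Measure_isProbability.Build _ _ _ channel_law channel_law_setT.

End channel.

Section product_measure.
Context d1 d2 (T1 : measurableType d1) (T2 : measurableType d2) (R : realType).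
Context (m1 : {sigma_finite_measure set T1 -> \bar R})
  (m2 : {sigma_finite_measure set T2 -> \bar R}).

(* Alias carrying the sigma-finite structure, which is not inferred for \x. *)
Definition prod_measure : set (T1 * T2) -> \bar R := m1 \x m2.

HB.instance Definition _ := Measure.on prod_measure.

Let prod_measure_sigma_finite : sigma_finite setT prod_measure.
Proof.
have /sigma_finiteP[F [TF ndF Foo]] := sigma_finiteT m1.
have /sigma_finiteP[G [TG ndG Goo]] := sigma_finiteT m2.
exists (fun n => F n `*` G n).
  rewrite -setXTT TF TG predeqE => -[x y]; split.
    move=> [/= [n _ Fnx] [k _ Gky]]; exists (maxn n k) => //; split.
    - by move: x Fnx; exact/subsetPset/ndF/leq_maxl.
    - by move: y Gky; exact/subsetPset/ndG/leq_maxr.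
  by move=> [n _ []/= ? ?]; split; exists n.
move=> k; have [? ?] := Foo k; have [? ?] := Goo k.
split; first exact: measurableX.
by rewrite /prod_measure product_measure1E// lte_mul_pinfty// ge0_fin_numE.
Qed.

HB.instance Definition _ :=
  Measure_isSigmaFinite.Build _ _ _ prod_measure prod_measure_sigma_finite.

End product_measure.

(* The integral of log (dnu/dmu) against nu, and +oo when nu has no density with
   respect to mu. *)
Definition expected_log_density d (T : measurableType d) (R : realType)
    (nu : probability T R) (mu : {sigma_finite_measure set T -> \bar R})
    : \bar R :=
  if `[< nu `<< mu >] then
    \int[nu]_z lne (('d (charge_of_finite_measure nu) '/d mu) z)
  else +oo.

Section information_measures.
Context d (T : measurableType d) (R : realType) (P : probability T R).

(* I(U;V) = E[log (dP_(U,V) / d(P_U x P_V))] *)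
Definition mutual_information d1 d2 (T1 : measurableType d1)
    (T2 : measurableType d2) (U : {RV P >-> T1}) (V : {RV P >-> T2}) : \bar R :=
  expected_log_density (distribution P (rv_pair U V))
    (prod_measure (distribution P U) (distribution P V)).

(* h(U) = - E[log f_U(U)], with f_U the Lebesgue density of U; it is -oo for a
   law without density. *)
Definition diff_entropy (U : {RV P >-> measurableTypeR R}) : \bar R :=
  - expected_log_density (distribution P U) (@lebesgue_measure R).

(* h(U|V) = - E[log f_(U|V)(U|V)]: the density of (U,V) with respect to
   (Lebesgue x P_V) is the conditional density f_(U|V).  The value is -oo when
   the conditional law of U given V fails to have a density on an event of
   positive probability, in agreement with h(U|V) = E[h(U|V=v)] as soon as U
   has a finite variance. *)
Definition cond_diff_entropy d2 (T2 : measurableType d2)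
    (U : {RV P >-> measurableTypeR R}) (V : {RV P >-> T2}) : \bar R :=
  - expected_log_density (distribution P (rv_pair U V))
      (prod_measure (@lebesgue_measure R) (distribution P V)).

(* (U,V) is jointly Gaussian: in law, an affine image of a vector of two
   independent standard normal variables. Degenerate covariances are allowed. *)
Definition jointly_gaussian (U V : {RV P >-> measurableTypeR R}) : Prop :=
  exists (b : 'cV[R]_2) (A : 'M[R]_2),
  forall B : set (measurableTypeR R * measurableTypeR R), measurable B ->
    distribution P (rv_pair U V) B =
    (normal_prob (0 : R) 1 \x normal_prob (0 : R) 1)
      [set z | B ((b 0 0 + A 0 0 * z.1 + A 0 1 * z.2)%R,
                  (b 1 0 + A 1 0 * z.1 + A 1 1 * z.2)%R)].

End information_measures.

Section rate_distortion.
Context d (T : measurableType d) (R : realType) (P : probability T R).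
Context (X S : {RV P >-> measurableTypeR R}).

(* Test channels p_(Y|X), as Markov kernels; the reconstruction Y is the second
   projection of the space (T * R, channel_law P X k). *)
Local Notation channel := (R.-pker (measurableTypeR R) ~> (measurableTypeR R)).

Definition channel_input (k : channel) :
    {RV (channel_law P X k) >-> measurableTypeR R} := X \o fst.

Definition channel_hidden (k : channel) :
    {RV (channel_law P X k) >-> measurableTypeR R} := S \o fst.

Definition channel_output (k : channel) :
    {RV (channel_law P X k) >-> measurableTypeR R} := snd.

Definition feasible (D C : R) : set channel := [set k |
  'E_(channel_law P X k)
    [fun w => ((channel_input k w - channel_output k w) ^+ 2)%R] <= D%:E /\
  cond_diff_entropy (channel_hidden k) (channel_output k) <= C%:E].

Definition is_min_rate (D C : R) (r : \bar R) : Prop :=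
  let rates := [set mutual_information (channel_input k) (channel_output k)
               | k in feasible D C] in
  rates r /\ lbound rates r.

End rate_distortion.

(* Main.v *)
(* In law S = al X + be + s Z with Z a standard normal variable independent of
   (X, Y), and both lower bounds on I(X;Y) come from Gibbs' inequality applied
   to a trial conditional density of X given Y.
   - Distortion: the trial density N(y, D) gives I >= log (sigx^2 / D) / 2.
   - Entropy: let w be the conditional density of S given Y = y and let
     0 < lam < 1.  The integral over x of exp (E[log w (al x + be + s Z)] / lam)
     is at most an explicit constant, a limiting case of the sharp Young
     inequality for a Gaussian kernel.  It is proved by transporting w
     monotonically onto the standard normal law and integrating by parts
     against the Gaussian weight.  The normalised integrand is a trial density
     which bounds h(X|Y), hence I, in terms of h(S|Y); choosing lam as in the
     Gaussian case recovers the conditional entropy power inequality.  If s = 0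
     then h(S|Y) = h(X|Y) + log |al| directly.
   The bounds are attained when X = Y + N(0, D') with D' = min (D, sigx^2 g)
   if 0 < D' < sigx^2, by a constant channel if D' >= sigx^2, and by the
   identity channel if g = 0. *)

From HB Require Import structures.
From mathcomp Require Import all_boot all_order all_algebra.
From mathcomp Require Import all_classical all_reals all_analysis.
From mathcomp Require Import measurable_realfun.
From mathcomp Require Import ring lra.
Require Import Defs.

Set Implicit Arguments.
Unset Strict Implicit.
Unset Printing Implicit Defensive.

Import Order.TTheory GRing.Theory Num.Theory.
Import numFieldNormedType.Exports.

Local Open Scope classical_set_scope.
Local Open Scope ring_scope.
Local Open Scope charge_scope.
Local Open Scope ereal_scope.

(** * Densities and affine substitutions *)

(** An arbitrary channel leaves little control over the conditional density of [S] given [Y]: the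
    noise makes it bounded and continuous, but its tails may be arbitrarily thin. It is therefore
    mixed with [eps] times the Cauchy weight [1 / (1 + t^2)]. This lower bound decays so slowly that
    the logarithm grows at most quadratically, as do the derivative and the square of the transport
    map, so every integral against a Gaussian converges. The price is [ln (1 + eps * pi)], which
    vanishes with [eps]. If [S] denotes the transport map of [w], then [ln w] is a constant minus
    [S^2 / 2] plus [ln S']. Smoothing bounds [E[S^2]] below by the projection of [S] on the span of
    [1] and [Z], and [E[ln S']] above by concavity. What remains is, up to a constant factor, the
    pullback of an [N(0, lam)] density along the smoothed transport, whose mass is at most one.
    Densities of the pair [(X, Y)] are taken relative to the product of its marginals, where one
    exists as soon as [I(X;Y)] is finite. At [g = 0] no single trial density suffices; relaxing [C]
    gives a lower bound by every real number. *)

Lemma measure_indicE d (T : measurableType d) (R : realType) (m : {measure set T -> \bar R})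
  (A : set T) : measurable A -> m A = \int[m]_x (\1_A x)%:E.
Proof. by move=> mA; rewrite integral_indic// setIT. Qed.

Lemma measurable_lne (R : realType) : measurable_fun setT (@lne R).
Proof.
rewrite (_ : @lne R = fun x => if x <= 0 then -oo else
   if x == +oo then +oo else (ln (fine x))%:E); last first.
  by apply/funext => -[r| |]; rewrite /= ?lee_fin ?leNye ?leye_eq.
apply: measurable_fun_ifT => //.
  apply: (measurable_fun_bool true) => /=.
  rewrite [X in _ X](_ : _ = [set x | x <= 0]); last by apply/seteqP; split.
  have := emeasurable_fun_infty_c measurableT (@measurable_id _ (\bar R) setT) 0.
  by rewrite setTI.
apply: measurable_fun_ifT => //.
  apply: (measurable_fun_bool true) => /=.
  rewrite [X in _ X](_ : _ = [set +oo]); first exact: emeasurable_set1.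
  by rewrite setTI; apply/seteqP; split => x /=; [move/eqP|move=> ->; rewrite eqxx].
apply/measurable_EFinP; apply: measurableT_comp; first exact: measurable_ln.
exact: fine_measurable.
Qed.

Section density.
Context d (T : measurableType d) (R : realType).
Context (nu : {finite_measure set T -> \bar R}) (mu : {sigma_finite_measure set T -> \bar R}).
Context (f : T -> \bar R) (mf : measurable_fun setT f) (f0 : forall x, 0 <= f x).
Hypothesis nuf : forall A, measurable A -> nu A = \int[mu]_(x in A) f x.

Lemma density_dominates : nu `<< mu.
Proof.
apply/null_content_dominatesP => A mA muA0; rewrite nuf//.
by apply: null_set_integral => //; exact: measurable_funTS.
Qed.

Lemma density_RN_ae : ae_eq mu setT ('d (charge_of_finite_measure nu) '/d mu) f.
Proof.
have numu := density_dominates.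
apply: integral_ae_eq => //.
- exact: Radon_Nikodym_integrable.
- move=> A _ mA; rewrite -Radon_Nikodym_integral//.
  exact: nuf.
Qed.

Lemma density_ae_nu : {ae nu, forall x, ('d (charge_of_finite_measure nu) '/d mu) x = f x}.
Proof.
have [N [mN muN0 sN]] := density_RN_ae.
exists N; split => //.
  by have /null_content_dominatesP := density_dominates; exact.
by move=> x /= h; apply: sN => /= h'; apply: h; exact: h'.
Qed.

Lemma density_integral (g : T -> \bar R) : measurable_fun setT g ->
  (forall x, 0 <= g x) -> \int[nu]_x g x = \int[mu]_x (g x * f x).
Proof.
move=> mg g0; have numu := density_dominates.
rewrite -(Radon_Nikodym_SigmaFinite.change_of_variables numu)//.
apply: ge0_ae_eq_integral => //.
- apply: emeasurable_funM => //.
  exact: measurable_int (Radon_Nikodym_SigmaFinite.f_integrable numu).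
- exact: emeasurable_funM.
- by move=> x _; rewrite mule_ge0// Radon_Nikodym_SigmaFinite.f_ge0.
- by move=> x _; rewrite mule_ge0.
- apply: ae_eqe_mul2l.
  apply: (ae_eq_trans (ae_eq_Radon_Nikodym_SigmaFinite numu measurableT)).
  exact: density_RN_ae.
Qed.

End density.

(** The Radon-Nikodym derivative is fixed only up to a [mu]-null set, which is [nu]-null by
    domination. Since the integral is taken against [nu], any density may be used. *)
Lemma expected_log_densityE d (T : measurableType d) (R : realType)
    (nu : probability T R) (mu : {sigma_finite_measure set T -> \bar R})
    (f : T -> \bar R) : measurable_fun setT f -> (forall x, 0 <= f x) ->
  (forall A, measurable A -> nu A = \int[mu]_(x in A) f x) ->
  expected_log_density nu mu = \int[nu]_x lne (f x).
Proof.
move=> mf f0 nuf; rewrite /expected_log_density.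
have numu := density_dominates mf nuf.
rewrite ifT; last exact/asboolP.
apply: ae_eq_integral => //.
- by apply: measurableT_comp => //; exact: measurable_lne.
- by apply: measurableT_comp => //; exact: measurable_lne.
- have [N [mN nuN sN]] := density_ae_nu mf nuf.
  exists N; split => // x /= h; apply: sN => /= h'; apply: h => _; by rewrite h'.
Qed.

(** Meant for [f] the logarithm of a density, whose negative part may have infinite integral;
    positive and negative parts are compared separately. *)
Lemma integral_le_integrable d (T : measurableType d) (R : realType)
    (mu : {measure set T -> \bar R}) (f g : T -> \bar R) :
  measurable_fun setT f -> mu.-integrable setT g -> (forall x, f x <= g x) ->
  \int[mu]_x f x <= \int[mu]_x g x.
Proof.
move=> mf ig fg; rewrite [leLHS]integralE [leRHS]integralE.
apply: leeB.
- apply: ge0_le_integral => //.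
  + exact: measurable_funepos.
  + by apply: measurable_funepos; exact: measurable_int ig.
  + by move=> x _; apply: (@funepos_le _ _ setT); rewrite ?inE.
- apply: ge0_le_integral => //.
  + by apply: measurable_funeneg; exact: measurable_int ig.
  + exact: measurable_funeneg.
  + by move=> x _; apply: (@funeneg_le _ _ setT); rewrite ?inE.
Qed.

Section lebesgue_affine.
Context (R : realType).
Local Notation leb := (@lebesgue_measure R).
Context (a b : R) (a0 : a != 0%R).

Let phi (x : measurableTypeR R) : measurableTypeR R := (a * x + b)%R.

Let mphi : measurable_fun setT phi.
Proof. by apply: measurable_funD => //; exact: measurable_funM. Qed.

(** Lebesgue measure is determined by its values on the intervals []p, q]], so the image measure
    under [phi], scaled by [|a|], is tested on these only. *)
Lemma lebesgue_measure_affine (A : set (measurableTypeR R)) : measurable A ->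
  leb A = `|a|%:E * leb (phi @^-1` A).
Proof.
pose m := mscale (NngNum (normr_ge0 a)) (pushforward leb phi).
move=> mA; rewrite -[RHS]/(m mphi A).
apply: lebesgue_measure_unique => // _ [[p q]] _ <-.
transitivity (`|a|%:E * leb (phi @^-1` `]p, q])); last by [].
have [a_gt0|a_le0] := ltP 0%R a.
  rewrite (_ : _ @^-1` _ = `]((p - b) / a)%R, ((q - b) / a)%R]%classic); last first.
    apply/seteqP; split => x /=; rewrite !in_itv/= /phi.
      by rewrite ltr_pdivrMr// ler_pdivlMr// ltrBlDr lerBrDr (mulrC x).
    by rewrite ltr_pdivrMr// ler_pdivlMr// ltrBlDr lerBrDr (mulrC x).
  rewrite !lebesgue_measure_itv/= !lte_fin ltr_pM2r ?invr_gt0// ltrD2r.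
  case: ifPn => _; last by rewrite mule0.
  rewrite gtr0_norm// -!EFinD -EFinM; congr EFin.
  by field; rewrite gt_eqF.
have a_lt0 : (a < 0)%R by rewrite lt_neqAle a0.
rewrite (_ : _ @^-1` _ = `[((q - b) / a)%R, ((p - b) / a)%R[%classic); last first.
  apply/seteqP; split => x /=; rewrite !in_itv/= /phi.
    by rewrite ltr_ndivlMr// ler_ndivrMr// ltrBlDr lerBrDr (mulrC x) andbC.
  by rewrite ltr_ndivlMr// ler_ndivrMr// ltrBlDr lerBrDr (mulrC x) andbC.
rewrite !lebesgue_measure_itv/= !lte_fin ltr_nM2r ?invr_lt0// ltrD2r.
case: ifPn => _; last by rewrite mule0.
rewrite ltr0_norm// -!EFinD -EFinM; congr EFin.
by field.
Qed.

Lemma ge0_integral_affine (f : R -> \bar R) : measurable_fun setT f ->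
  (forall x, 0 <= f x) ->
  \int[leb]_x f x = `|a|%:E * \int[leb]_x f (a * x + b)%R.
Proof.
move=> mf f0.
pose m := mscale (NngNum (normr_ge0 a)) (pushforward leb phi).
rewrite (eq_measure_integral (m mphi)); last by move=> A mA _; exact: lebesgue_measure_affine.
rewrite ge0_integral_mscale//= ge0_integral_pushforward//.
Qed.

End lebesgue_affine.

(** * Integration of derivatives over the whole line *)

Section line_calculus.
Context (R : realType).
Local Open Scope ring_scope.
Local Notation leb := (@lebesgue_measure R).
Implicit Types (F f : R -> R).

Lemma is_derive_continuous F f : (forall x, is_derive x (1 : R) F (f x)) -> continuous F.
Proof.
by move=> dF x; apply/differentiable_continuous/derivable1_diffP; case: (dF x).
Qed.

Lemma FTC2_is_derive F f a b : (forall x, is_derive x (1 : R) F (f x)) ->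
  continuous f -> (a < b)%R ->
  (\int[leb]_(x in `[a, b]) (f x)%:E = (F b - F a)%:E)%E.
Proof.
move=> dF cf ab; have cF := is_derive_continuous dF.
rewrite (@continuous_FTC2 _ f F)//.
- exact: continuous_subspaceT.
- split.
  + by move=> x _; case: (dF x).
  + by apply: cvg_at_right_filter; exact: cF.
  + by apply: cvg_at_left_filter; exact: cF.
- by move=> x _; rewrite derive1E; case: (dF x).
Qed.

Lemma bigcup_itvNn : \bigcup_n `[- n.+1%:R, n.+1%:R]%classic = [set: R].
Proof.
apply/seteqP; split => // x _.
exists (Num.truncn `|x : R|) => //=; rewrite in_itv/= -ler_norml ltW//.
exact: truncnS_gt.
Qed.

Lemma cvgnS_pinfty : (n.+1%:R : R) @[n --> \oo] --> +oo.
Proof. by move: (@cvgr_idn R); rewrite -(@cvg_shiftS R^o). Qed.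

(** Integrations by parts take this form, with [F] the product being differentiated. On growing
    symmetric intervals only boundary values remain, and dominated convergence with majorant [|f|]
    passes to the line. *)
Lemma integral_derive_eq0 F f : (forall x, is_derive x (1 : R) F (f x)) ->
  continuous f -> leb.-integrable setT (EFin \o f) ->
  F x @[x --> +oo%R] --> (0 : R) -> F x @[x --> -oo%R] --> (0 : R) ->
  (\int[leb]_x (f x)%:E = 0)%E.
Proof.
move=> dF cf intf Fy FNy.
pose I (n : nat) := `[- n.+1%:R, n.+1%:R]%classic : set R.
have mf : measurable_fun setT f by exact: continuous_measurable_fun.
have h1 : (\int[leb]_x ((EFin \o f) \_ (I n)) x @[n --> \oo] --> \int[leb]_x (f x)%:E)%E.
  apply: (@dominated_cvg _ _ _ leb setT measurableT _ _ (fun x => `|(f x)%:E|%E)) => //.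
  - move=> n; apply/(measurable_restrictT _ _).1 => //.
    + exact: measurable_itv.
    + by apply: measurable_funTS; exact/measurable_EFinP.
  - move=> x _; apply: cvg_near_cst.
    have [k _ kx] : (\bigcup_n I n) x by rewrite bigcup_itvNn.
    exists k => // n /= kn; rewrite patchE mem_set//.
    move: kx; rewrite /I/= !in_itv/= => /andP[h1 h2]; apply/andP; split.
      by apply: le_trans h1; rewrite lerN2 ler_nat.
    by apply: (le_trans h2); rewrite ler_nat.
  - exact: integrable_abse.
  - by move=> n x _; rewrite patchE; case: ifPn => //; rewrite abse0.
have h2 : (\int[leb]_x ((EFin \o f) \_ (I n)) x @[n --> \oo] --> (0 : \bar R))%E.
  under eq_fun do rewrite -integral_mkcond (FTC2_is_derive dF cf) ?gtrN ?ltr0n//.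
  apply: cvg_EFin; first exact: nearW.
  rewrite -(subr0 (0 : R)); apply: cvgB.
    by apply: (cvg_comp _ _ _ Fy); exact: cvgnS_pinfty.
  by apply: (cvg_comp _ _ _ FNy); apply/cvgNrNy; exact: cvgnS_pinfty.
exact: (cvg_unique _ h1 h2).
Qed.

End line_calculus.

Section density_signed.
Context d (T : measurableType d) (R : realType).
Context (nu : {finite_measure set T -> \bar R}) (mu : {sigma_finite_measure set T -> \bar R}).
Context (f : T -> \bar R) (mf : measurable_fun setT f) (f0 : forall x, 0 <= f x).
Hypothesis nuf : forall A, measurable A -> nu A = \int[mu]_(x in A) f x.

Let funeposM_ge0 (g : T -> \bar R) x : (fun x => g x * f x)^\+ x = g^\+ x * f x.
Proof.
have [g0|g0] := leP 0 (g x).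
  rewrite (@ge0_funeposE _ _ [set x])//; last 2 first.
  - by move=> _ ->; exact: mule_ge0.
  - by rewrite inE.
  by rewrite (@ge0_funeposE _ _ [set x])// ?inE//; move=> _ ->.
rewrite (@le0_funeposE _ _ [set x])//; last 2 first.
- by move=> _ ->; rewrite mule_le0_ge0// ltW.
- by rewrite inE.
by rewrite (@le0_funeposE _ _ [set x])// ?mul0e ?inE//; move=> _ ->; exact: ltW.
Qed.

Let funenegM_ge0 (g : T -> \bar R) x : (fun x => g x * f x)^\- x = g^\- x * f x.
Proof.
rewrite -!funeposN -funeposM_ge0; congr (funepos _ x).
by apply/funext => y /=; rewrite mulNe.
Qed.

(** Multiplication by [f >= 0] commutes with taking positive and negative parts, so the nonnegative
    case applies to each part and integrability of [g] is not assumed. *)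
Lemma density_integral_signed (g : T -> \bar R) : measurable_fun setT g ->
  \int[nu]_x g x = \int[mu]_x (g x * f x).
Proof.
move=> mg; rewrite [LHS]integralE [RHS]integralE; congr (_ - _).
  rewrite (density_integral mf f0 nuf)//; first by apply: eq_integral => x _; rewrite funeposM_ge0.
  exact: measurable_funepos.
rewrite (density_integral mf f0 nuf)//; first by apply: eq_integral => x _; rewrite funenegM_ge0.
exact: measurable_funeneg.
Qed.

Lemma density_integrableE (g : T -> \bar R) : measurable_fun setT g ->
  nu.-integrable setT g <-> mu.-integrable setT (fun x => g x * f x).
Proof.
move=> mg.
have e : \int[nu]_x `|g x| = \int[mu]_x `|g x * f x|.
  rewrite (density_integral mf f0 nuf)//; last exact: measurableT_comp.
  by apply: eq_integral => x _; rewrite abseM (gee0_abs (f0 x)).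
split => /integrableP[_ ig]; apply/integrableP; split => //.
- exact: emeasurable_funM.
- by rewrite -e.
- by rewrite e.
Qed.

End density_signed.

(** * The normal law and its moments *)

Section normal.
Context (R : realType).
Local Open Scope ring_scope.
Local Notation leb := (@lebesgue_measure R).
Implicit Types (m s x : R).

Lemma normal_pdf_gt0 m s x : s != 0 -> 0 < normal_pdf m s x.
Proof. by move=> s0; rewrite normal_pdfE// mulr_gt0 ?normal_peak_gt0 ?expR_gt0. Qed.

Lemma measurable_normal_pdfE m s : measurable_fun setT (fun x => (normal_pdf m s x)%:E).
Proof. by apply/measurable_EFinP; exact: measurable_normal_pdf. Qed.

Lemma integral_normal_prob m s (g : R -> \bar R) : measurable_fun setT g ->
  (\int[normal_prob m s]_x g x = \int[leb]_x (g x * (normal_pdf m s x)%:E))%E.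
Proof.
move=> mg; apply: density_integral_signed => //.
- exact: measurable_normal_pdfE.
- by move=> x; rewrite lee_fin normal_pdf_ge0.
Qed.

Lemma integrable_normal_probE m s (g : R -> \bar R) : measurable_fun setT g ->
  (normal_prob m s).-integrable setT g <->
  leb.-integrable setT (fun x => g x * (normal_pdf m s x)%:E)%E.
Proof.
move=> mg; apply: density_integrableE => //.
- exact: measurable_normal_pdfE.
- by move=> x; rewrite lee_fin normal_pdf_ge0.
Qed.

(** The scale [s] may be negative, since the noise coefficient found by regression has no fixed
    sign; the factor [1 / |s|] inside [normal_peak] cancels the Jacobian. *)
Lemma ge0_integral_normal_std m s (g : R -> \bar R) : s != 0 ->
  measurable_fun setT g -> (forall x, 0 <= g x)%E ->
  (\int[normal_prob m s]_x g x = \int[normal_prob (0 : R) 1]_v g (s * v + m)%R)%E.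
Proof.
move=> s0 mg g0.
have ma : measurable_fun setT (fun v : R => s * v + m).
  by apply: measurable_funD => //; exact: measurable_funM.
rewrite (integral_normal_prob m s mg) (integral_normal_prob 0 1 (measurableT_comp mg ma)).
rewrite (@ge0_integral_affine _ s m s0)//; last 2 first.
- by apply: emeasurable_funM => //; exact: measurable_normal_pdfE.
- by move=> x; rewrite mule_ge0// lee_fin normal_pdf_ge0.
rewrite -ge0_integralZl//; last 2 first.
- apply: emeasurable_funM => //; first exact: measurableT_comp.
  by apply: (measurableT_comp (measurable_normal_pdfE m s)).
- by move=> x _; rewrite mule_ge0// lee_fin normal_pdf_ge0.
apply: eq_integral => v _; rewrite muleCA; congr (_ * _)%E.
rewrite -EFinM; congr EFin.
rewrite !normal_pdfE// /normal_fun mulrA; congr (_ * _).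
  rewrite /normal_peak expr1n mul1r -mulrnAr sqrtrM ?sqr_ge0// sqrtr_sqr invfM mulrA.
  by rewrite divff ?mul1r// normr_eq0.
congr expR; rewrite addrK subr0 expr1n exprMn.
have ? : s ^+ 2 != 0 by rewrite expf_neq0.
by field.
Qed.

End normal.

Section normal_moments.
Context (R : realType).
Local Open Scope ring_scope.
Local Notation leb := (@lebesgue_measure R).
Local Notation phi := (normal_pdf (0 : R) 1).
Local Notation gamma := (normal_prob (0 : R) 1).
Implicit Types (x c : R) (K : R -> R).

(** The Cauchy weight serves twice: as an integrable majorant for Gaussian moments and, through its
    exact mass, as the regularisation of conditional densities. *)
Lemma integral_cauchy : (\int[leb]_x ((1 + x ^+ 2)^-1)%:E = pi%:E)%E.
Proof.
rewrite (ge0_symfun_integralT (f := fun x => (1 + x ^+ 2)^-1)).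
- rewrite -set_itvcy (integral0y_oneDsqr R) -EFinM; congr EFin.
  by field.
- by move=> x; rewrite invr_ge0 addr_ge0// sqr_ge0.
- exact: continuous_oneDsqrV.
- by move=> x /=; rewrite sqrrN.
Qed.

Lemma integrable_cauchy : leb.-integrable setT (fun x => ((1 + x ^+ 2)^-1)%:E).
Proof.
apply/integrableP; split.
  by apply/measurable_EFinP; apply: continuous_measurable_fun; exact: continuous_oneDsqrV.
under eq_integral do rewrite gee0_abs ?lee_fin ?invr_ge0 ?addr_ge0 ?sqr_ge0//.
by rewrite integral_cauchy ltry.
Qed.

Lemma stdnormal_pdfE x : phi x = normal_peak 1 * expR (- x ^+ 2 / 2).
Proof. by rewrite normal_pdfE ?oner_neq0// /normal_fun subr0 expr1n. Qed.

(** The constant comes from [exp (x^2/2) = exp (x^2/6) ^ 3 >= (1 + x^2/6) ^ 3 >= ((1 + x^2) / 6) ^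
    3]. *)
Lemma stdnormal_pdf_decay x : (1 + x ^+ 2) ^+ 2 * phi x <= 6 ^+ 3 * normal_peak 1 / (1 + x ^+ 2).
Proof.
have x2 : 0 <= x ^+ 2 by exact: sqr_ge0.
have p0 := @normal_peak_ge0 R 1.
rewrite stdnormal_pdfE mulrCA (mulrC (6 ^+ 3)) -[leRHS]mulrA.
apply: (ler_wpM2l p0).
rewrite mulNr expRN ler_pdivlMr; last by lra.
rewrite mulrAC -exprSr ler_pdivrMr ?expR_gt0//.
have -> : x ^+ 2 / 2 = 3%:R * (x ^+ 2 / 6) by field.
rewrite expRM_natl.
have h := expR_ge1Dx (x ^+ 2 / 6).
apply: (@le_trans _ _ (6 ^+ 3 * (1 + x ^+ 2 / 6) ^+ 3)).
  rewrite -exprMn lerXn2r ?nnegrE//; lra.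
by rewrite ler_wpM2l ?exprn_ge0// lerXn2r ?nnegrE ?expR_ge0//; lra.
Qed.

(** Supplies the vanishing boundary terms for [integral_derive_eq0]; the decay estimate reduces both
    limits to a bound [C / |x|]. *)
Lemma cvg0_normal K c : (forall x, `|K x| <= c * ((1 + x ^+ 2) ^+ 2 * phi x)) ->
  K x @[x --> +oo] --> (0 : R) /\ K x @[x --> -oo] --> (0 : R).
Proof.
move=> Kc.
pose C := `|c| * (6 ^+ 3 * normal_peak 1) + 1.
have C0 : 0 < C by rewrite ltr_wpDl// mulr_ge0// mulr_ge0// normal_peak_ge0.
have KC x : x != 0 -> `|K x| <= C / `|x|.
  move=> x0; apply: (le_trans (Kc x)).
  have ax : 0 < `|x| by rewrite normr_gt0.
  apply: (@le_trans _ _ (`|c| * (6 ^+ 3 * normal_peak 1 / (1 + x ^+ 2)))).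
    apply: (@le_trans _ _ (`|c| * ((1 + x ^+ 2) ^+ 2 * phi x))).
      apply: ler_wpM2r; last exact: ler_norm.
      by rewrite mulr_ge0 ?sqr_ge0// normal_pdf_ge0.
    by apply: ler_wpM2l => //; exact: stdnormal_pdf_decay.
  rewrite mulrA; apply: ler_pM.
  - by rewrite mulr_ge0// mulr_ge0// normal_peak_ge0.
  - by rewrite invr_ge0; have := sqr_ge0 x; lra.
  - by rewrite /C lerDl.
  - rewrite lef_pV2 ?posrE//; last by have := sqr_ge0 x; lra.
    by rewrite -[x ^+ 2]real_normK ?num_real//; have := sqr_ge0 (`|x| - 1); lra.
split; apply/cvgr0Pnorm_lt => e e0; near=> x.
  have xp : C / e < x by near: x; apply: nbhs_pinfty_gt; exact: num_real.
  have x0 : 0 < x by apply: lt_trans xp; rewrite divr_gt0.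
  apply: (le_lt_trans (KC x _)); first by rewrite gt_eqF.
  by rewrite gtr0_norm// ltr_pdivrMr// mulrC -ltr_pdivrMr.
have xp : x < - (C / e) by near: x; apply: nbhs_ninfty_lt; exact: num_real.
have x0 : x < 0 by apply: (lt_trans xp); rewrite oppr_lt0 divr_gt0.
apply: (le_lt_trans (KC x _)); first by rewrite lt_eqF.
by rewrite ltr0_norm// ltr_pdivrMr ?oppr_gt0// mulrC -ltr_pdivrMr// ltrNr.
Unshelve. all: end_near. Qed.

Lemma is_derive_stdnormal_pdf x : is_derive x (1 : R) phi (- (x * phi x)).
Proof.
have -> : phi = fun x => normal_peak 1 * expR (- x ^+ 2 / 2).
  by apply/funext => y; rewrite stdnormal_pdfE.
apply: is_derive_eq.
by rewrite /GRing.scale/= -mulr_natr; field.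
Qed.

Lemma integrable_sqr_normal : gamma.-integrable setT (fun x => (x ^+ 2)%:E).
Proof.
apply/integrable_normal_probE; first by apply/measurable_EFinP; exact: measurable_funX.
pose c := 6 ^+ 3 * normal_peak 1 : R.
apply: (@le_integrable _ _ _ leb setT measurableT _ (fun x => (c%:E * ((1 + x ^+ 2)^-1)%:E)%E)).
- apply: emeasurable_funM; last exact: measurable_normal_pdfE.
  by apply/measurable_EFinP; exact: measurable_funX.
- move=> x _; rewrite -!EFinM lee_fin.
  have x2 := sqr_ge0 x; have p0 := normal_pdf_ge0 (0:R) 1 x.
  rewrite !ger0_norm; last 2 first.
  + by rewrite mulr_ge0// /c ?mulr_ge0 ?normal_peak_ge0// invr_ge0; lra.
  + by rewrite mulr_ge0.
  apply: le_trans (stdnormal_pdf_decay x).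
  apply: ler_wpM2r => //; nra.
- apply: integrableZl => //.
  exact: integrable_cauchy.
Qed.

End normal_moments.

Section normal_moments2.
Context (R : realType).
Local Open Scope ring_scope.
Local Notation leb := (@lebesgue_measure R).
Local Notation phi := (normal_pdf (0 : R) 1).
Local Notation gamma := (normal_prob (0 : R) 1).
Implicit Types (x c : R) (K : R -> R).

Lemma integrable_id_normal : gamma.-integrable setT (fun x => x%:E).
Proof.
apply: (@le_integrable _ _ _ gamma setT measurableT _ (fun x : R => (1 + x ^+ 2)%:E)).
- by apply/measurable_EFinP.
- move=> x _; rewrite lee_fin [leRHS]ger0_norm ?addr_ge0 ?sqr_ge0//.
  have := sqr_ge0 (`|x| - 1); rewrite -[x ^+ 2]real_normK ?num_real//.
  by have := normr_ge0 x; nra.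
- under eq_fun do rewrite EFinD.
  apply: integrableD => //; last exact: integrable_sqr_normal.
  exact: finite_measure_integrable_cst.
Qed.

Lemma integral_id_normal : (\int[gamma]_x x%:E = 0)%E.
Proof.
have mid : measurable_fun setT (EFin : R -> \bar R) by exact/measurable_EFinP.
rewrite integral_normal_prob//.
have ipdf := (integrable_normal_probE 0 1 mid).1 integrable_id_normal.
transitivity (\int[leb]_x (x * phi x)%:E)%E.
  by apply: eq_integral => x _; rewrite EFinM.
have cphi : continuous phi by apply: continuous_normal_pdf; rewrite oner_neq0.
have [c1 c2] := @cvg0_normal R (fun x => - phi x) 1 (fun x => ltac:(
  rewrite mul1r normrN ger0_norm ?normal_pdf_ge0// ler_peMl ?normal_pdf_ge0//;
  have := sqr_ge0 x; nra)).
apply: (@integral_derive_eq0 _ (fun x => - phi x)) => //.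
- move=> x; have := is_derive_stdnormal_pdf x => h.
  by apply: is_derive_eq; rewrite opprK.
- by move=> x; apply: cvgM; [exact: cvg_id|exact: cphi].
Qed.

(** The derivative of [x * phi x] is [phi x - x^2 * phi x], so the second moment equals the mass of
    [phi]. *)
Lemma integral_sqr_normal : (\int[gamma]_x (x ^+ 2)%:E = 1)%E.
Proof.
have msq : measurable_fun setT (fun x : R => (x ^+ 2)%:E).
  by apply/measurable_EFinP; exact: measurable_funX.
rewrite integral_normal_prob//.
have ipdf := (integrable_normal_probE 0 1 msq).1 (integrable_sqr_normal R).
have cphi : continuous phi by apply: continuous_normal_pdf; rewrite oner_neq0.
have [c1 c2] := @cvg0_normal R (fun x => x * phi x) 1 (fun x => ltac:(
  rewrite mul1r normrM [`|phi x|]ger0_norm ?normal_pdf_ge0//;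
  apply: ler_wpM2r; rewrite ?normal_pdf_ge0//;
  have := sqr_ge0 (`|x| - 1); rewrite -[x ^+ 2]real_normK ?num_real//;
  have := normr_ge0 x; nra)).
have e0 : (\int[leb]_x (phi x - x ^+ 2 * phi x)%:E = 0)%E.
  apply: (@integral_derive_eq0 _ (fun x => x * phi x)) => //.
  - move=> x; have := is_derive_stdnormal_pdf x => h.
    by apply: is_derive_eq; rewrite /GRing.scale/=; ring.
  - move=> x; apply: cvgB; first exact: cphi.
    by apply: cvgM; [exact: exprn_continuous|exact: cphi].
  - rewrite (_ : _ \o _ = (fun x => (phi x)%:E - (x ^+ 2)%:E * (phi x)%:E)%E)//.
    by apply: integrableB => //; exact: integrable_normal_pdf.
move: e0.
under eq_integral do rewrite EFinB EFinM.
rewrite integralB//=; last exact: integrable_normal_pdf.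
rewrite integral_normal_pdf.
have := integrable_fin_num measurableT ipdf.
move: (integral _ _ _) => [a| |]// _ [] /eqP.
by rewrite subr_eq0 => /eqP <-.
Qed.

(** Bounded increments of [F] replace limits at infinity, and monotone convergence does the rest.
    Later [F] is a distribution function composed with an increasing map that is not known to be
    onto. *)
Lemma ge0_integral_derive_le (F f : R -> R) c :
  (forall x, is_derive x (1 : R) F (f x)) ->
  continuous f -> (forall x, 0 <= f x) -> (forall x y, F y - F x <= c) ->
  (\int[leb]_x (f x)%:E <= c%:E)%E.
Proof.
move=> dF cf f0 Fc.
pose I (n : nat) := `[- n.+1%:R, n.+1%:R]%classic : set R.
have mf : measurable_fun setT f by exact: continuous_measurable_fun.
have h : (\int[leb]_(x in I n) (f x)%:E @[n --> \oo] --> \int[leb]_(x in \bigcup_n I n) (f x)%:E)%E.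
  apply: ge0_nondecreasing_set_cvg_integral.
  - move=> n m nm; apply/subsetPset => x; rewrite /I/= !in_itv/= => /andP[h1 h2].
    apply/andP; split.
      by apply: le_trans h1; rewrite lerN2 ler_nat.
    by apply: (le_trans h2); rewrite ler_nat.
  - by move=> n; exact: measurable_itv.
  - by move=> n; apply: measurable_funTS; exact/measurable_EFinP.
  - by move=> n x _; rewrite lee_fin.
rewrite bigcup_itvNn in h.
rewrite -(cvg_lim _ h)//; apply: lime_le; first by apply/cvg_ex; eexists; exact: h.
by apply: nearW => n; rewrite (FTC2_is_derive dF cf) ?gtrN ?ltr0n// lee_fin.
Qed.

End normal_moments2.

(** * Distribution functions and Gaussian tails *)

Section cdf_of_density.
Context (R : realType).
Local Open Scope ring_scope.
Local Notation leb := (@lebesgue_measure R).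
Context (p : R -> R) (cp : continuous p) (p0 : forall x, 0 < p x).
Hypothesis ip : (\int[leb]_x (p x)%:E = 1)%E.

Definition pdf_cdf (x : R) : R := \int[leb]_(t in `]-oo, x]) p t.
Definition pdf_ccdf (x : R) : R := \int[leb]_(t in `]x, +oo[) p t.

Lemma pdf_integrable : leb.-integrable setT (EFin \o p).
Proof.
apply/integrableP; split; first by apply/measurable_EFinP; exact: continuous_measurable_fun.
by under eq_integral do rewrite /= ger0_norm ?ltW//; rewrite ip ltry.
Qed.

Let ipS (D : set R) : measurable D -> leb.-integrable D (EFin \o p).
Proof. by move=> mD; apply: (integrableS _ _ (subsetT _)) => //; exact: pdf_integrable. Qed.

Lemma pdf_cdf_derive x : is_derive x (1 : R) pdf_cdf (p x).
Proof.
have xu : x < x + 1 :> R by rewrite ltrDl.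
have [d1 d2] := @continuous_FTC1 R p -oo%O x (x + 1) xu (ipS (measurable_itv _)) (ltNyr _) (@cp x).
apply: DeriveDef; first exact: d1.
by rewrite -derive1E; exact: d2.
Qed.

Lemma pdf_cdf_continuous : continuous pdf_cdf.
Proof. exact: is_derive_continuous pdf_cdf_derive. Qed.

Lemma pdf_cdf_MVT x y : x < y ->
  exists2 c, x < c < y & pdf_cdf y - pdf_cdf x = p c * (y - x).
Proof.
move=> xy; have [c + e] := MVT xy (fun z _ => pdf_cdf_derive z)
  (continuous_subspaceT pdf_cdf_continuous).
by rewrite in_itv/= => h; exists c.
Qed.

Lemma pdf_cdf_lt x y : x < y -> pdf_cdf x < pdf_cdf y.
Proof.
move=> xy; have [c _ e] := pdf_cdf_MVT xy.
by rewrite -subr_gt0 e mulr_gt0// subr_gt0.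
Qed.

Lemma pdf_cdf_inj : injective pdf_cdf.
Proof.
move=> x y e; have [/pdf_cdf_lt|/pdf_cdf_lt|//] := ltgtP x y; by rewrite e ltxx.
Qed.

Lemma pdf_cdfD x : pdf_cdf x + pdf_ccdf x = 1.
Proof.
rewrite -Rintegral_setU//=.
- rewrite (_ : _ `|` _ = setT) /Rintegral ?ip//.
  by rewrite -setCitvl setUv.
- by apply: ipS; apply: measurableU; exact: measurable_itv.
- by rewrite -setCitvl; exact/disj_setPCl.
Qed.

Lemma pdf_cdf_ge0 x : 0 <= pdf_cdf x.
Proof. by apply: Rintegral_ge0 => t _; exact: ltW. Qed.

Lemma pdf_ccdf_ge0 x : 0 <= pdf_ccdf x.
Proof. by apply: Rintegral_ge0 => t _; exact: ltW. Qed.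

Lemma pdf_cdf_gt0 x : 0 < pdf_cdf x.
Proof. by apply: (le_lt_trans (pdf_cdf_ge0 (x - 1))); apply: pdf_cdf_lt; rewrite gtrBl. Qed.

Lemma pdf_cdf_le1 x : pdf_cdf x <= 1.
Proof. by rewrite -(pdf_cdfD x) lerDl pdf_ccdf_ge0. Qed.

Lemma pdf_cdf_lt1 x : pdf_cdf x < 1.
Proof. by apply: (@lt_le_trans _ _ (pdf_cdf (x + 1))); [apply: pdf_cdf_lt; rewrite ltrDl|exact: pdf_cdf_le1]. Qed.

End cdf_of_density.

Section mills.
Context (R : realType).
Local Open Scope ring_scope.
Local Notation leb := (@lebesgue_measure R).
Local Notation phi := (normal_pdf (0 : R) 1).
Local Notation Phi := (pdf_cdf phi).

Let cphi : continuous phi.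
Proof. by apply: continuous_normal_pdf; rewrite oner_neq0. Qed.

Let phi_gt0 x : 0 < phi x.
Proof. by apply: normal_pdf_gt0; rewrite oner_neq0. Qed.

Let iphi : (\int[leb]_x (phi x)%:E = 1)%E.
Proof. exact: integral_normal_pdf. Qed.

Let peak_gt0 : 0 < normal_peak (1 : R).
Proof. by apply: normal_peak_gt0; rewrite oner_neq0. Qed.

(* Gaussian tails: for x beyond u on the side away from the origin,
   exp (- x^2/2) <= exp (- u^2/2) * exp (- (x-u)^2/2). *)
Let tail (u : R) (D : set R) : measurable D -> (forall x, D x -> 0 <= u * (x - u)) ->
  \int[leb]_(t in D) phi t <= expR (- u ^+ 2 / 2).
Proof.
move=> mD uD.
have -> : expR (- u ^+ 2 / 2) = \int[leb]_t (expR (- u ^+ 2 / 2) * normal_pdf u 1 t).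
  rewrite RintegralZl//; last exact: integrable_normal_pdf.
  by rewrite /Rintegral integral_normal_pdf mulr1.
rewrite Rintegral_mkcond; apply: le_Rintegral => //.
- rewrite -restrict_EFin; apply/integrable_restrict => //=; rewrite setTI.
  apply: (integrableS _ _ (subsetT _)) => //; exact: integrable_normal_pdf.
- have := integrableZl measurableT (expR (- u ^+ 2 / 2)) (integrable_normal_pdf u 1).
  by apply: eq_integrable.
- move=> x _; rewrite patchE; case: ifPn; last first.
    by rewrite mulr_ge0 ?expR_ge0 ?normal_pdf_ge0.
  rewrite inE => /uD h.
  rewrite stdnormal_pdfE normal_pdfE ?oner_neq0// /normal_fun expr1n.
  rewrite mulrCA -expRD; apply: ler_wpM2l; first exact: ltW.
  by rewrite ler_expR; lra.
Qed.

(** The tail on the side of [u] is the small one. With the minimum, a lower bound on both tails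
    controls [u^2] whatever its sign. *)
Lemma stdnormal_cdf_tail u : Num.min (Phi u) (pdf_ccdf phi u) <= expR (- u ^+ 2 / 2).
Proof.
rewrite ge_min; have [u0|u0] := leP 0 u.
  apply/orP; right; apply: tail => // x /=; rewrite in_itv/= andbT => ux.
  by rewrite mulr_ge0// subr_ge0 ltW.
apply/orP; left; apply: tail => // x /=; rewrite in_itv/= => ux.
by rewrite mulr_le0 ?subr_le0// ltW.
Qed.

Lemma stdnormal_cdf_surj (c : R) : 0 < c < 1 -> exists u, Phi u = c.
Proof.
move=> /andP[c0 c1].
(* The point [1 + 2 / e] works because half its square is at least [2 / e], so [1 + x <= exp x]
   already exceeds [1 / e]. It provides explicit endpoints for the intermediate value theorem. *)
have small (e : R) : 0 < e -> expR (- (1 + 2 / e) ^+ 2 / 2) < e.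
  move=> e0; rewrite mulNr expRN -[ltRHS]invrK ltf_pV2 ?posrE ?invr_gt0 ?expR_gt0//.
  apply: lt_le_trans (expR_ge1Dx _).
  have : 0 < e^-1 by rewrite invr_gt0.
  set f := e^-1 => f0; nra.
have Phi0u (u : R) : u <= 0 -> Phi u <= expR (- u ^+ 2 / 2).
  move=> u0; apply: tail => // x /=; rewrite in_itv/= => ux.
  by rewrite mulr_le0 ?subr_le0.
have cPhi0u (u : R) : 0 <= u -> pdf_ccdf phi u <= expR (- u ^+ 2 / 2).
  move=> u0; apply: tail => // x /=; rewrite in_itv/= andbT => ux.
  by rewrite mulr_ge0// subr_ge0 ltW.
pose a := - (1 + 2 / c); pose b := 1 + 2 / (1 - c).
have a0 : a <= 0 by rewrite /a oppr_le0 addr_ge0// divr_ge0// ltW.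
have c1' : 0 < 1 - c by rewrite subr_gt0.
have b0 : 0 <= b by rewrite /b addr_ge0// divr_ge0// ltW.
have Pa : Phi a < c by apply: (le_lt_trans (Phi0u _ a0)); rewrite /a sqrrN small.
have Pb : c < Phi b.
  have := le_lt_trans (cPhi0u _ b0) (small _ c1').
  by have := pdf_cdfD cphi phi_gt0 iphi b; lra.
have ab : a <= b by exact: le_trans b0.
have [u _ <-] := @IVT R Phi a b c ab
  (continuous_subspaceT (pdf_cdf_continuous cphi phi_gt0 iphi)) ltac:(
  rewrite ge_min (ltW Pa)/= le_max (ltW Pb) orbT//).
by exists u.
Qed.

End mills.

Section positive_integral.
Context d (T : measurableType d) (R : realType) (P : probability T R).
Local Open Scope ring_scope.

(** A zero integral would make a positive function vanish almost everywhere, hence make the whole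
    space null, against total mass one. *)
Lemma Rintegral_gt0 (f : T -> R) : P.-integrable setT (EFin \o f) ->
  (forall x, 0 < f x) -> 0 < \int[P]_x f x.
Proof.
move=> intf f0; rewrite lt_neqAle Rintegral_ge0 ?andbT; last by move=> x _; exact: ltW.
apply/eqP => /esym i0.
have mf := measurable_int _ intf.
have e : (\int[P]_x `|(EFin \o f) x| = 0)%E.
  under eq_integral do rewrite /= gtr0_norm//.
  rewrite -[LHS]fineK; first exact: congr1 i0.
  exact: integrable_fin_num.
have [N [mN N0 sN]] := (ae_eq_integral_abs P measurableT mf).1 e.
have NT : N = setT.
  apply/seteqP; split => // x _; apply: sN => /= /(_ I) [] /eqP.
  by rewrite gt_eqF.
have [] := etrans (esym N0) (etrans (congr1 P NT) (probability_setT P)).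
by move/eqP; rewrite eq_sym oner_eq0.
Qed.

End positive_integral.

Section is_mean.
Context d (T : measurableType d) (R : realType) (P : probability T R).
Local Open Scope ring_scope.
Implicit Types (f g : T -> R) (a b k : R).

(** Integrability is bundled with the value, so that moments of linear combinations are computed
    without repeated side conditions. *)
Definition is_mean f a :=
  P.-integrable setT (EFin \o f) /\ (\int[P]_x (f x)%:E = a%:E)%E.

Lemma integrable_is_mean f : P.-integrable setT (EFin \o f) ->
  is_mean f (\int[P]_x f x).
Proof. by move=> h; split => //; rewrite fineK//; exact: integrable_fin_num. Qed.

Lemma is_mean_Rintegral f a : is_mean f a -> \int[P]_x f x = a.
Proof. by move=> [_ h]; rewrite /Rintegral h. Qed.

Lemma is_mean_cst k : is_mean (fun=> k) k.
Proof.
split; first exact: finite_measure_integrable_cst.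
by rewrite (integral_cst P measurableT k%:E) -[RHS]mule1; congr (_ * _)%E; exact: probability_setT.
Qed.

Lemma is_meanD f g a b : is_mean f a -> is_mean g b ->
  is_mean (fun x => f x + g x) (a + b).
Proof.
move=> [If fa] [Ig gb]; split; first exact: (integrableD measurableT If Ig).
by under eq_integral do rewrite EFinD; rewrite integralD// fa gb.
Qed.

Lemma is_meanZ k f a : is_mean f a -> is_mean (fun x => k * f x) (k * a).
Proof.
move=> [If fa]; split; first exact: (integrableZl measurableT k If).
by under eq_integral do rewrite EFinM; rewrite integralZl// fa.
Qed.

Lemma eq_is_mean f g a b : is_mean f a -> f =1 g -> a = b -> is_mean g b.
Proof. by move=> h /funext <- <-. Qed.

Lemma is_mean_le f g a b : is_mean f a -> is_mean g b -> (forall x, f x <= g x) -> a <= b.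
Proof.
move=> [If fa] [Ig gb] fg; rewrite -lee_fin -fa -gb.
by apply: le_integral => // x _; rewrite lee_fin.
Qed.

Lemma is_mean_uniq f a b : is_mean f a -> is_mean f b -> a = b.
Proof. by move=> /is_mean_Rintegral <- /is_mean_Rintegral. Qed.

End is_mean.

(** * Gaussian smoothing of log-densities *)

Section gaussian_smoothing.
Context (R : realType).
Local Open Scope ring_scope.
Local Notation leb := (@lebesgue_measure R).
Local Notation phi := (normal_pdf (0 : R) 1).
Local Notation gamma := (normal_prob (0 : R) 1).

(** Quadratic growth is stable under [v -> x + s * v]; the integrability checks for smoothed
    functions reduce to this class. *)
Lemma integrable_quadratic_normal (g : R -> R) c : measurable_fun setT g ->
  (forall v, `|g v| <= c * (1 + v ^+ 2)) -> gamma.-integrable setT (EFin \o g).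
Proof.
move=> mg gc.
apply: (@le_integrable _ _ _ gamma setT measurableT _ (fun v : R => (c%:E * (1 + v ^+ 2)%:E)%E)).
- exact/measurable_EFinP.
- by move=> v _; rewrite -EFinM lee_fin (le_trans (gc v))// ler_norm.
- apply: integrableZl => //.
  under eq_fun do rewrite EFinD.
  apply: integrableD => //; last exact: integrable_sqr_normal.
  exact: finite_measure_integrable_cst.
Qed.

Context (S S' : R -> R) (B s : R).
Hypothesis dS : forall t, is_derive t (1 : R) S (S' t).
Hypothesis cS' : continuous S'.
Hypothesis S'0 : forall t, 0 < S' t.
Hypothesis SB : forall t, S t ^+ 2 <= B * (1 + t ^+ 2).
Hypothesis S'B : forall t, S' t <= B * (1 + t ^+ 2).

Let cS : continuous S. Proof. exact: is_derive_continuous dS. Qed.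

Let B0 : 0 < B.
Proof.
have := lt_le_trans (S'0 0) (S'B 0); rewrite expr0n/= addr0 mulr1; exact.
Qed.

Let maff x : measurable_fun setT (fun v : R => x + s * v).
Proof. by apply: measurable_funD => //; exact: measurable_funM. Qed.

Let quad x v : 1 + (x + s * v) ^+ 2 <= (1 + 2 * x ^+ 2 + 2 * s ^+ 2) * (1 + v ^+ 2).
Proof.
have := sqr_ge0 (x - s * v); have := sqr_ge0 s; have := sqr_ge0 x; have := sqr_ge0 v.
rewrite !expr2 => *; nra.
Qed.

(** The expectation [E[f (x + s Z)]] for a standard normal [Z]. In this section [S] and [S'] stand
    for a transport map and its derivative; [f] will also be [ln w]. *)
Definition gsmooth (f : R -> R) (x : R) : R := \int[gamma]_v f (x + s * v).

Let mcomp (f : R -> R) x : continuous f -> measurable_fun setT (fun v => f (x + s * v)).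
Proof.
move=> cf; apply: (measurableT_comp (f := f)); last exact: maff.
exact: continuous_measurable_fun.
Qed.

Let Sn t : `|S t| <= (1 + B) * (1 + t ^+ 2).
Proof.
have h := SB t; rewrite -[S t ^+ 2]real_normK ?num_real// in h.
have := sqr_ge0 (`|S t| - 1); have := normr_ge0 (S t); have := sqr_ge0 t.
rewrite !expr2 in h *; nra.
Qed.

Let intS x : gamma.-integrable setT (EFin \o (fun v => S (x + s * v))).
Proof.
apply: (@integrable_quadratic_normal _ ((1 + B) * (1 + 2 * x ^+ 2 + 2 * s ^+ 2))).
  exact: mcomp.
move=> v; apply: (le_trans (Sn _)); rewrite -mulrA ler_wpM2l//.
by rewrite addr_ge0// ltW.
Qed.

Let intS' x : gamma.-integrable setT (EFin \o (fun v => S' (x + s * v))).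
Proof.
apply: (@integrable_quadratic_normal _ (B * (1 + 2 * x ^+ 2 + 2 * s ^+ 2))).
  exact: mcomp.
move=> v; rewrite gtr0_norm//; apply: (le_trans (S'B _)); rewrite -mulrA ler_wpM2l//.
exact: ltW.
Qed.

Let vSn x v : `|v * S (x + s * v)| <= (1 + B * (1 + 2 * x ^+ 2 + 2 * s ^+ 2)) * (1 + v ^+ 2).
Proof.
have h := SB (x + s * v); have q := ler_wpM2l (ltW B0) (quad x v).
have {}h := le_trans h q.
have : `|v * S (x + s * v)| <= v ^+ 2 + S (x + s * v) ^+ 2.
  rewrite -[leRHS]ger0_norm ?addr_ge0 ?sqr_ge0// ler_norml.
  move: (S _) => a; rewrite ger0_norm ?addr_ge0 ?sqr_ge0//.
  have := sqr_ge0 (v + a); have := sqr_ge0 (v - a); have := sqr_ge0 v; have := sqr_ge0 a.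
  rewrite !expr2 => *; apply/andP; split; nra.
move=> k; apply: (le_trans k); rewrite mulrDl mul1r; apply: lerD.
  by rewrite lerDr.
by rewrite -mulrA.
Qed.

Let intvS x : gamma.-integrable setT (EFin \o (fun v => v * S (x + s * v))).
Proof.
apply: (integrable_quadratic_normal _ (vSn x)).
by apply: measurable_funM => //; exact: mcomp.
Qed.

Lemma gsmooth_gt0 x : 0 < gsmooth S' x.
Proof. by apply: Rintegral_gt0. Qed.

Lemma gsmooth_derive (x : R) : is_derive x (1 : R) (gsmooth S) (gsmooth S' x).
Proof.
pose f x v := S (x + s * v).
have df y v : is_derive y (1 : R) (f ^~ v) (S' (y + s * v)).
  rewrite -[S' _]mulr1; apply: is_derive1_comp.
  by apply: is_derive_eq; rewrite addr0.
(* On []x - 1, x + 1[] one has [|y| <= |x| + 1], so [quad] gives a dominating function independent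
   of [y]. *)
pose c := B * (1 + 2 * ((`|x| + 1) ^+ 2) + 2 * s ^+ 2).
pose G (v : R) := c * (1 + v ^+ 2).
have c0 : 0 <= c.
  apply: mulr_ge0; first exact: ltW.
  by have := sqr_ge0 (`|x| + 1); have := sqr_ge0 s; lra.
have Ix : `]x - 1, x + 1[%classic x by rewrite /= in_itv/= ltrDl ltr01 gtrBl ltr01.
have G0 v : 0 <= G v by rewrite mulr_ge0// addr_ge0// sqr_ge0.
have iG : gamma.-integrable setT (EFin \o G).
  apply: (@integrable_quadratic_normal _ c).
    by apply: measurable_funM => //; apply: measurable_funD => //; exact: measurable_funX.
  by move=> v; rewrite ger0_norm.
have GB y v : `]x - 1, x + 1[%classic y -> `|partial1of2 f y v| <= G v.
  rewrite /= in_itv/= => /andP[y1 y2].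
  rewrite partial1of2E; case: (df y v) => _ ->; rewrite gtr0_norm//.
  apply: (le_trans (S'B _)); rewrite /G /c -mulrA ler_wpM2l//; first exact: ltW.
  apply: (le_trans (quad _ _)); apply: ler_wpM2r; first by rewrite addr_ge0// sqr_ge0.
  rewrite lerD2r lerD2l ler_wpM2l// -[y ^+ 2]real_normK ?num_real//.
  rewrite lerXn2r ?nnegrE ?addr_ge0//.
  have := ler_norm x; have : - x <= `|x| by rewrite lerNl; exact: lerNnormlW.
  by rewrite ler_norml => *; lra.
have h1 y : `]x - 1, x + 1[%classic y -> gamma.-integrable setT (EFin \o f y).
  by move=> _; exact: intS.
have h2 y v : `]x - 1, x + 1[%classic y -> [set: R] v -> derivable (f ^~ v) y 1.
  by move=> _ _; case: (df y v).
have h3 y v : `]x - 1, x + 1[%classic y -> [set: R] v -> `|partial1of2 f y v| <= G v.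
  by move=> /GB.
have dd := derivable_under_integral measurableT Ix h1 h2 G0 iG h3.
have := differentiation_under_integral measurableT Ix h1 h2 G0 iG h3.
rewrite (_ : \int[_]_(y in _) _ = gsmooth S' x) => [de|]; last first.
  by apply: eq_Rintegral => v _; rewrite partial1of2E; case: (df x v).
by apply: DeriveDef; [exact: dd|rewrite -derive1E].
Qed.

Lemma gsmooth_continuous : continuous (gsmooth S').
Proof.
move=> x.
pose c := B * (1 + 2 * ((`|x| + 1) ^+ 2) + 2 * s ^+ 2).
pose G (v : R) := c * (1 + v ^+ 2).
have Ix : x \in `]x - 1, x + 1[%classic by rewrite inE /= in_itv/= ltrDl ltr01 gtrBl ltr01.
have iG : gamma.-integrable setT (EFin \o G).
  apply: (@integrable_quadratic_normal _ `|c|).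
    by apply: measurable_funM => //; apply: measurable_funD => //; exact: measurable_funX.
  by move=> v; rewrite normrM [`|1 + _|]ger0_norm// addr_ge0// sqr_ge0.
apply: (continuity_under_integral measurableT _ _ iG _ Ix).
- by move=> y _; exact: intS'.
- apply: aeW => v _ y _; apply: (continuous_comp (f := fun z => z + s * v)); last exact: cS'.
  by apply: cvgD; [exact: cvg_id|exact: cvg_cst].
- move=> y; rewrite /= in_itv/= => /andP[y1 y2]; apply: aeW => v _.
  rewrite gtr0_norm//.
  apply: (le_trans (S'B _)); rewrite /G /c -mulrA ler_wpM2l//; first exact: ltW.
  apply: (le_trans (quad _ _)); apply: ler_wpM2r; first by rewrite addr_ge0// sqr_ge0.
  rewrite lerD2r lerD2l ler_wpM2l// -[y ^+ 2]real_normK ?num_real//.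
  rewrite lerXn2r ?nnegrE ?addr_ge0//.
  have := ler_norm x; have : - x <= `|x| by rewrite lerNl; exact: lerNnormlW.
  by rewrite ler_norml => *; lra.
Qed.

(** Stein's identity: integration by parts with primitive [- phi v * S (x + s * v)], whose
    derivative combines both integrands. It identifies the coefficient of [S (x + s Z)] along
    [Z]. *)
Lemma gsmooth_stein x : is_mean gamma (fun v => v * S (x + s * v)) (s * gsmooth S' x).
Proof.
have [h1 e1] := integrable_is_mean (intvS x).
have [h2 e2] := is_meanZ s (integrable_is_mean (intS' x)).
split => //; rewrite -e2.
have mv : measurable_fun setT (EFin \o (fun v : R => v * S (x + s * v))) by exact: measurable_int h1.
have mS : measurable_fun setT (EFin \o (fun v : R => s * S' (x + s * v))) by exact: measurable_int h2.
have l1 := (integrable_normal_probE 0 1 mv).1 h1.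
have l2 := (integrable_normal_probE 0 1 mS).1 h2.
rewrite [LHS](integral_normal_prob 0 1 mv) [RHS](integral_normal_prob 0 1 mS).
have f1 := integrable_fin_num measurableT l1.
have f2 := integrable_fin_num measurableT l2.
suff : (\int[leb]_v ((v * S (x + s * v))%:E * (phi v)%:E) -
        \int[leb]_v ((s * S' (x + s * v))%:E * (phi v)%:E) = 0)%E.
  rewrite -(fineK f1) -(fineK f2) => -[] /eqP.
  by rewrite subr_eq0 => /eqP ->.
rewrite -integralB//.
pose k v := v * S (x + s * v) * phi v - s * S' (x + s * v) * phi v.
transitivity (\int[leb]_v (k v)%:E)%E.
  by apply: eq_integral => v _; rewrite /k EFinB !EFinM.
have [c1 c2] : ((fun v => - (phi v * S (x + s * v))) v @[v --> +oo] --> (0 : R)) /\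
    ((fun v => - (phi v * S (x + s * v))) v @[v --> -oo] --> (0 : R)).
  apply: (@cvg0_normal _ _ ((1 + B) * (1 + 2 * x ^+ 2 + 2 * s ^+ 2))) => v.
  rewrite normrN normrM ger0_norm ?normal_pdf_ge0// mulrC mulrA.
  apply: ler_wpM2r; first exact: normal_pdf_ge0.
  apply: (le_trans (Sn _)); rewrite -mulrA; apply: ler_wpM2l.
    by rewrite addr_ge0// ltW.
  apply: (le_trans (quad _ _)); apply: ler_wpM2l.
    by have := sqr_ge0 x; have := sqr_ge0 s; lra.
  by have := sqr_ge0 v; rewrite !expr2 => *; nra.
apply: (integral_derive_eq0 _ _ _ c1 c2).
- move=> v; have hphi := is_derive_stdnormal_pdf v.
  have hS : is_derive v (1 : R) (fun v => S (x + s * v)) (s * S' (x + s * v)).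
    rewrite mulrC; apply: is_derive1_comp.
    by apply: is_derive_eq; rewrite /GRing.scale/=; ring.
  by apply: is_derive_eq; rewrite /k /GRing.scale/=; ring.
- have cphi : continuous phi by apply: continuous_normal_pdf; rewrite oner_neq0.
  have ca : continuous (fun v : R => x + s * v).
    by move=> v; apply: cvgD; [exact: cvg_cst|apply: cvgM; [exact: cvg_cst|exact: cvg_id]].
  move=> v; apply: cvgB; apply: cvgM; try exact: cphi.
    apply: cvgM; first exact: cvg_id.
    by apply: (continuous_comp (f := fun v => x + s * v)); [exact: ca|exact: cS].
  apply: cvgM; first exact: cvg_cst.
  by apply: (continuous_comp (f := fun v => x + s * v)); [exact: ca|exact: cS'].
- rewrite (_ : _ \o _ = (fun v => (v * S (x + s * v))%:E * (phi v)%:E -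
    (s * S' (x + s * v))%:E * (phi v)%:E)%E); first exact: integrableB.
  by apply/funext => v; rewrite /= /k EFinB !EFinM.
Qed.

(** By Bessel's inequality for the orthonormal pair [1, Z] and Stein's identity, [E[S^2]] is at
    least [(E S)^2 + s^2 (E S')^2]; by Jensen, [E[ln S']] is at most [ln (E S')]. *)
Lemma gsmooth_ln_le (w : R -> R) k x : (forall t, ln (w t) = k - S t ^+ 2 / 2 + ln (S' t)) ->
  gamma.-integrable setT (EFin \o (fun v => ln (w (x + s * v)))) ->
  gsmooth (fun t => ln (w t)) x <=
    k - gsmooth S x ^+ 2 / 2 - s ^+ 2 * gsmooth S' x ^+ 2 / 2 + ln (gsmooth S' x).
Proof.
move=> wE /integrable_is_mean iw.
set V := gsmooth S x; set m := gsmooth S' x; pose c := s * m.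
have m0 : 0 < m := gsmooth_gt0 x.
have eS : is_mean gamma (fun v => S (x + s * v)) V := integrable_is_mean (intS x).
have eS' : is_mean gamma (fun v => S' (x + s * v)) m := integrable_is_mean (intS' x).
have e1 : is_mean gamma (fun v => v) 0.
  by split; [exact: integrable_id_normal|exact: integral_id_normal].
have e2 : is_mean gamma (fun v => v ^+ 2) 1.
  by split; [exact: integrable_sqr_normal|exact: integral_sqr_normal].
have evS := gsmooth_stein x.
(* Both inequalities are made pointwise: the majorant comes from expanding [(b - V - c v)^2 >= 0]
   and from [ln a <= ln m + a / m - 1], and [eU] is its mean. *)
have eU := is_meanD (is_mean_cst gamma (k + V ^+ 2 / 2 + ln m - 1))
  (is_meanD (is_meanZ (V * c) e1) (is_meanD (is_meanZ (c ^+ 2 / 2) e2)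
  (is_meanD (is_meanZ (- V) eS) (is_meanD (is_meanZ (- c) evS) (is_meanZ m^-1 eS'))))).
apply: (le_trans (is_mean_le iw eU _)) => [v|].
  rewrite wE; move: (S'0 (x + s * v)); move: (S' _) (S _) => a b a0.
  have am : 0 < a / m by rewrite divr_gt0.
  have := @le_ln1Dx _ (a / m - 1); rewrite ltrBrDl addrN [1 + _]addrC subrK => /(_ am).
  rewrite ln_div ?posrE// => h.
  have := sqr_ge0 (b - V - c * v); rewrite [m^-1 * _]mulrC !expr2 => *; nra.
by rewrite mulVf ?gt_eqF// /c -/m; apply/eqP/eqP; rewrite le_eqVlt; apply/orP; left; apply/eqP; field.
Qed.

End gaussian_smoothing.

(** * Monotone transport to the standard normal law, with growth bounds *)

Section transport.
Context (R : realType).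
Local Open Scope ring_scope.
Local Notation leb := (@lebesgue_measure R).
Local Notation phi := (normal_pdf (0 : R) 1).
Context (w : R -> R) (e M : R) (cw : continuous w) (e0 : 0 < e).
Hypothesis w_ge : forall t, e / (1 + t ^+ 2) <= w t.
Hypothesis w_le : forall t, w t <= M.
Hypothesis iw : (\int[leb]_x (w x)%:E = 1)%E.

Let w0 t : 0 < w t.
Proof. by apply: lt_le_trans (w_ge t); rewrite divr_gt0// ltr_pwDl// sqr_ge0. Qed.

Let cphi : continuous phi.
Proof. by apply: continuous_normal_pdf; rewrite oner_neq0. Qed.

Let phi_gt0 x : 0 < phi x.
Proof. by apply: normal_pdf_gt0; rewrite oner_neq0. Qed.

Let iphi : (\int[leb]_x (phi x)%:E = 1)%E.
Proof. exact: integral_normal_pdf. Qed.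

Let peak_gt0 : 0 < normal_peak (1 : R).
Proof. by apply: normal_peak_gt0; rewrite oner_neq0. Qed.

Let Phi := pdf_cdf phi.
Let W := pdf_cdf w.

(** The default [0] is never reached in use: the argument is a value of [W], which lies strictly
    between 0 and 1. *)
Definition stdnormal_quantile (c : R) : R := xget 0 [set u | Phi u = c].

Let PhiK u : stdnormal_quantile (Phi u) = u.
Proof.
rewrite /stdnormal_quantile; case: xgetP => [v _ /= /(pdf_cdf_inj cphi phi_gt0 iphi)//|].
by move=> /(_ u) /(_ erefl).
Qed.

(* The increasing rearrangement sending the law with density w to the standard
   normal law. *)
Definition transport (t : R) : R := stdnormal_quantile (W t).
Definition transport' (t : R) : R := w t / phi (transport t).

Let transportE t : Phi (transport t) = W t.
Proof.
have [u uW] : exists u, Phi u = W t.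
  apply: stdnormal_cdf_surj; rewrite (pdf_cdf_gt0 cw w0 iw).
  exact: (pdf_cdf_lt1 cw w0 iw).
by rewrite /transport -uW PhiK.
Qed.

(** Differentiates [Phi (transport t) = W t], the one-dimensional Monge-Ampere equation; [PhiK]
    provides the inverse needed for the inverse function rule. *)
Lemma transport_derive t : is_derive t (1 : R) transport (transport' t).
Proof.
rewrite /transport' mulrC; apply: is_derive1_comp; last exact: pdf_cdf_derive.
rewrite -/W -transportE; apply: is_derive_inverse.
- by near=> u; exact: PhiK.
- by near=> u; exact: pdf_cdf_continuous.
- exact: pdf_cdf_derive.
- by rewrite gt_eqF.
Unshelve. all: end_near. Qed.

Lemma transport'_gt0 t : 0 < transport' t.
Proof. by rewrite divr_gt0. Qed.

Lemma transport'_continuous : continuous transport'.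
Proof.
have cT := is_derive_continuous transport_derive.
move=> t; apply: cvgM; first exact: cw.
apply: cvgV; first by rewrite gt_eqF.
by apply: continuous_comp; [exact: cT|exact: cphi].
Qed.

(** Each tail of [w] at [t] contains a unit interval adjacent to [t], on which
    [1 + c^2 <= 3 + 2 t^2]. The transport preserves both tails, so the Gaussian tail bound applies
    at [transport t]. *)
Let tail t : e / (3 + 2 * t ^+ 2) <= expR (- transport t ^+ 2 / 2).
Proof.
have t2 := sqr_ge0 t.
have lb (c : R) : t - 1 < c < t + 1 -> e / (3 + 2 * t ^+ 2) <= w c.
  move=> /andP[c1 c2]; apply: le_trans (w_ge c); apply: ler_wpM2l; first exact: ltW.
  rewrite lef_pV2 ?posrE; [|lra|by have := sqr_ge0 c; lra].
  have : 0 <= (1 - (c - t)) * (1 + (c - t)) by apply: mulr_ge0; lra.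
  by have := sqr_ge0 (c - 2 * t); rewrite !expr2 => *; nra.
have h1 : e / (3 + 2 * t ^+ 2) <= W t.
  have [c /andP[c1 c2]] := pdf_cdf_MVT cw w0 iw (ltac:(lra) : t - 1 < t).
  rewrite opprB addrCA subrr addr0 mulr1 => h.
  have := pdf_cdf_gt0 cw w0 iw (t - 1); have := lb c; rewrite c1 -h /W.
  by move=> /(_ (ltac:(lra))) *; lra.
have h2 : e / (3 + 2 * t ^+ 2) <= 1 - W t.
  have [c /andP[c1 c2]] := pdf_cdf_MVT cw w0 iw (ltac:(lra) : t < t + 1).
  rewrite [t + 1]addrC addrK mulr1 => h.
  have := pdf_cdf_le1 cw w0 iw (1 + t).
  have := lb c; rewrite -h [t + 1]addrC (addrC 1 t) c2 /W andbT.
  by move=> /(_ (ltac:(lra))) *; lra.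
apply: le_trans (stdnormal_cdf_tail _); rewrite le_min.
have := pdf_cdfD cphi phi_gt0 iphi (transport t).
by rewrite -/Phi transportE h1 => WE /=; lra.
Qed.

(** The first summand bounds the squared map, by [1 + y <= exp y] applied to the tail estimate; the
    second bounds the derivative, by [w <= M] and the resulting lower bound on [phi (transport t)].
    A single constant serves both growth hypotheses of the smoothing lemmas. *)
Definition transport_bound : R := 6 / e + 3 * M / (normal_peak 1 * e).

Let M0 : 0 < M. Proof. exact: lt_le_trans (w_le 0). Qed.

Lemma transport_sqr_le t : transport t ^+ 2 <= transport_bound * (1 + t ^+ 2).
Proof.
have t2 := sqr_ge0 t; have h := tail t.
have d0 : 0 < e / (3 + 2 * t ^+ 2) by rewrite divr_gt0//; lra.
have h' : expR (transport t ^+ 2 / 2) <= (3 + 2 * t ^+ 2) / e.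
  rewrite -[leLHS]invrK -expRN -mulNr -[leRHS]invrK lef_pV2 ?posrE ?expR_gt0//.
    by rewrite invf_div.
  by rewrite invf_div.
have k := le_trans (expR_ge1Dx _) h'.
apply: (@le_trans _ _ (6 / e * (1 + t ^+ 2))); last first.
  apply: ler_wpM2r; first by lra.
  by rewrite lerDl ltW// divr_gt0 ?mulr_gt0.
have : (3 + 2 * t ^+ 2) / e <= 3 / e * (1 + t ^+ 2).
  by rewrite mulrAC ler_pM2r ?invr_gt0//; lra.
lra.
Qed.

Lemma transport'_le t : transport' t <= transport_bound * (1 + t ^+ 2).
Proof.
have t2 := sqr_ge0 t; have h := tail t.
apply: (@le_trans _ _ (3 * M / (normal_peak 1 * e) * (1 + t ^+ 2))); last first.
  apply: ler_wpM2r; first by lra.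
  by rewrite lerDr ltW// divr_gt0.
rewrite /transport' ler_pdivrMr// stdnormal_pdfE.
apply: (le_trans (w_le t)).
have k : e / 3 / (1 + t ^+ 2) <= expR (- transport t ^+ 2 / 2).
  apply: le_trans h; rewrite -mulrA -invfM ler_pM2l// lef_pV2 ?posrE; lra.
rewrite mulrA; apply: le_trans (ler_wpM2l _ k); last first.
  apply: mulr_ge0; last exact: ltW.
  apply: mulr_ge0; last by lra.
  by rewrite ltW// divr_gt0 ?mulr_gt0.
rewrite le_eqVlt; apply/orP; left; apply/eqP; field.
by rewrite !gt_eqF//; lra.
Qed.

(** The change of variables formula in logarithmic form, as required by [gsmooth_ln_le] with
    [k = ln (normal_peak 1)]. *)
Lemma ln_transport t : ln (w t) =
  ln (normal_peak 1) - transport t ^+ 2 / 2 + ln (transport' t).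
Proof.
rewrite /transport' ln_div ?posrE// stdnormal_pdfE lnM ?posrE ?expR_gt0// expRK.
ring.
Qed.

End transport.

(** * The integral bound for smoothed log-densities *)

Section smoothed_log_density.
Context (R : realType).
Local Open Scope ring_scope.
Local Notation leb := (@lebesgue_measure R).
Local Notation gamma := (normal_prob (0 : R) 1).

Lemma ln_le_subr1 (x : R) : 0 < x -> ln x <= x - 1.
Proof.
move=> x0; have := @le_ln1Dx _ (x - 1); rewrite [1 + _]addrC subrK; apply.
by rewrite ltrBrDl addrN.
Qed.

(** A Cauchy lower bound costs only [ln (1 + t^2) <= t^2] in the logarithm, which a Gaussian can
    integrate. *)
Lemma ln_density_bound (w e M t : R) : 0 < e -> e / (1 + t ^+ 2) <= w -> w <= M ->
  `|ln w| <= (M + `|ln e| + 1) * (1 + t ^+ 2).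
Proof.
move=> e0 we wM; have t2 := sqr_ge0 t.
have q0 : 0 < e / (1 + t ^+ 2) by rewrite divr_gt0//; lra.
have w0 : 0 < w := lt_le_trans q0 we.
have l1 := ln_sublinear w0.
have l2 : ln (e / (1 + t ^+ 2)) <= ln w by rewrite ler_ln ?posrE.
rewrite ln_div ?posrE// in l2; last by lra.
have l3 : ln (1 + t ^+ 2) <= t ^+ 2 by apply: le_ln1Dx; lra.
have := ler_norm (ln e); have : - ln e <= `|ln e| by rewrite -normrN ler_norm.
move: (ln e) (ln w) l1 l2 l3 => a b *.
have := normr_ge0 a.
have : 0 <= (M + `|a|) * t ^+ 2 by rewrite mulr_ge0// addr_ge0//; lra.
by rewrite ler_norml => *; apply/andP; split; nra.
Qed.

Lemma integrable_ln_density (w : R -> R) (e M s x : R) : 0 < e ->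
  measurable_fun setT w -> (forall t, e / (1 + t ^+ 2) <= w t <= M) ->
  gamma.-integrable setT (EFin \o (fun v => ln (w (x + s * v)))).
Proof.
move=> e0 mw we.
have M0 : 0 < M.
  have /andP[h1 h2] := we 0; apply: lt_le_trans (le_trans h1 h2).
  by rewrite divr_gt0// expr0n addr0.
apply: (@integrable_quadratic_normal _ _ ((M + `|ln e| + 1) * (1 + 2 * x ^+ 2 + 2 * s ^+ 2))).
  apply: (measurableT_comp (f := @ln R)); first exact: measurable_ln.
  apply: measurableT_comp => //.
  by apply: measurable_funD => //; exact: measurable_funM.
move=> v; have /andP[h1 h2] := we (x + s * v).
apply: (le_trans (ln_density_bound e0 h1 h2)); rewrite -mulrA; apply: ler_wpM2l.
  by rewrite addr_ge0// addr_ge0// ltW.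
have := sqr_ge0 (x - s * v); have := sqr_ge0 s; have := sqr_ge0 x; have := sqr_ge0 v.
rewrite !expr2 => *; nra.
Qed.

(** With [m] the smoothed derivative of the transport, the exponent collects
    [ln (normal_peak 1) / lam] from [ln_transport] and the maximum over [m] of
    [(ln m - s^2 m^2 / 2) / lam - ln m], attained at [m^2 = (1 - lam) / s^2]. The denominator is the
    peak of the [N(0, lam)] density into which the remaining factor is turned. *)
Definition smoothing_const (lam s : R) : R :=
  expR (lam^-1 * ln (normal_peak 1) +
    (1 - lam) / lam / 2 * (ln ((1 - lam) / s ^+ 2) - 1)) / normal_peak (Num.sqrt lam).

(* A limiting case of the sharp Young inequality for a Gaussian kernel. *)
Lemma smoothed_log_density_le (w : R -> R) (e M lam s : R) : continuous w -> 0 < e ->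
  (forall t, e / (1 + t ^+ 2) <= w t <= M) -> (\int[leb]_x (w x)%:E = 1)%E ->
  0 < lam < 1 -> s != 0 ->
  measurable_fun setT (gsmooth s (fun t => ln (w t))) ->
  (\int[leb]_x (expR (lam^-1 * gsmooth s (fun t => ln (w t)) x))%:E <=
   (smoothing_const lam s)%:E)%E.
Proof.
move=> cw e0 we iw /andP[l0 l1] s0 mL.
have w_ge t : e / (1 + t ^+ 2) <= w t by case/andP: (we t).
have w_le t : w t <= M by case/andP: (we t).
pose S := transport w; pose S' := transport' w; pose B := transport_bound e M.
have dS := transport_derive cw e0 w_ge iw.
have cS' := transport'_continuous cw e0 w_ge iw.
have S'0 := transport'_gt0 e0 w_ge.
have SB := transport_sqr_le cw e0 w_ge w_le iw.
have S'B := transport'_le cw e0 w_ge w_le iw.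
pose V := gsmooth s S; pose m := gsmooth s S'.
have m0 x : 0 < m x := gsmooth_gt0 s cS' S'0 S'B x.
have dV x : is_derive x (1 : R) V (m x) := gsmooth_derive s dS S'0 SB S'B x.
have cm : continuous m := @gsmooth_continuous _ _ _ s cS' S'0 S'B.
have sl0 : Num.sqrt lam != 0 by rewrite gt_eqF// sqrtr_gt0.
have pk : 0 < normal_peak (Num.sqrt lam) := normal_peak_gt0 sl0.
pose K := smoothing_const lam s.
have K0 : 0 <= K by rewrite /K /smoothing_const divr_ge0// ?expR_ge0// ltW.
have key x : expR (lam^-1 * gsmooth s (fun t => ln (w t)) x) <=
    K * (normal_pdf 0 (Num.sqrt lam) (V x) * m x).
  have := @gsmooth_ln_le _ S S' B s dS cS' S'0 SB S'B w (ln (normal_peak 1)) x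
    (ln_transport e0 w_ge) (integrable_ln_density s x e0 (continuous_measurable_fun cw) we).
  rewrite -/V -/m; move: (gsmooth _ _ _) => L hL.
  rewrite normal_pdfE// /normal_fun subr0 sqr_sqrtr ?(ltW l0)//.
  rewrite /K /smoothing_const -[m x in leRHS](@lnK _ (m x)) ?posrE//.
  rewrite (_ : _ / _ * _ = expR (lam^-1 * ln (normal_peak 1) +
    (1 - lam) / lam / 2 * (ln ((1 - lam) / s ^+ 2) - 1) + - V x ^+ 2 / (lam *+ 2) + ln (m x))); last first.
    by rewrite !expRD; field; rewrite gt_eqF.
  rewrite ler_expR.
  have s2 : 0 < s ^+ 2 by rewrite exprn_even_gt0.
  have m2 : 0 < m x ^+ 2 by rewrite exprn_gt0.
  (* The maximiser of the terms in [m x] left after one factor [m x] is kept as a Jacobian;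
     [ln y <= y - 1] at [y = m^2 / mu2] is sharp there. *)
  pose mu2 := (1 - lam) / s ^+ 2.
  have mu0 : 0 < mu2 by rewrite divr_gt0// subr_gt0.
  have h : ln (m x ^+ 2 / mu2) <= m x ^+ 2 / mu2 - 1.
    by apply: ln_le_subr1; rewrite divr_gt0.
  rewrite ln_div ?posrE// lnXn// -/mu2 in h *.
  have c0 : 0 < (1 - lam) / lam / 2 by rewrite !divr_gt0// subr_gt0.
  have h' := ler_wpM2l (ltW c0) h.
  have il0 : 0 < lam^-1 by rewrite invr_gt0.
  apply: (le_trans (ler_wpM2l (ltW il0) hL)).
  have e1 : (1 - lam) / lam / 2 * (m x ^+ 2 / mu2 - 1) =
     lam^-1 * (s ^+ 2 * m x ^+ 2 / 2) - (1 - lam) / lam / 2.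
    by rewrite /mu2; field; rewrite s0 !gt_eqF// subr_gt0.
  rewrite e1 in h'.
  have e2 : (1 - lam) / lam / 2 * (ln (m x) *+ 2 - ln mu2) =
     lam^-1 * ln (m x) - ln (m x) - (1 - lam) / lam / 2 * ln mu2.
    by rewrite -mulr_natr; field; rewrite gt_eqF.
  rewrite e2 in h'.
  have e3 : - V x ^+ 2 / (lam *+ 2) = - (lam^-1 * (V x ^+ 2 / 2)).
    by rewrite -mulr_natr; field; rewrite gt_eqF.
  rewrite e3; lra.
pose N := normal_pdf 0 (Num.sqrt lam).
have cN : continuous N by exact: continuous_normal_pdf.
have N0 x : 0 < N x by exact: normal_pdf_gt0.
have iN : (\int[leb]_x (N x)%:E = 1)%E by exact: integral_normal_pdf.
have cVm : continuous (fun x => N (V x) * m x).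
  move=> x; apply: cvgM; last exact: cm.
  by apply: continuous_comp; [exact: (is_derive_continuous dV)|exact: cN].
(* The integrand is the derivative of the [N(0, lam)] distribution function along [V], whose
   increments never exceed one. *)
have i1 : (\int[leb]_x (N (V x) * m x)%:E <= 1%:E)%E.
  apply: (@ge0_integral_derive_le _ (pdf_cdf N \o V)) => //.
  - move=> x; apply: is_derive1_comp; exact: pdf_cdf_derive.
  - by move=> x; rewrite mulr_ge0// ltW.
  - move=> x y /=; rewrite lerBlDr (le_trans (pdf_cdf_le1 cN N0 iN (V y)))// lerDl.
    exact: pdf_cdf_ge0.
apply: (@le_trans _ _ (\int[leb]_x (K * (N (V x) * m x))%:E)%E).
  apply: ge0_le_integral => //.
  - apply/measurable_EFinP; apply: measurableT_comp => //.
    exact: measurable_funM.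
  - apply/measurable_EFinP; apply: measurable_funM => //.
    exact: continuous_measurable_fun.
  - by move=> x _; rewrite lee_fin.
under eq_integral do rewrite EFinM.
rewrite ge0_integralZl//; last 2 first.
- by apply/measurable_EFinP; exact: continuous_measurable_fun.
- by move=> x _; rewrite lee_fin mulr_ge0// ltW.
by rewrite -[leRHS]mule1 lee_wpmul2l.
Qed.

End smoothed_log_density.

Lemma measurable_inv_gt0 d (T : measurableType d) (R : realType) (f : T -> R) :
  measurable_fun setT f -> (forall x, 0 < f x)%R ->
  measurable_fun setT (fun x => (f x)^-1%R).
Proof.
move=> mf f0; rewrite (_ : (fun x => _) = (fun x => expR (- ln (f x)))%R).
  apply: measurableT_comp => //; apply: measurableT_comp => //.
  by apply: measurableT_comp => //; exact: measurable_ln.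
by apply/funext => x; rewrite expRN lnK// posrE.
Qed.

Lemma integral_ge_integrable d (T : measurableType d) (R : realType)
    (mu : {measure set T -> \bar R}) (f g : T -> \bar R) :
  measurable_fun setT f -> mu.-integrable setT g -> (forall x, g x <= f x) ->
  \int[mu]_x g x <= \int[mu]_x f x.
Proof.
move=> mf ig gf; rewrite [leLHS]integralE [leRHS]integralE.
apply: leeB.
- apply: ge0_le_integral => //.
  + by apply: measurable_funepos; exact: measurable_int ig.
  + exact: measurable_funepos.
  + by move=> x _; apply: (@funepos_le _ _ setT); rewrite ?inE.
- apply: ge0_le_integral => //.
  + exact: measurable_funeneg.
  + by apply: measurable_funeneg; exact: measurable_int ig.
  + by move=> x _; apply: (@funeneg_le _ _ setT); rewrite ?inE.
Qed.

(** * Gibbs' inequality *)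

Section gibbs.
Context d (T : measurableType d) (R : realType).
Context (nu : probability T R) (mu : {sigma_finite_measure set T -> \bar R}).

(* The density is replaced by 1 where it vanishes, a nu-null set, so that it
   becomes positive everywhere. *)
Lemma positive_density : nu `<< mu ->
  exists2 f : T -> R, measurable_fun setT f /\ (forall x, (0 < f x)%R) &
    (expected_log_density nu mu = \int[nu]_x (ln (f x))%:E) /\
    (forall g : T -> \bar R, measurable_fun setT g -> (forall x, 0 <= g x) ->
      \int[nu]_x (g x * (f x)^-1%:E) <= \int[mu]_x g x).
Proof.
move=> numu.
pose f0 := Radon_Nikodym_SigmaFinite.f nu mu.
have mf0 : measurable_fun setT f0.
  exact: measurable_int (Radon_Nikodym_SigmaFinite.f_integrable numu).
have f0_ge0 := Radon_Nikodym_SigmaFinite.f_ge0 numu.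
have f0_fin := Radon_Nikodym_SigmaFinite.f_fin_num numu.
have nuE A : measurable A -> nu A = \int[mu]_(x in A) f0 x.
  exact: Radon_Nikodym_SigmaFinite.f_integral.
pose f x := if (fine (f0 x) <= 0)%R then 1%R else fine (f0 x).
have mff0 : measurable_fun setT (fine \o f0) by apply: measurableT_comp => //; exact: fine_measurable.
have mf : measurable_fun setT f.
  apply: measurable_fun_ifT => //.
  by apply: measurable_fun_ler => //; exact: mff0.
have f_gt0 x : (0 < f x)%R by rewrite /f; case: ifPn => //; rewrite -ltNge.
have mZ : measurable [set x | f0 x <= 0].
  by rewrite -[X in measurable X]setTI; exact: emeasurable_fun_infty_c.
have nuZ : nu [set x | f0 x <= 0] = 0.
  rewrite nuE// (eq_integral (cst 0)) ?integral0// => x; rewrite inE/= => h.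
  by apply/eqP; rewrite eq_le h f0_ge0.
exists f => //; split.
  rewrite (expected_log_densityE mf0 f0_ge0 nuE).
  apply: ae_eq_integral => //.
  - by apply: measurableT_comp => //; exact: measurable_lne.
  - by apply/measurable_EFinP; apply: measurableT_comp => //; exact: measurable_ln.
  - exists [set x | f0 x <= 0]; split => // x /= h; apply: contrapT => /negP.
    rewrite -ltNge => h0; apply: h => _; rewrite /f.
    have := f0_fin x; move: h0; rewrite -/f0; case: (f0 x) => [a| |]//=.
    by rewrite lte_fin => a0 _; rewrite leNgt a0.
move=> g mg g0.
rewrite (density_integral mf0 f0_ge0 nuE); last 2 first.
- apply: emeasurable_funM => //; apply/measurable_EFinP.
  exact: measurable_inv_gt0.
- by move=> x; rewrite mule_ge0// lee_fin invr_ge0 ltW.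
apply: ge0_le_integral => //.
- by move=> x _; rewrite !mule_ge0// lee_fin invr_ge0 ltW.
- apply: emeasurable_funM => //; apply: emeasurable_funM => //; apply/measurable_EFinP.
  exact: measurable_inv_gt0.
- move=> x _; rewrite -muleA /f.
  have := f0_fin x; have := f0_ge0 x; rewrite -/f0; case: (f0 x) => [a| |]//= a0 _.
  rewrite -EFinM; case: ifPn => [a1|].
    by rewrite (_ : a = 0%R) ?mulr0 ?mule0//; apply/eqP; rewrite eq_le a1 -lee_fin.
  by rewrite -ltNge => a1; rewrite mulVf ?gt_eqF// mule1.
Qed.

(** Integrates [ln (r / f) <= r / f - 1] against [nu], with [f] the density of [nu]. Mass at most
    one for [r] suffices because [r / f] has [nu]-integral at most the mass of [r]. Without
    domination the right-hand side is [+oo]. *)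
Lemma gibbs (r : T -> R) : measurable_fun setT r -> (forall x, (0 < r x)%R) ->
  \int[mu]_x (r x)%:E <= 1 -> nu.-integrable setT (fun x => (ln (r x))%:E) ->
  \int[nu]_x (ln (r x))%:E <= expected_log_density nu mu.
Proof.
move=> mr r0 ir ilr.
have [numu|] := pselect (nu `<< mu); last first.
  by move=> h; rewrite /expected_log_density ifF ?leey//; apply/negbTE/asboolPn.
have [f [mf f0] [-> fg]] := positive_density numu.
have h : \int[nu]_x (r x / f x)%:E <= 1.
  apply: le_trans ir; under eq_integral do rewrite EFinM.
  by apply: fg => [|x]; [exact/measurable_EFinP|rewrite lee_fin ltW].
have mq : measurable_fun setT (fun x => r x / f x)%R.
  by apply: measurable_funM => //; exact: measurable_inv_gt0.
have q0 x : (0 <= r x / f x)%R by rewrite divr_ge0 ?ltW.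
have iq : nu.-integrable setT (fun x => (r x / f x)%:E).
  apply/integrableP; split; first exact/measurable_EFinP.
  under eq_integral do rewrite /= ger0_norm//.
  by rewrite (le_lt_trans h) ?ltry.
have qfin := integrable_fin_num measurableT iq.
have i1 : nu.-integrable setT (fun x => (1 - r x / f x)%:E).
  under eq_fun do rewrite EFinB; apply: integrableB => //.
  exact: finite_measure_integrable_cst.
have i2 : \int[nu]_x (1 - r x / f x)%:E = 1 - \int[nu]_x (r x / f x)%:E.
  under eq_integral do rewrite EFinB; rewrite integralB//.
    by congr (_ - _); exact: (is_mean_cst nu 1%R).2.
  exact: finite_measure_integrable_cst.
(* The minorant [ln r + 1 - r / f] of [ln f] is integrable, whereas [ln f] itself need not be. *)
apply: (@le_trans _ _ (\int[nu]_x ((ln (r x))%:E + (1 - r x / f x)%:E))).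
  rewrite integralD// i2 leeDl//.
  by move: h; rewrite -(fineK qfin) -EFinB !lee_fin subr_ge0.
apply: integral_ge_integrable.
- by apply/measurable_EFinP; apply: measurableT_comp => //; exact: measurable_ln.
- exact: integrableD.
- move=> x; rewrite -EFinD lee_fin.
  have q : (0 < r x / f x)%R by rewrite divr_gt0.
  have := ln_le_subr1 q; rewrite ln_div ?posrE//; lra.
Qed.

End gibbs.

(** * Product measures, slices and image measures *)

Section prod_measure_integral.
Context d1 d2 (T1 : measurableType d1) (T2 : measurableType d2) (R : realType).
Context (m1 : {sigma_finite_measure set T1 -> \bar R})
  (m2 : {sigma_finite_measure set T2 -> \bar R}).

Lemma ge0_integral_prod_measure (g : T1 * T2 -> \bar R) :
  measurable_fun setT g -> (forall z, 0 <= g z) ->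
  \int[prod_measure m1 m2]_z g z = \int[m2]_y \int[m1]_x g (x, y).
Proof. by move=> mg g0; exact: (@fubini_tonelli2 _ _ _ _ _ m1 m2 g mg g0). Qed.

End prod_measure_integral.

Section normal_translate.
Context (R : realType).
Implicit Types (m s x : R).

Lemma normal_pdf_translate m s x : s != 0%R -> normal_pdf m s x = normal_pdf 0 s (x - m).
Proof. by move=> s0; rewrite !normal_pdfE// /normal_fun subr0. Qed.

End normal_translate.

Section slices.
Context d1 d2 (T1 : measurableType d1) (T2 : measurableType d2) (R : realType).
Context (m1 : {sigma_finite_measure set T1 -> \bar R}) (m2 : probability T2 R)
  (nu : probability (T1 * T2)%type R).
Hypothesis nu2 : forall B, measurable B -> nu (snd @^-1` B) = m2 B.

(** Since [m2] is the second marginal, almost every slice of the Radon-Nikodym density has mass one.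
    Setting the density to zero on slices of mass above one changes it on a null set and gives a
    bound valid for every [y], so that later constructions on a fixed slice have no exceptional
    set. *)
Lemma density_slices : nu `<< prod_measure m1 m2 ->
  exists f : T1 * T2 -> R,
    [/\ measurable_fun setT f, (forall z, (0 <= f z)%R),
     (forall y, \int[m1]_x (f (x, y))%:E <= 1) &
     (forall A, measurable A -> nu A = \int[prod_measure m1 m2]_(z in A) (f z)%:E)].
Proof.
move=> numu.
pose f0 := Radon_Nikodym_SigmaFinite.f nu (prod_measure m1 m2).
have mf0 : measurable_fun setT f0.
  exact: measurable_int (Radon_Nikodym_SigmaFinite.f_integrable numu).
have f0_ge0 : forall z, 0 <= f0 z := Radon_Nikodym_SigmaFinite.f_ge0 numu.
have f0_fin : forall z, f0 z \is a fin_num := Radon_Nikodym_SigmaFinite.f_fin_num numu.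
have nuE A : measurable A -> nu A = \int[prod_measure m1 m2]_(x in A) f0 x.
  exact: Radon_Nikodym_SigmaFinite.f_integral.
pose c y := \int[m1]_x f0 (x, y).
have mc : measurable_fun setT c.
  exact: (measurable_fun_fubini_tonelli_G f0 mf0 f0_ge0).
have c0 y : 0 <= c y by apply: integral_ge0.
have cB B : measurable B -> \int[m2]_(y in B) c y = m2 B.
  move=> mB; rewrite -nu2// nuE; last first.
    by rewrite -[X in measurable X]setTI; exact: measurable_snd.
  rewrite integral_mkcond [RHS]integral_mkcond ge0_integral_prod_measure; last 2 first.
  - apply/(measurable_restrictT _ _).1; last exact: measurable_funTS.
    by rewrite -[X in measurable X]setTI; exact: measurable_snd.
  - by move=> z; rewrite patchE; case: ifPn.
  apply: eq_integral => y _; rewrite patchE; case: ifPn => yB.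
    by apply: eq_integral => x _; rewrite patchE ifT// inE /=; rewrite inE in yB.
  rewrite integral0_eq// => x _; rewrite patchE ifF//.
  by apply/negbTE; apply: contra yB; rewrite !inE.
have ic : m2.-integrable setT c.
  apply/integrableP; split => //; under eq_integral do rewrite gee0_abs//.
  by rewrite cB// (le_lt_trans (probability_le1 m2 measurableT))// ltry.
have [N [mN N0 sN]] : ae_eq m2 setT c (cst 1).
  apply: integral_ae_eq => // B _ mB.
  by rewrite cB// integral_cst// mul1e.
pose f z := if c z.2 <= 1 then fine (f0 z) else 0%R.
have mZ : measurable [set y | c y <= 1].
  by rewrite -[X in measurable X]setTI; exact: emeasurable_fun_infty_c.
have mf : measurable_fun setT f.
  apply: measurable_fun_ifT => //.
    apply: (measurable_fun_bool true); rewrite setTI.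
    rewrite (_ : _ @^-1` _ = snd @^-1` [set y | c y <= 1])//.
    by rewrite -[X in measurable X]setTI; exact: measurable_snd.
  by apply: measurableT_comp => //; exact: fine_measurable.
exists f; split => //.
- by move=> z; rewrite /f; case: ifPn => // _; exact: fine_ge0.
- move=> y; rewrite /f /=; have [cy|cy] := leP (c y) 1; last by rewrite integral0.
  by under eq_integral do rewrite fineK//.
- move=> A mA; rewrite nuE//; apply: ae_eq_integral => //.
  + exact: measurable_funTS.
  + by apply: measurable_funTS; exact/measurable_EFinP.
  + exists (snd @^-1` N); split.
    * by rewrite -[X in measurable X]setTI; exact: measurable_snd.
    * rewrite -setTX -[LHS]/((m1 \x m2) _) product_measure1E// N0 mule0//.
    * move=> z /= h; apply: sN => /= k; apply: h => _.
      by rewrite /f k// lexx fineK.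
Qed.

End slices.

Section image_measure.
Context d1 d2 (T1 : measurableType d1) (T2 : measurableType d2) (R : realType).
Context (m1 : {measure set T1 -> \bar R}) (m2 : {measure set T2 -> \bar R}).
Context (phi : T1 -> T2) (mphi : measurable_fun setT phi).
Hypothesis m2E : forall A, measurable A -> m2 A = m1 (phi @^-1` A).

Lemma ge0_integral_image (g : T2 -> \bar R) : measurable_fun setT g ->
  (forall y, 0 <= g y) -> \int[m2]_y g y = \int[m1]_x g (phi x).
Proof.
move=> mg g0.
have := @ge0_integral_pushforward _ _ _ _ _ phi mphi m1 setT g measurableT mg (fun y _ => g0 y).
by rewrite preimage_setT => <-; apply: eq_measure_integral => A mA _; exact: m2E.
Qed.

Lemma integrable_image (g : T2 -> \bar R) : measurable_fun setT g ->
  m2.-integrable setT g <-> m1.-integrable setT (g \o phi).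
Proof.
move=> mg; have e : \int[m2]_y `|g y| = \int[m1]_x `|g (phi x)|.
  by rewrite ge0_integral_image//; exact: measurableT_comp.
split => /integrableP[_ h]; apply/integrableP; split => //.
- exact: measurableT_comp.
- by rewrite -e.
- by rewrite e.
Qed.

Lemma integral_image (g : T2 -> \bar R) : measurable_fun setT g ->
  \int[m2]_y g y = \int[m1]_x g (phi x).
Proof.
move=> mg; rewrite [LHS]integralE [RHS]integralE.
rewrite -[fun x => g (phi x)]/(g \o phi) (funepos_comp g phi) (funeneg_comp g phi).
congr (_ - _); apply: ge0_integral_image => //.
  exact: measurable_funepos.
exact: measurable_funeneg.
Qed.

End image_measure.

(** * Conditional entropy power inequality *)

Section gaussian_output.
Context (R : realType).
Local Notation RR := (measurableTypeR R).
Local Notation gamma := (normal_prob (0 : R) 1).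
Context (nu nuS : probability (RR * RR)%type R) (al be s : R).

(** Turns the law of [(X, Y)] times an independent standard normal law into the law of [(S, Y)]. *)
Definition affine_noise (z : (RR * RR) * RR) : RR * RR :=
  ((al * z.1.1 + be + s * z.2)%R, z.1.2).

Lemma measurable_affine_noise : measurable_fun setT affine_noise.
Proof.
apply: measurable_fun_pair; last first.
  by apply: (measurableT_comp measurable_snd); exact: measurable_fst.
apply: measurable_funD; first apply: measurable_funD => //.
  apply: measurable_funM => //.
  by apply: (measurableT_comp measurable_fst); exact: measurable_fst.
by apply: measurable_funM => //; exact: measurable_snd.
Qed.

Hypothesis nuSE : forall A, measurable A -> nuS A = (nu \x gamma) (affine_noise @^-1` A).

Lemma ge0_integral_output (G : RR * RR -> \bar R) : measurable_fun setT G ->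
  (forall z, 0 <= G z) ->
  \int[nuS]_z G z = \int[nu]_z \int[gamma]_v G (affine_noise (z, v)).
Proof.
move=> mG G0; rewrite (ge0_integral_image measurable_affine_noise nuSE)//.
apply: (@fubini_tonelli1 _ _ _ _ _ nu gamma (G \o affine_noise)).
  by apply: measurableT_comp => //; exact: measurable_affine_noise.
by move=> x; exact: G0.
Qed.

Lemma integral_output (G : RR * RR -> \bar R) : nuS.-integrable setT G ->
  nu.-integrable setT (fun z => \int[gamma]_v G (affine_noise (z, v))) /\
  \int[nuS]_z G z = \int[nu]_z \int[gamma]_v G (affine_noise (z, v)).
Proof.
move=> iG; have mG := measurable_int _ iG.
have iG' := (integrable_image measurable_affine_noise nuSE mG).1 iG.
split; first exact: (integrable_fubini_F iG').
rewrite (integral_image measurable_affine_noise nuSE mG).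
exact/esym/(integral12_prod_meas1 iG').
Qed.

End gaussian_output.

Section output_density.
Context (R : realType).
Local Notation RR := (measurableTypeR R).
Local Notation leb := (@lebesgue_measure R).
Local Notation gamma := (normal_prob (0 : R) 1).
Context (PX mu : probability RR R) (nu nuS : probability (RR * RR)%type R) (al be s : R).
Hypothesis s0 : s != 0%R.
Hypothesis nuSE : forall A, measurable A ->
  nuS A = (nu \x gamma) (affine_noise al be s @^-1` A).
Context (f : RR * RR -> R) (mf : measurable_fun setT f) (f0 : forall z, (0 <= f z)%R).
Hypothesis f1 : forall y, \int[PX]_x (f (x, y))%:E <= 1.
Hypothesis nuf : forall A, measurable A -> nu A = \int[prod_measure PX mu]_(z in A) (f z)%:E.

(** The conditional density of [S] given [Y]: a mixture of normal densities. As [f] is relative to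
    [PX], the mixing measure on slice [y] is [f (x, y)] times [PX]. *)
Definition output_density (z : RR * RR) : R :=
  (\int[PX]_x (f (x, z.2) * normal_pdf (al * x + be) s z.1))%R.

Lemma measurable_normal_kernel :
  measurable_fun setT (fun z : RR * RR => normal_pdf (al * z.1 + be) s z.2).
Proof.
rewrite (_ : (fun _ => _) = (fun z : RR * RR => normal_pdf 0 s (z.2 - (al * z.1 + be))%R)).
  apply: measurableT_comp; first exact: measurable_normal_pdf.
  apply: measurable_funB; first exact: measurable_snd.
  apply: measurable_funD => //; apply: measurable_funM => //; exact: measurable_fst.
by apply/funext => z; rewrite normal_pdf_translate.
Qed.

Let h (p : (RR * RR) * RR) : R := (f (p.2, p.1.2) * normal_pdf (al * p.2 + be) s p.1.1)%R.

Let mh : measurable_fun setT h.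
Proof.
have m12 : measurable_fun setT (fun p : (RR * RR) * RR => p.1.2).
  exact: (measurableT_comp measurable_snd measurable_fst).
have m11 : measurable_fun setT (fun p : (RR * RR) * RR => p.1.1).
  exact: (measurableT_comp measurable_fst measurable_fst).
apply: measurable_funM.
  exact: (measurableT_comp mf (measurable_fun_pair measurable_snd m12)).
exact: (measurableT_comp measurable_normal_kernel (measurable_fun_pair measurable_snd m11)).
Qed.

Let h0 p : (0 <= h p)%R.
Proof. by rewrite mulr_ge0// normal_pdf_ge0. Qed.

Let mfy y : measurable_fun setT (fun x => f (x, y)).
Proof. by apply: measurableT_comp => //; exact: measurable_pair2. Qed.

Let ify y : PX.-integrable setT (fun x => (f (x, y))%:E).
Proof.
apply/integrableP; split; first exact/measurable_EFinP.
under eq_integral do rewrite gee0_abs ?lee_fin//.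
by rewrite (le_lt_trans (f1 y)) ?ltry.
Qed.

Let mhx z : measurable_fun setT (fun x => h (z, x)).
Proof. by apply: measurableT_comp => //; exact: measurable_pair1. Qed.

Let hpeak z x : (h (z, x) <= normal_peak s * f (x, z.2))%R.
Proof. by rewrite /h/= mulrC ler_wpM2r// normal_pdf_ub. Qed.

Let ihx z : PX.-integrable setT (fun x => (h (z, x))%:E).
Proof.
apply: (@le_integrable _ _ _ PX setT measurableT _
  (fun x => (normal_peak s)%:E * (f (x, z.2))%:E)).
- exact/measurable_EFinP.
- move=> x _; rewrite -EFinM lee_fin !ger0_norm//.
  by rewrite mulr_ge0// normal_peak_ge0.
- exact: integrableZl.
Qed.

Let sE z : (output_density z)%:E = \int[PX]_x (h (z, x))%:E.
Proof. by rewrite fineK//; exact: (integrable_fin_num measurableT (ihx z)). Qed.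

Lemma output_density_ge0 z : (0 <= output_density z)%R.
Proof. by apply: Rintegral_ge0 => x _; exact: (h0 (z, x)). Qed.

Lemma output_density_le z : (output_density z <= normal_peak s)%R.
Proof.
rewrite -lee_fin sE.
apply: (@le_trans _ _ (\int[PX]_x ((normal_peak s)%:E * (f (x, z.2))%:E))).
  apply: ge0_le_integral => //.
  - by move=> x _; rewrite lee_fin.
  - exact/measurable_EFinP.
  - by apply: emeasurable_funM => //; exact/measurable_EFinP.
  - by move=> x _; rewrite -EFinM lee_fin.
rewrite ge0_integralZl//; last 3 first.
- exact/measurable_EFinP.
- by move=> x _; rewrite lee_fin.
- by rewrite lee_fin normal_peak_ge0.
by rewrite -[leRHS]mule1 lee_wpmul2l// lee_fin normal_peak_ge0.
Qed.

Lemma measurable_output_density : measurable_fun setT output_density.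
Proof.
apply/measurable_EFinP.
rewrite (_ : _ \o _ = fubini_F PX (fun p => (h p)%:E)).
  apply: measurable_fun_fubini_tonelli_F; first exact/measurable_EFinP.
  by move=> p; rewrite lee_fin.
by apply/funext => z; rewrite /fubini_F -sE.
Qed.

Lemma output_density_continuous y : continuous (fun t => output_density (t, y)).
Proof.
move=> t.
have It : t \in `](t - 1)%R, (t + 1)%R[%classic by rewrite inE/= in_itv/= ltrDl gtrBl ltr01.
apply: (@continuity_under_integral R _ _ PX (fun t x => h ((t, y), x)) setT measurableT
  (t - 1)%R (t + 1)%R _ _ (fun x => normal_peak s * f (x, y))%R _ _ t It).
- by move=> u _; exact: ihx.
- apply: aeW => x _ u _; rewrite /h/=; apply: cvgM; first exact: cvg_cst.
  exact: continuous_normal_pdf.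
- exact: (integrableZl measurableT _ (ify y)).
- by move=> u _; apply: aeW => x _; rewrite ger0_norm//; exact: (hpeak (u, y)).
Qed.

Lemma output_density_mass y :
  \int[leb]_t (output_density (t, y))%:E = \int[PX]_x (f (x, y))%:E.
Proof.
transitivity (\int[leb]_t \int[PX]_x (h ((t, y), x))%:E).
  by apply: eq_integral => t _; rewrite sE.
rewrite (@fubini_tonelli _ _ _ _ _ leb PX (fun p => (h ((p.1, y), p.2))%:E))/=; last 2 first.
- apply/measurable_EFinP; apply: (measurableT_comp mh).
  exact: (measurable_fun_pair (measurable_fun_pair measurable_fst (measurable_cst y)) measurable_snd).
- by move=> p; rewrite lee_fin.
apply: eq_integral => x _; rewrite /h/=.
under eq_integral do rewrite EFinM.
rewrite ge0_integralZl//; last 3 first.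
- exact: measurable_normal_pdfE.
- by move=> t _; rewrite lee_fin normal_pdf_ge0.
- by rewrite lee_fin.
by rewrite integral_normal_pdf mule1.
Qed.

(** For fixed [(x, y)] the noise average is an integral against a normal density centred at
    [al * x + be]; exchanging the integrals in [x] and [t] then isolates the mixture. *)
Lemma output_densityE A : measurable A ->
  nuS A = \int[prod_measure leb mu]_(z in A) (output_density z)%:E.
Proof.
move=> mA.
pose I (z : RR * RR) : \bar R := (\1_A z)%:E.
have mI : measurable_fun setT I by apply/measurable_EFinP; exact: measurable_indic.
have I0 z : 0 <= I z by rewrite lee_fin.
have mIy y : measurable_fun setT (fun t => I (t, y)).
  by apply: measurableT_comp => //; exact: measurable_pair2.
pose J (z : RR * RR) := \int[leb]_t (I (t, z.2) * (normal_pdf (al * z.1 + be) s t)%:E).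
have mJ : measurable_fun setT J.
  pose g (p : (RR * RR) * RR) := I (p.2, p.1.2) * (normal_pdf (al * p.1.1 + be) s p.2)%:E.
  have m12 : measurable_fun setT (fun p : (RR * RR) * RR => p.1.2).
    exact: (measurableT_comp measurable_snd measurable_fst).
  have m11 : measurable_fun setT (fun p : (RR * RR) * RR => p.1.1).
    exact: (measurableT_comp measurable_fst measurable_fst).
  apply: (measurable_fun_fubini_tonelli_F (m2 := leb) g).
    apply: emeasurable_funM.
      exact: (measurableT_comp mI (measurable_fun_pair measurable_snd m12)).
    apply/measurable_EFinP.
    exact: (measurableT_comp measurable_normal_kernel (measurable_fun_pair m11 measurable_snd)).
  by move=> p; rewrite mule_ge0// lee_fin normal_pdf_ge0.
have J0 z : 0 <= J z.
  by apply: integral_ge0 => t _; rewrite mule_ge0// lee_fin normal_pdf_ge0.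
transitivity (\int[nuS]_z I z).
  by rewrite integral_indic// setIT.
rewrite (ge0_integral_output nuSE)//.
transitivity (\int[nu]_z J z).
  apply: eq_integral => -[x y] _.
  rewrite /J -(integral_normal_prob (al * x + be) s (mIy y)).
  rewrite (ge0_integral_normal_std _ s0 (mIy y))//.
  by apply: eq_integral => v _; rewrite /affine_noise/= addrC.
have mfE : measurable_fun setT (fun z => (f z)%:E) by exact/measurable_EFinP.
have f0E z : 0 <= (f z)%:E by rewrite lee_fin.
rewrite (density_integral mfE f0E nuf)// ge0_integral_prod_measure; last 2 first.
- exact: emeasurable_funM.
- by move=> z; rewrite mule_ge0.
transitivity (\int[prod_measure leb mu]_z (I z * (output_density z)%:E)); last first.
  rewrite [RHS]integral_mkcond; apply: eq_integral => z _.
  by rewrite /I patchE indicE; case: ifPn => _; rewrite ?mul1e ?mul0e.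
rewrite ge0_integral_prod_measure; last 2 first.
- by apply: emeasurable_funM => //; apply/measurable_EFinP; exact: measurable_output_density.
- by move=> z; rewrite mule_ge0// lee_fin output_density_ge0.
apply: eq_integral => y _.
transitivity (\int[PX]_x \int[leb]_t (I (t, y) * (h ((t, y), x))%:E)).
  apply: eq_integral => x _; rewrite /J/= -ge0_integralZr//; last 2 first.
  - by apply: emeasurable_funM => //; exact: measurable_normal_pdfE.
  - by move=> t _; rewrite mule_ge0// lee_fin normal_pdf_ge0.
  by apply: eq_integral => t _; rewrite /h /= EFinM -muleA; congr (_ * _); exact: muleC.
rewrite (@fubini_tonelli _ _ _ _ _ PX leb (fun p => (I (p.2, y) * (h ((p.2, y), p.1))%:E)))/=; last 2 first.
- apply: emeasurable_funM; first by apply: (measurableT_comp (mIy y)); exact: measurable_snd.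
  apply/measurable_EFinP; apply: (measurableT_comp mh).
  exact: (measurable_fun_pair (measurable_fun_pair measurable_snd (measurable_cst y)) measurable_fst).
- by move=> p; rewrite mule_ge0// lee_fin.
apply: eq_integral => t _; rewrite sE ge0_integralZl//.
- exact/measurable_EFinP.
- by move=> x _; rewrite lee_fin.
Qed.

End output_density.

Section conditional_entropy_power.
Context (R : realType).
Local Notation RR := (measurableTypeR R).
Local Notation leb := (@lebesgue_measure R).
Local Notation gamma := (normal_prob (0 : R) 1).
Context (PX mu : probability RR R) (nu nuS : probability (RR * RR)%type R).
Context (mx sx al be s : R).
Hypotheses (sx0 : sx != 0%R) (al0 : al != 0%R) (s0 : s != 0%R).
Hypothesis PXE : forall A : set RR, measurable A -> PX A = normal_prob mx sx A.
Hypothesis nu2 : forall B, measurable B -> nu (snd @^-1` B) = mu B.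
Hypothesis nuSE : forall A, measurable A ->
  nuS A = (nu \x gamma) (affine_noise al be s @^-1` A).
Hypothesis nu_sqr : nu.-integrable setT (fun z => (z.1 ^+ 2)%:E).

(** Makes the quadratically bounded [ln w] integrable under the law of [(S, Y)]. The factors 3 come
    from [(a + b + c)^2 <= 3 (a^2 + b^2 + c^2)]. *)
Lemma output_sqr_integrable : nuS.-integrable setT (fun z => (z.1 ^+ 2)%:E).
Proof.
have m1 : measurable_fun setT (fun z : RR * RR => (z.1 ^+ 2)%:E).
  by apply/measurable_EFinP; apply: measurable_funX; exact: measurable_fst.
apply/integrableP; split => //.
under eq_integral do rewrite gee0_abs ?lee_fin ?sqr_ge0//.
rewrite (ge0_integral_output nuSE)//; last by move=> z; rewrite lee_fin sqr_ge0.
pose c (z : RR * RR) := (3 * (al ^+ 2 * z.1 ^+ 2) + (3 * be ^+ 2 + 3 * s ^+ 2))%R.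
have ic : nu.-integrable setT (fun z => (c z)%:E).
  rewrite /c; under eq_fun do rewrite EFinD 2!EFinM.
  apply: integrableD => //; last exact: finite_measure_integrable_cst.
  by do 2 (apply: integrableZl => //).
have c0 z : (0 <= c z)%R.
  have := sqr_ge0 (al * z.1); have := sqr_ge0 be; have := sqr_ge0 s.
  by rewrite /c exprMn; lra.
apply: (@le_lt_trans _ _ (\int[nu]_z (c z)%:E)); last first.
  by rewrite -(fineK (integrable_fin_num measurableT ic)) ltry.
apply: ge0_le_integral => //.
- by move=> z _; apply: integral_ge0 => v _; rewrite lee_fin sqr_ge0.
- apply: (measurable_fun_fubini_tonelli_F (m2 := gamma)
    (fun p => (((affine_noise al be s p).1) ^+ 2)%:E)) => [|p]; last first.
    by rewrite lee_fin sqr_ge0.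
  by apply: (measurableT_comp m1); exact: measurable_affine_noise.
- exact: measurable_int ic.
- move=> z _.
  have e2 : is_mean gamma (fun v : R => v ^+ 2)%R 1%R.
    by split; [exact: integrable_sqr_normal|exact: integral_sqr_normal].
  have eU := is_meanD (is_mean_cst gamma (3 * (al ^+ 2 * z.1 ^+ 2) + 3 * be ^+ 2)%R)
    (is_meanZ (3 * s ^+ 2)%R e2).
  rewrite (_ : c z = (3 * (al ^+ 2 * z.1 ^+ 2) + 3 * be ^+ 2 + 3 * s ^+ 2 * 1)%R); last first.
    by rewrite /c; ring.
  rewrite -eU.2; apply: ge0_le_integral => //.
  + by move=> v _; rewrite lee_fin sqr_ge0.
  + apply: (measurableT_comp m1).
    apply: (measurableT_comp (measurable_affine_noise al be s)).
    exact: measurable_pair1.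
  + by have := measurable_int _ eU.1.
  + move=> v _; rewrite lee_fin /affine_noise/=.
    have := sqr_ge0 (al * z.1 - be); have := sqr_ge0 (al * z.1 - s * v).
    have := sqr_ge0 (be - s * v); rewrite !expr2 => *; nra.
Qed.

Lemma ge0_integral_input (g : R -> \bar R) : measurable_fun setT g ->
  (forall x, 0 <= g x) ->
  \int[PX]_x g x = \int[leb]_x (g x * (normal_pdf mx sx x)%:E).
Proof.
move=> mg g0; rewrite -(integral_normal_prob mx sx mg).
by apply: eq_measure_integral => A mA _; exact: PXE.
Qed.

(** Here [i = I(X;Y)] and [e = - h(X)], so [i + e] is [- h(X|Y)]. Each [lam] gives an inequality
    that is linear in the two conditional entropies; the best [lam] is chosen by the caller. *)
Lemma conditional_entropy_power lam i e : (0 < lam < 1)%R ->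
  expected_log_density nu (prod_measure PX mu) = i%:E ->
  is_mean nu (fun z => ln (normal_pdf mx sx z.1)) e ->
  expected_log_density nuS (prod_measure leb mu) <=
    (lam * (i + e + ln (smoothing_const lam s) - ln `|al|))%:E.
Proof.
move=> /andP[l0 l1] iE eE.
have numu : nu `<< prod_measure PX mu.
  by apply: contrapT => h; move: iE; rewrite /expected_log_density ifF//; apply/negbTE/asboolPn.
have [f [mf f0 f1 nuf]] := density_slices nu2 numu.
pose sd := output_density PX al be s f.
have msd : measurable_fun setT sd by exact: measurable_output_density.
have sd0 z : (0 <= sd z)%R by exact: output_density_ge0.
have sd1 z : (sd z <= normal_peak s)%R by exact: output_density_le.
have eld : expected_log_density nuS (prod_measure leb mu) = \int[nuS]_z lne (sd z)%:E.
  apply: expected_log_densityE => [|z|A mA]; first exact/measurable_EFinP.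
  - by rewrite lee_fin.
  - exact: (output_densityE s0 nuSE mf f0 f1 nuf mA).
pose K := smoothing_const lam s.
have K0 : (0 < K)%R.
  by rewrite divr_gt0 ?expR_gt0// normal_peak_gt0// gt_eqF// sqrtr_gt0.
have pk0 : (0 < normal_peak s)%R := normal_peak_gt0 s0.
set X := (lam * _)%R.
(* [eps] is the weight of the Cauchy regularisation and [eps * pi] its total cost. *)
suff H (eps : R) : (0 < eps)%R ->
    expected_log_density nuS (prod_measure leb mu) <= (X + eps * pi)%:E.
  apply/lee_addgt0Pr => d d0; have := H (d / pi)%R; rewrite divfK ?gt_eqF ?pi_gt0//.
  by apply; rewrite divr_gt0// pi_gt0.
move=> eps0.
pose c1 y := fine (\int[PX]_x (f (x, y))%:E).
have c10 y : (0 <= c1 y)%R by apply: fine_ge0; apply: integral_ge0 => x _; rewrite lee_fin.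
have c1E y : (c1 y)%:E = \int[PX]_x (f (x, y))%:E.
  rewrite fineK// ge0_fin_numE; first by rewrite (le_lt_trans (f1 y)) ?ltry.
  by apply: integral_ge0 => x _; rewrite lee_fin.
have c11 y : (c1 y <= 1)%R by rewrite -lee_fin c1E.
have mc1 : measurable_fun setT c1.
  apply/measurable_EFinP; rewrite (_ : _ \o _ = fubini_G PX (fun z => (f z)%:E)); last first.
    by apply/funext => y /=; rewrite c1E.
  by apply: measurable_fun_fubini_tonelli_G => [|z]; [exact/measurable_EFinP|rewrite lee_fin].
have epi : (0 < eps * pi)%R by rewrite mulr_gt0// pi_gt0.
(* Slices of [f] may have mass below one, so each regularised slice is normalised by its own
   mass. *)
pose Z y := (c1 y + eps * pi)%R.
have Z0 y : (0 < Z y)%R by rewrite ltr_wpDl.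
pose w z := ((sd z + eps * (1 + z.1 ^+ 2)^-1) / Z z.2)%R.
have q0 (t : R) : (0 < 1 + t ^+ 2)%R by rewrite ltr_pwDl// sqr_ge0.
pose e0 := (eps / (1 + eps * pi))%R.
pose M := ((normal_peak s + eps) / (eps * pi))%R.
have e00 : (0 < e0)%R by rewrite divr_gt0// addr_gt0.
have wb z : (e0 / (1 + z.1 ^+ 2) <= w z <= M)%R.
  have a1 : (0 <= eps * (1 + z.1 ^+ 2)^-1 <= eps)%R.
    rewrite mulr_ge0 ?invr_ge0 ?(ltW eps0) ?(ltW (q0 _))//=.
    by rewrite -[leRHS]mulr1 ler_wpM2l ?(ltW eps0)// invf_le1// lerDl sqr_ge0.
  case/andP: a1 => a1 a2; rewrite /w /e0 /M; apply/andP; split.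
    rewrite mulrAC ler_pdivrMr ?addr_gt0// mulrAC ler_pdivlMr//.
    apply: ler_pM => //; first exact: ltW.
      by rewrite lerDr.
    by rewrite lerD2r.
  rewrite ler_pdivrMr// mulrAC ler_pdivlMr//; apply: ler_pM; rewrite ?addr_ge0 ?(ltW epi)//.
    by rewrite lerD.
  by rewrite lerDr.
have mw : measurable_fun setT w.
  apply: measurable_funM.
    apply: measurable_funD => //; apply: measurable_funM => //.
    apply: measurable_inv_gt0 => [|z]; last exact: q0.
    by apply: measurable_funD => //; apply: measurable_funX; exact: measurable_fst.
  apply: measurable_inv_gt0 => [|z]; last exact: Z0.
  by apply: measurable_funD => //; apply: (measurableT_comp mc1); exact: measurable_snd.
have w0 z : (0 < w z)%R.
  by case/andP: (wb z) => h _; apply: lt_le_trans h; rewrite divr_gt0.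
have cw y : continuous (fun t => w (t, y)).
  move=> t; rewrite /w /=; apply: (@cvgM R R); last exact: (@cvg_cst R).
  apply: cvgD; first exact: (output_density_continuous s0 mf f0 f1).
  apply: cvgM; first exact: cvg_cst.
  exact: (@continuous_oneDsqrV R t).
have iw y : \int[leb]_t (w (t, y))%:E = 1.
  transitivity (\int[leb]_t ((Z y)^-1%:E * ((sd (t, y))%:E + eps%:E * ((1 + t ^+ 2)^-1)%:E))).
    by apply: eq_integral => t _; rewrite /w/= mulrC EFinM EFinD EFinM.
  have msdy : measurable_fun setT (fun t => (sd (t, y))%:E).
    by apply/measurable_EFinP; apply: measurableT_comp => //; exact: measurable_pair2.
  have mca : measurable_fun setT (fun t : R => ((1 + t ^+ 2)^-1)%:E).
    exact: measurable_int (integrable_cauchy R).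
  rewrite ge0_integralZl//; last 3 first.
  - by apply: emeasurable_funD => //; exact: emeasurable_funM.
  - by move=> t _; rewrite adde_ge0 ?lee_fin ?sd0// mulr_ge0 ?invr_ge0 ?(ltW eps0) ?(ltW (q0 _)).
  - by rewrite lee_fin invr_ge0 ltW.
  rewrite ge0_integralD//; last 3 first.
  - by move=> t _; rewrite lee_fin.
  - by move=> t _; rewrite mule_ge0 ?lee_fin ?invr_ge0 ?(ltW eps0) ?(ltW (q0 _)).
  - exact: emeasurable_funM.
  rewrite output_density_mass// -c1E ge0_integralZl//; last 2 first.
  - by move=> t _; rewrite lee_fin invr_ge0 ltW.
  - by rewrite lee_fin ltW.
  rewrite integral_cauchy; transitivity (((Z y)^-1 * Z y)%R%:E) => //.
  by rewrite mulVf// gt_eqF.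
(* Since [Z y <= 1 + eps * pi], the true density is at most [1 + eps * pi] times the regularised
   one. *)
have lsd z : lne (sd z)%:E <= (ln (1 + eps * pi) + ln (w z))%:E.
  have [s1|s1] := leP (sd z) 0%R; first by rewrite le0_lneNy ?lee_fin ?leNye.
  have e1 : (0 < 1 + eps * pi)%R by exact: addr_gt0.
  rewrite lne_EFin// lee_fin -lnM ?posrE// ler_ln ?posrE ?(mulr_gt0 e1 (w0 z))//.
  rewrite /w mulrA ler_pdivlMr// mulrC; apply: ler_pM; rewrite ?sd0 ?(ltW (Z0 _))//.
    by rewrite lerD2r.
  by rewrite lerDl mulr_ge0 ?invr_ge0 ?(ltW eps0) ?(ltW (q0 _)).
have ilw : nuS.-integrable setT (fun z => (ln (w z))%:E).
  pose C := (M + `|ln e0| + 1)%R.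
  apply: (@le_integrable _ _ _ nuS setT measurableT _ (fun z => C%:E * (1 + z.1 ^+ 2)%:E)).
  - by apply/measurable_EFinP; apply: measurableT_comp => //; exact: measurable_ln.
  - move=> z _; rewrite -EFinM lee_fin; case/andP: (wb z) => b1 b2.
    by apply: le_trans (ln_density_bound e00 b1 b2) _; exact: ler_norm.
  - apply: integrableZl => //; under eq_fun do rewrite EFinD.
    apply: integrableD => //; last exact: output_sqr_integrable.
    exact: finite_measure_integrable_cst.
pose g z := gsmooth s (fun t => ln (w (t, z.2))) (al * z.1 + be).
have gE z : (g z)%:E = \int[gamma]_v (ln (w (affine_noise al be s (z, v))))%:E.
  rewrite /g /gsmooth fineK//; apply: integrable_fin_num => //.
  apply: (integrable_ln_density s (al * z.1 + be)%R e00 _ (fun t => wb (t, z.2))).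
  by apply: continuous_measurable_fun; exact: cw.
have [ig eg] := integral_output nuSE ilw.
have ig' : nu.-integrable setT (EFin \o g).
  by apply: eq_integrable ig => // z _; rewrite /= gE.
have Lg := integrable_is_mean ig'.
set L := (\int[nu]_x g x)%R in Lg.
have egL : \int[nuS]_z (ln (w z))%:E = L%:E.
  by rewrite eg -Lg.2; apply: eq_integral => z _; rewrite gE.
have mg : measurable_fun setT g by apply/measurable_EFinP; exact: measurable_int ig'.
have a0 : (0 < `|al|)%R by rewrite normr_gt0.
(* The trial conditional density of [X] given [Y], relative to [PX]: hence the division by the
   normal density of [X]. [K] bounds the integral in [al * x + be] and [|al|] is the Jacobian. *)
pose r z := (expR (lam^-1 * g z) * (`|al| / (K * normal_pdf mx sx z.1)))%R.
have n0 (x : R) : (0 < normal_pdf mx sx x)%R by exact: normal_pdf_gt0.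
have r0 z : (0 < r z)%R by rewrite mulr_gt0 ?expR_gt0// divr_gt0// mulr_gt0.
have mr : measurable_fun setT r.
  apply: measurable_funM; first by apply: measurableT_comp => //; exact: measurable_funM.
  apply: measurable_funM => //; apply: measurable_inv_gt0 => [|z]; last exact: mulr_gt0.
  apply: measurable_funM => //; apply: (measurableT_comp (measurable_normal_pdf mx sx)).
  exact: measurable_fst.
have ir : \int[prod_measure PX mu]_z (r z)%:E <= 1.
  rewrite ge0_integral_prod_measure; last 2 first.
  - exact/measurable_EFinP.
  - by move=> z; rewrite lee_fin ltW.
  apply: (@le_trans _ _ (\int[mu]_y cst 1 y)); last by rewrite (is_mean_cst mu 1%R).2.
  apply: ge0_le_integral => //.
  - by move=> y _; apply: integral_ge0 => x _; rewrite lee_fin ltW.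
  - apply: (measurable_fun_fubini_tonelli_G (m1 := PX) (fun z => (r z)%:E)).
      exact/measurable_EFinP.
    by move=> z; rewrite lee_fin ltW.
  move=> y _; rewrite ge0_integral_input; last 2 first.
  - by apply/measurable_EFinP; apply: (measurableT_comp mr); exact: measurable_pair2.
  - by move=> x; rewrite lee_fin ltW.
  pose E x := (expR (lam^-1 * gsmooth s (fun t => ln (w (t, y))) x))%R.
  (* Measurability in [x] is read off from the joint measurability of [g] by inverting
     [x -> al * x + be]. *)
  have mgy : measurable_fun setT (gsmooth s (fun t => ln (w (t, y)))).
    rewrite (_ : gsmooth _ _ = (fun x => g ((x - be) / al, y))%R).
      apply: (measurableT_comp mg); apply: measurable_fun_pair => //.
      by apply: measurable_funM => //; exact: measurable_funB.
    by apply/funext => x; rewrite /g/= mulrC divfK// subrK.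
  have mE : measurable_fun setT (fun x => (E x)%:E).
    by apply/measurable_EFinP; apply: measurableT_comp => //; exact: measurable_funM.
  have E0 x : 0 <= (E x)%:E by rewrite lee_fin expR_ge0.
  have core : \int[leb]_x (E x)%:E <= K%:E.
    by apply: (smoothed_log_density_le (cw y) e00 (fun t => wb (t, y))) => //; rewrite l0.
  rewrite (ge0_integral_affine be al0 mE E0) in core.
  have mEa : measurable_fun setT (fun x : R => (E (al * x + be)%R)%:E).
    apply: (measurableT_comp mE); apply: measurable_funD => //; exact: measurable_funM.
  have -> : \int[leb]_x ((r (x, y))%:E * (normal_pdf mx sx x)%:E) =
      K^-1%:E * (`|al|%:E * \int[leb]_x (E (al * x + be)%R)%:E).
    have K10 : 0 <= K^-1%:E by rewrite lee_fin invr_ge0 ltW.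
    have mEa2 : measurable_fun setT (fun x : R => `|al|%:E * (E (al * x + be)%R)%:E).
      exact: emeasurable_funM.
    have aE0 (x : R) : setT x -> 0 <= `|al|%:E * (E (al * x + be)%R)%:E by rewrite mule_ge0.
    rewrite -!ge0_integralZl//.
    apply: eq_integral => x _; rewrite -!EFinM /r /E /g/=; congr EFin.
    by field; rewrite !gt_eqF.
  rewrite -[leRHS]/1 (_ : 1 = K^-1%:E * K%:E); last by rewrite -EFinM mulVf// gt_eqF.
  by rewrite lee_wpmul2l// lee_fin invr_ge0 ltW.
have lr z : ln (r z) = (lam^-1 * g z + (ln `|al| - ln K) + (-1) * ln (normal_pdf mx sx z.1))%R.
  have Kn : (0 < K * normal_pdf mx sx z.1)%R by exact: mulr_gt0.
  have q1 : (0 < `|al| / (K * normal_pdf mx sx z.1))%R by exact: divr_gt0.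
  rewrite /r lnM ?posrE ?expR_gt0// expRK ln_div ?posrE// lnM ?posrE//.
  by move: (ln _) (ln _) (ln _) => x1 x2 x3; ring.
have er := is_meanD (is_meanD (is_meanZ lam^-1 Lg) (is_mean_cst nu (ln `|al| - ln K)%R))
  (is_meanZ (-1) eE).
have lrE : (fun x => lam^-1 * g x + (ln `|al| - ln K) + -1 * ln (normal_pdf mx sx x.1))%R = (fun z => ln (r z)).
  by apply/funext => z; rewrite lr.
rewrite lrE in er.
have G := @gibbs _ _ _ nu (prod_measure PX mu) r mr r0 ir er.1.
rewrite er.2 iE lee_fin in G.
have LX : (L <= X)%R.
  have {}G : (lam^-1 * L <= i + e + ln K - ln `|al|)%R by lra.
  have := ler_wpM2l (ltW l0) G; rewrite mulrA divff ?gt_eqF// mul1r.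
  by rewrite /X.
rewrite eld.
apply: (@le_trans _ _ (\int[nuS]_z ((ln (1 + eps * pi))%:E + (ln (w z))%:E))).
  apply: integral_le_integrable => //.
  - apply: measurableT_comp; [exact: measurable_lne|exact/measurable_EFinP].
  - by apply: integrableD => //; exact: finite_measure_integrable_cst.
rewrite integralD//; last exact: finite_measure_integrable_cst.
rewrite egL (is_mean_cst nuS _).2 -EFinD lee_fin addrC lerD//.
by apply: le_ln1Dx; apply: lt_trans epi.
Qed.

End conditional_entropy_power.

(** * The noise floor of the conditional entropy, and the noiseless case *)

Section output_entropy_bounds.
Context (R : realType).
Local Notation RR := (measurableTypeR R).
Local Notation leb := (@lebesgue_measure R).
Local Notation gamma := (normal_prob (0 : R) 1).
Context (PX mu : probability RR R) (nu nuS : probability (RR * RR)%type R).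
Context (mx sx al be s : R).
Hypothesis nu2 : forall B, measurable B -> nu (snd @^-1` B) = mu B.
Hypothesis nuSE : forall A, measurable A ->
  nuS A = (nu \x gamma) (affine_noise al be s @^-1` A).

Let nuS2 B : measurable B -> nuS (snd @^-1` B) = mu B.
Proof.
move=> mB; rewrite nuSE; last by rewrite -[X in measurable X]setTI; exact: measurable_snd.
rewrite (_ : _ @^-1` _ = (snd @^-1` B) `*` setT); last first.
  by apply/seteqP; split => -[[x y] v]//= [].
rewrite product_measure1E//; last first.
  by rewrite -[X in measurable X]setTI; exact: measurable_snd.
by rewrite -[RHS]mule1; congr (_ * _); [exact: nu2|exact: probability_setT].
Qed.

(** A null set has null slices for almost every [y], and a nondegenerate normal law ignores
    Lebesgue-null sets. The law of [(X, Y)] itself may be singular, as for the identity channel. *)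
Lemma output_dominated : s != 0%R -> nuS `<< prod_measure leb mu.
Proof.
move=> s0; apply/null_content_dominatesP => A mA A0.
pose I (z : RR * RR) : \bar R := (\1_A z)%:E.
have mI : measurable_fun setT I by apply/measurable_EFinP; exact: measurable_indic.
have I0 z : 0 <= I z by rewrite lee_fin.
have mIy y : measurable_fun setT (fun t => I (t, y)).
  by apply: measurableT_comp => //; exact: measurable_pair2.
pose c y := \int[leb]_t I (t, y).
have mc : measurable_fun setT c by exact: (measurable_fun_fubini_tonelli_G I mI I0).
have c0 y : 0 <= c y by exact: integral_ge0.
have ic : \int[mu]_y `|c y| = 0.
  under eq_integral do rewrite gee0_abs//.
  rewrite -(ge0_integral_prod_measure leb mu mI I0) integral_indic// setIT.
  exact: A0.
have [N [mN N0 sN]] := (ae_eq_integral_abs mu measurableT mc).1 ic.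
transitivity (\int[nuS]_z I z); first by rewrite integral_indic// setIT.
rewrite (ge0_integral_output nuSE)//.
have mF : measurable_fun setT (fun z => \int[gamma]_v I (affine_noise al be s (z, v))).
  apply: (measurable_fun_fubini_tonelli_F (m2 := gamma)
    (fun p => I (affine_noise al be s p))) => //.
  by apply: (measurableT_comp mI); exact: measurable_affine_noise.
rewrite (ae_eq_integral (cst 0)) ?integral0//.
exists (snd @^-1` N); split.
- by rewrite -[X in measurable X]setTI; exact: measurable_snd.
- by apply: etrans N0; exact: nu2.
- move=> -[x y] /= h; apply: sN => /= k; apply: h => _.
  have {}k := k Logic.I.
  transitivity (\int[normal_prob (al * x + be) s]_t I (t, y)).
    rewrite (ge0_integral_normal_std _ s0 (mIy y))//.
    by apply: eq_integral => v _; rewrite /affine_noise/= addrC.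
  rewrite (integral_normal_prob _ _ (mIy y)).
  apply/eqP; rewrite eq_le; apply/andP; split; last first.
    by apply: integral_ge0 => t _; rewrite mule_ge0// lee_fin normal_pdf_ge0.
  apply: (@le_trans _ _ (\int[leb]_t ((normal_peak s)%:E * I (t, y)))).
    apply: ge0_le_integral => //.
    - by move=> t _; rewrite mule_ge0// lee_fin normal_pdf_ge0.
    - by apply: emeasurable_funM => //; exact: measurable_normal_pdfE.
    - exact: emeasurable_funM.
    - by move=> t _; rewrite muleC lee_wpmul2r// lee_fin normal_pdf_ub.
  rewrite ge0_integralZl//; last by rewrite lee_fin normal_peak_ge0.
  by rewrite -/(c y) k mule0.
Qed.

(** Conditionally on [(X, Y)] only the noise [s Z] remains, and its entropy is a lower bound for
    [h(S|Y)]. The proof compares the density [f] of [(S, Y)] with the noise density [q] through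
    [ln f <= ln q - 1 + f / q], so it also covers infinite [I(X;Y)]. *)
Lemma output_entropy_ge : s != 0%R ->
  expected_log_density nuS (prod_measure leb mu) <= (ln (normal_peak s) - 1 / 2)%:E.
Proof.
move=> s0.
have [f [mf f0 f1 nuf]] := density_slices nuS2 (output_dominated s0).
have mfE : measurable_fun setT (fun z => (f z)%:E) by exact/measurable_EFinP.
rewrite (expected_log_densityE (f := fun z => (f z)%:E))//.
have mA := measurable_affine_noise al be s.
pose q (v : R) := (normal_peak s * expR (- v ^+ 2 / 2))%R.
have pk0 : (0 < normal_peak s)%R := normal_peak_gt0 s0.
have q0 v : (0 < q v)%R by rewrite mulr_gt0 ?expR_gt0.
have qE m v : q v = normal_pdf m s (s * v + m).
  rewrite normal_pdfE// /normal_fun addrK /q; congr (_ * expR _)%R.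
  have ? : (s ^+ 2 != 0)%R by rewrite expf_neq0.
  by rewrite exprMn -mulr_natr; field.
have mq : measurable_fun setT q.
  rewrite (_ : q = fun v => normal_pdf 0 s (s * v + 0)%R); last by apply/funext => v; rewrite (qE 0%R).
  apply: (measurableT_comp (measurable_normal_pdf 0 s)).
  by apply: measurable_funD => //; exact: measurable_funM.
pose F (p : (RR * RR) * RR) := (f (affine_noise al be s p) / q p.2)%R.
have F0 p : 0 <= (F p)%:E by rewrite lee_fin divr_ge0// ltW.
have mF : measurable_fun setT (fun p => (F p)%:E).
  apply/measurable_EFinP; apply: measurable_funM; first exact: (measurableT_comp mf mA).
  by apply: measurable_inv_gt0 => //; apply: (measurableT_comp mq); exact: measurable_snd.
(* Given [(x, y)], [q v] is exactly the density of [S] at the noisy point, so averaging over [v]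
   cancels it and leaves a slice mass of [f]. *)
have iF : \int[nu \x gamma]_p (F p)%:E <= 1.
  rewrite fubini_tonelli1//; apply: (@le_trans _ _ (\int[nu]_z cst 1 z)); last first.
    by rewrite (is_mean_cst nu 1%R).2.
  apply: ge0_le_integral => //.
  - by move=> z _; apply: integral_ge0.
  - exact: measurable_fun_fubini_tonelli_F.
  move=> -[x y] _; rewrite /fubini_F.
  pose G t : \bar R := (f (t, y) / normal_pdf (al * x + be) s t)%:E.
  have mfy : measurable_fun setT (fun t => f (t, y)).
    by apply: (measurableT_comp mf); exact: measurable_pair2.
  have mG : measurable_fun setT G.
    apply/measurable_EFinP; apply: measurable_funM => //.
    apply: measurable_inv_gt0; first exact: measurable_normal_pdf.
    by move=> t; exact: normal_pdf_gt0.
  have G0 t : 0 <= G t by rewrite lee_fin divr_ge0// normal_pdf_ge0.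
  rewrite (_ : integral _ _ _ = \int[gamma]_v G (s * v + (al * x + be))%R); last first.
    apply: eq_integral => v _; rewrite /F /G /affine_noise/= (qE (al * x + be)%R).
    by rewrite (addrC (s * v)%R).
  rewrite -(ge0_integral_normal_std _ s0 mG G0) (integral_normal_prob _ _ mG).
  rewrite (_ : integral _ _ _ = \int[leb]_t (f (t, y))%:E) ?f1//.
  by apply: eq_integral => t _; rewrite -EFinM divfK// gt_eqF// normal_pdf_gt0.
have iF' : (nu \x gamma).-integrable setT (fun p => (F p)%:E).
  apply/integrableP; split => //; under eq_integral do rewrite gee0_abs//.
  by rewrite (le_lt_trans iF) ?ltry.
(* This is [ln (q p.2) - 1]; its mean is [ln (normal_peak s) - 3 / 2], and adding the mass of [F]
   gives the constant of the statement. *)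
pose H (p : (RR * RR) * RR) := (ln (normal_peak s) - 1 - p.2 ^+ 2 / 2)%R.
have eH : is_mean gamma (fun v => ln (normal_peak s) - 1 + (- (1 / 2)) * v ^+ 2)%R
    (ln (normal_peak s) - 1 + (- (1 / 2)) * 1)%R.
  apply: is_meanD; first exact: is_mean_cst.
  apply: is_meanZ; split; [exact: integrable_sqr_normal|exact: integral_sqr_normal].
have HE p : H p = (ln (normal_peak s) - 1 + (- (1 / 2)) * p.2 ^+ 2)%R by rewrite /H; field.
have mH : measurable_fun setT (fun p => (H p)%:E).
  have := measurableT_comp (measurable_int _ eH.1) (@measurable_snd _ _ (RR * RR)%type RR).
  by apply: eq_measurable_fun => p _; rewrite /= HE.
have iH : (nu \x gamma).-integrable setT (fun p => (H p)%:E).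
  apply/integrable12ltyP => //.
  under eq_integral do under eq_integral do rewrite HE.
  have := integrable_abse eH.1 => /(integrable_fin_num measurableT).
  set I := (\int[gamma]_v _) => Ifin.
  rewrite (_ : integral _ _ _ = \int[nu]_z I)//.
  by rewrite -(fineK Ifin) (is_mean_cst nu _).2 ltry.
have eH' : \int[nu \x gamma]_p (H p)%:E = (ln (normal_peak s) - 3 / 2)%:E.
  rewrite -(integral12_prod_meas1 iH).
  rewrite (_ : integral _ _ _ = \int[nu]_z (ln (normal_peak s) - 1 + (- (1 / 2)) * 1)%:E).
    by rewrite (is_mean_cst nu _).2; congr EFin; field.
  by apply: eq_integral => z _; rewrite -eH.2; apply: eq_integral => v _; rewrite HE.
have mlf : measurable_fun setT (fun z => lne (f z)%:E).
  exact: (measurableT_comp (@measurable_lne R) mfE).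
rewrite (integral_image mA nuSE mlf).
apply: (@le_trans _ _ (\int[nu \x gamma]_p ((H p)%:E + (F p)%:E))).
  apply: integral_le_integrable; first exact: (measurableT_comp mlf mA).
    exact: integrableD.
  move=> p; rewrite -EFinD.
  have [h|h] := leP (f (affine_noise al be s p)) 0%R.
    by rewrite le0_lneNy ?lee_fin ?leNye.
  rewrite lne_EFin// lee_fin.
  have Fp : (0 < F p)%R by rewrite divr_gt0.
  have := ln_le_subr1 Fp; rewrite {1}/F ln_div ?posrE// /q lnM ?posrE ?expR_gt0// expRK /H.
  lra.
rewrite integralD// eH'.
have Ffin := integrable_fin_num measurableT iF'.
move: iF; rewrite -(fineK Ffin) -EFinD !lee_fin; lra.
Qed.

(** For [s = 0] the map [(x, y) -> (al * x + be, y)] is invertible, so the density of [(S, Y)] is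
    that of [(X, Y)] relative to Lebesgue times [mu], transported and divided by [|al|]. *)
Lemma noiseless_output_entropy i e : s = 0%R -> sx != 0%R -> al != 0%R ->
  (forall A : set RR, measurable A -> PX A = normal_prob mx sx A) ->
  expected_log_density nu (prod_measure PX mu) = i%:E ->
  is_mean nu (fun z => ln (normal_pdf mx sx z.1)) e ->
  expected_log_density nuS (prod_measure leb mu) = (i + e - ln `|al|)%:E.
Proof.
move=> s0 sx0 al0 PXE iE eE.
have numu : nu `<< prod_measure PX mu.
  by apply: contrapT => h; move: iE; rewrite /expected_log_density ifF//; apply/negbTE/asboolPn.
have [f [mf f0 f1 nuf]] := density_slices nu2 numu.
have mfE : measurable_fun setT (fun z => (f z)%:E) by exact/measurable_EFinP.
have f0E z : 0 <= (f z)%:E by rewrite lee_fin.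
rewrite (expected_log_densityE mfE f0E nuf) in iE.
have n0 x : (0 < normal_pdf mx sx x)%R by exact: normal_pdf_gt0.
have a0 : (0 < `|al|)%R by rewrite normr_gt0.
pose A0 (z : RR * RR) : RR * RR := ((al * z.1 + be)%R, z.2).
have mA0 : measurable_fun setT A0.
  apply: measurable_fun_pair; last exact: measurable_snd.
  by apply: measurable_funD => //; apply: measurable_funM => //; exact: measurable_fst.
have nuS0 A : measurable A -> nuS A = nu (A0 @^-1` A).
  move=> mA; rewrite nuSE// (_ : _ @^-1` _ = (A0 @^-1` A) `*` setT); last first.
    by apply/seteqP; split => -[[x y] v]; rewrite /affine_noise /A0/= s0 mul0r addr0//= => -[].
  rewrite product_measure1E//; last by rewrite -[X in measurable X]setTI; exact: mA0.
  by rewrite -[RHS]mule1; congr (_ * _); exact: probability_setT.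
pose k (z : RR * RR) := (f z * (normal_pdf mx sx z.1 / `|al|))%R.
pose inv (z : RR * RR) : RR * RR := (((z.1 - be) / al)%R, z.2).
have minv : measurable_fun setT inv.
  apply: measurable_fun_pair; last exact: measurable_snd.
  by apply: measurable_funM => //; apply: measurable_funB => //; exact: measurable_fst.
pose h z := k (inv z).
have mk : measurable_fun setT k.
  apply: measurable_funM => //; apply: measurable_funM => //.
  by apply: (measurableT_comp (measurable_normal_pdf mx sx)); exact: measurable_fst.
have k0 z : (0 <= k z)%R by rewrite mulr_ge0// divr_ge0 ?(ltW a0) ?(ltW (n0 _)).
have mh : measurable_fun setT h by exact: (measurableT_comp mk minv).
have h0 z : (0 <= h z)%R by exact: k0.
have invK z : inv (A0 z) = z by case: z => x y; rewrite /inv /A0/= addrK mulrC mulKf.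
have nuSh A : measurable A -> nuS A = \int[prod_measure leb mu]_(z in A) (h z)%:E.
  move=> mA; pose I (z : RR * RR) : \bar R := (\1_A z)%:E.
  have mI : measurable_fun setT I by apply/measurable_EFinP; exact: measurable_indic.
  have I0 z : 0 <= I z by rewrite lee_fin.
  transitivity (\int[nuS]_z I z); first by rewrite integral_indic// setIT.
  rewrite (ge0_integral_image mA0 nuS0)// (density_integral mfE f0E nuf); last 2 first.
  - exact: (measurableT_comp mI mA0).
  - by move=> z; exact: I0.
  rewrite ge0_integral_prod_measure; last 2 first.
  - by apply: emeasurable_funM => //; exact: (measurableT_comp mI mA0).
  - by move=> z; rewrite mule_ge0.
  transitivity (\int[prod_measure leb mu]_z (I z * (h z)%:E)); last first.
    rewrite [RHS]integral_mkcond; apply: eq_integral => z _.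
    by rewrite /I patchE indicE; case: ifPn => _; rewrite ?mul1e ?mul0e.
  have mIh : measurable_fun setT (fun z => I z * (h z)%:E).
    by apply: emeasurable_funM => //; exact/measurable_EFinP.
  have Ih0 z : 0 <= I z * (h z)%:E by rewrite mule_ge0// lee_fin.
  rewrite (ge0_integral_prod_measure leb mu mIh Ih0).
  apply: eq_integral => y _.
  have mG : measurable_fun setT (fun x => I (A0 (x, y)) * (f (x, y))%:E).
    apply: (measurableT_comp (f := fun z => I (A0 z) * (f z)%:E)); last exact: measurable_pair2.
    by apply: emeasurable_funM => //; exact: (measurableT_comp mI mA0).
  transitivity (\int[normal_prob mx sx]_x (I (A0 (x, y)) * (f (x, y))%:E)).
    by apply: eq_measure_integral => B mB _; exact: PXE.
  rewrite (integral_normal_prob _ _ mG).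
  have mIhy : measurable_fun setT (fun t => I (t, y) * (h (t, y))%:E).
    by apply: (measurableT_comp mIh); exact: measurable_pair2.
  rewrite (ge0_integral_affine be al0 mIhy (fun t => Ih0 (t, y))).
  have mIha : measurable_fun setT (fun x : RR => I ((al * x + be)%R, y) * (h ((al * x + be)%R, y))%:E).
    apply: (measurableT_comp mIhy).
    by apply: measurable_funD => //; exact: measurable_funM.
  rewrite -(ge0_integralZl leb measurableT mIha) => [||//]; last by move=> x _; exact: Ih0.
  apply: eq_integral => x _; rewrite muleCA -muleA; congr (_ * _).
  rewrite -!EFinM; congr EFin; rewrite /h -[((al * x + be)%R, y)]/(A0 (x, y)) invK /k/=.
  by field; rewrite gt_eqF.
have mhE : measurable_fun setT (fun z => (h z)%:E) by exact/measurable_EFinP.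
rewrite (expected_log_densityE mhE _ nuSh); last by move=> z; rewrite lee_fin.
have mlh : measurable_fun setT (fun z => lne (h z)%:E).
  exact: (measurableT_comp (@measurable_lne R) mhE).
rewrite (integral_image mA0 nuS0 mlh).
have mlf : measurable_fun setT (fun z => lne (f z)%:E).
  exact: (measurableT_comp (@measurable_lne R) mfE).
(* The finite value [i] forces integrability, which allows the logarithm of the product to be
   split. *)
have ilf : nu.-integrable setT (fun z => lne (f z)%:E).
  by apply/integrableP; split => //; apply/abse_integralP => //; rewrite iE ltry.
have eE' := is_meanD eE (is_mean_cst nu (- ln `|al|)%R).
rewrite (_ : integral _ _ _ = \int[nu]_z (lne (f z)%:E + (ln (normal_pdf mx sx z.1) + - ln `|al|)%:E)).
  by rewrite (integralD measurableT ilf eE'.1) iE eE'.2 -EFinD addrA.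
apply: eq_integral => z _; rewrite /h invK /k.
have c0 : (0 < normal_pdf mx sx z.1 / `|al|)%R by rewrite divr_gt0.
have [fz|fz] := leP (f z) 0%R.
  rewrite le0_lneNy; last by rewrite lee_fin pmulr_lle0.
  by rewrite le0_lneNy ?lee_fin.
rewrite (lne_EFin (mulr_gt0 fz c0)) (lne_EFin fz) (lnM fz c0) (ln_div (n0 _) a0).
by rewrite EFinD.
Qed.

End output_entropy_bounds.

(** * Integration along a channel *)

Section channel_integral.
Context d d1 d2 (T : measurableType d) (T1 : measurableType d1)
  (T2 : measurableType d2) (R : realType).
Context (P : probability T R) (X : {mfun T >-> T1}) (k : R.-pker T1 ~> T2).
Local Notation Q := (channel_law P X k).

Let input_kernel (w : T) : {measure set T2 -> \bar R} := k (X w).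

Let measurable_input_kernel A : measurable A ->
  measurable_fun [set: T] (input_kernel ^~ A).
Proof.
move=> mA; apply: (measurableT_comp (f := k ^~ A)).
  exact: measurable_kernel.
exact: measurable_funPT.
Qed.

HB.instance Definition _ :=
  isKernel.Build _ _ T T2 R input_kernel measurable_input_kernel.

Let input_kernel_setT w : input_kernel w [set: T2] = 1.
Proof. exact: prob_kernel. Qed.

HB.instance Definition _ :=
  Kernel_isProbability.Build _ _ T T2 R input_kernel input_kernel_setT.

Lemma measurable_channel_integral (G : T * T2 -> \bar R) :
  measurable_fun setT G -> (forall z, 0 <= G z) ->
  measurable_fun setT (fun w => \int[k (X w)]_y G (w, y)).
Proof.
move=> mG G0.
by apply: (@measurable_fun_integral_finite_kernel _ _ _ _ _ G input_kernel).
Qed.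

(** Kernel composition hands the second kernel both the initial and the intermediate point; the
    first component is a dummy here. *)
Let graph (z : T * T) (y : T2) : T * T2 := (z.2, y).

Let measurable_graph z : measurable_fun setT (graph z).
Proof. by apply: measurable_fun_pair. Qed.

Let graph_kernel (z : T * T) : {measure set (T * T2) -> \bar R}.
Proof.
by unshelve refine (pushforward (k (X z.2)) (graph z)); exact: measurable_graph.
Defined.

Let graph_kernelE z A : graph_kernel z A = k (X z.2) (xsection A z.2).
Proof.
by rewrite /graph_kernel /pushforward /=; congr (k _ _);
  apply/seteqP; split => y; rewrite /xsection /= inE.
Qed.

Let measurable_graph_kernel A : measurable A ->
  measurable_fun [set: T * T] (graph_kernel ^~ A).
Proof.
move=> mA.
have -> : graph_kernel ^~ A = (fun w => input_kernel w (xsection A w)) \o snd.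
  by apply/funext => z /=; exact: graph_kernelE.
apply: measurableT_comp; last exact: measurable_snd.
by apply: (@measurable_fun_xsection_finite_kernel _ _ _ _ _ input_kernel);
  rewrite inE.
Qed.

HB.instance Definition _ :=
  isKernel.Build _ _ (T * T)%type (T * T2)%type R graph_kernel
    measurable_graph_kernel.

Let graph_kernel_setT z : graph_kernel z setT = 1.
Proof.
rewrite graph_kernelE (_ : xsection _ _ = setT) ?prob_kernel//.
by apply/seteqP; split => // y _; rewrite /xsection /= inE.
Qed.

HB.instance Definition _ :=
  Kernel_isProbability.Build _ _ (T * T)%type (T * T2)%type R graph_kernel
    graph_kernel_setT.

(** [channel_law] is the composition of the constant kernel [P] with the kernel that keeps [w] and
    draws [y] from [k (X w)], so integration disintegrates by [integral_kcomp]. The starting point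
    is arbitrary. *)
Lemma ge0_integral_channel (G : T * T2 -> \bar R) :
  measurable_fun setT G -> (forall z, 0 <= G z) ->
  \int[Q]_z G z = \int[P]_w \int[k (X w)]_y G (w, y).
Proof.
move=> mG G0.
pose l := kprobability (@measurable_cst _ _ T (pprobability T R) setT P).
have h w : \int[kcomp l graph_kernel w]_z G z
    = \int[P]_w \int[k (X w)]_y G (w, y).
  rewrite integral_kcomp//; apply: eq_integral => v _.
  by rewrite ge0_integral_pushforward.
rewrite -(h point); apply: eq_measure_integral => A mA _.
rewrite /channel_law/= /kcomp.
by apply: eq_integral => v _; rewrite graph_kernelE.
Qed.

End channel_integral.

(** * Jointly Gaussian variables *)

Section gaussian_rotation.
Local Open Scope ring_scope.
Context (R : realType).
Local Notation leb := (@lebesgue_measure R).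
Local Notation gamma := (normal_prob (0 : R) 1).
Local Notation RR := (measurableTypeR R).
Implicit Types F : RR * RR -> \bar R.

(** The rotation is split into two one-dimensional affine substitutions separated by an exchange of
    integrals; their Jacobians [1 / |s|] and [|s|] cancel. The case [s = 0] is only a reflection or
    the identity in each coordinate. *)
Lemma lebesgue_rotation (c s : R) F : c ^+ 2 + s ^+ 2 = 1 ->
  measurable_fun setT F -> (forall z, 0 <= F z)%E ->
  (\int[leb]_x \int[leb]_y F (c * x + s * y, - s * x + c * y)%R
    = \int[leb]_x \int[leb]_y F (x, y))%E.
Proof.
move=> cs mF F0.
have m1 (a b : RR) : measurable_fun setT (fun y : RR => a * y + b).
  by apply: measurable_funD => //; exact: measurable_funM.
have mF2 u : measurable_fun setT (fun y : RR => F (u, y)).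
  exact: (measurableT_comp mF (measurable_pair1 u)).
have [s0|s0] := eqVneq s 0.
  have c1 : `|c| = 1.
    by apply/eqP; rewrite -sqr_norm_eq1 -cs s0 expr0n addr0.
  have c0 : c != 0 by rewrite -normr_gt0 c1.
  have h u : (\int[leb]_y F (u, y) = \int[leb]_y F (u, c * y)%R)%E.
    rewrite (ge0_integral_affine 0 c0 (mF2 u))// c1 mul1e.
    by under eq_integral do rewrite addr0.
  rewrite [RHS](ge0_integral_affine 0 c0)//; first last.
  - by move=> x; exact: integral_ge0.
  - exact: measurable_fun_fubini_tonelli_F.
  rewrite c1 mul1e; apply: eq_integral => x _; rewrite h s0.
  by apply: eq_integral => y _; rewrite mul0r addr0 oppr0 mul0r add0r.
have s1 : - s^-1 != 0 by rewrite oppr_eq0 invr_eq0.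
(* With [u = c x + s y] fixed, [- s x + c y] equals [- x / s + c u / s] because [c^2 + s^2 = 1]. *)
have h u : (\int[leb]_y F (u, y)
    = \int[leb]_x (`|s^-1|%:E * F (u, - s^-1 * x + c * u / s)%R))%E.
  rewrite (ge0_integral_affine (c * u / s) s1 (mF2 u))// normrN ge0_integralZl//.
  exact: (measurableT_comp (mF2 u) (m1 (- s^-1) (c * u / s))).
pose H (z : RR * RR) := (`|s^-1|%:E * F (z.1, - s^-1 * z.2 + c * z.1 / s)%R)%E.
have mH : measurable_fun setT H.
  apply: emeasurable_funM => //; apply: (measurableT_comp mF).
  apply: measurable_fun_pair; first exact: measurable_fst.
  by apply: measurable_funD; repeat apply: measurable_funM => //.
have H0 z : (0 <= H z)%E by rewrite mule_ge0// lee_fin.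
transitivity (\int[leb]_u \int[leb]_x H (u, x))%E; last first.
  by apply: eq_integral => u _; rewrite h.
rewrite (@fubini_tonelli _ _ _ _ R leb leb H mH H0).
apply: eq_integral => x _.
rewrite [RHS](ge0_integral_affine (c * x) s0)//; last first.
  exact: (measurableT_comp mH (measurable_pair2 x)).
rewrite -ge0_integralZl//; last first.
  exact: (measurableT_comp (measurableT_comp mH (measurable_pair2 x)) (m1 s (c * x))).
apply: eq_integral => y _; rewrite /H/= muleA -EFinM -normrM divff// normr1 mul1e.
congr (F (_, _)); first by rewrite addrC.
rewrite (_ : - s * x = (c ^+ 2 - 1) / s * x); first by field.
by rewrite -cs; field.
Qed.

Lemma ge0_integral_gaussian2 F : measurable_fun setT F -> (forall z, 0 <= F z)%E ->
  (\int[gamma]_x \int[gamma]_y F (x, y) = \int[leb]_x \int[leb]_y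
     (F (x, y) * (normal_pdf 0 1 x * normal_pdf 0 1 y)%R%:E))%E.
Proof.
move=> mF F0.
rewrite integral_normal_prob; last exact: measurable_fun_fubini_tonelli_F.
apply: eq_integral => x _.
have mFx : measurable_fun setT (fun y : RR => F (x, y)).
  exact: (measurableT_comp mF (measurable_pair1 x)).
have mp : measurable_fun setT (fun y : R => F (x, y) * (normal_pdf 0 1 y)%:E)%E.
  by apply: emeasurable_funM => //; exact: measurable_normal_pdfE.
rewrite integral_normal_prob// -ge0_integralZr//.
- by apply: eq_integral => y _; rewrite -muleA -EFinM mulrC.
- by move=> y _; rewrite mule_ge0// lee_fin normal_pdf_ge0.
- by rewrite lee_fin normal_pdf_ge0.
Qed.

(** The product density depends on [x^2 + y^2] only, which a rotation preserves. *)
Lemma gaussian_rotation (c s : R) F : c ^+ 2 + s ^+ 2 = 1 ->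
  measurable_fun setT F -> (forall z, 0 <= F z)%E ->
  (\int[gamma]_x \int[gamma]_y F (c * x + s * y, - s * x + c * y)%R
    = \int[gamma]_x \int[gamma]_y F (x, y))%E.
Proof.
move=> cs mF F0.
pose W (z : RR * RR) := (F z * (normal_pdf 0 1 z.1 * normal_pdf 0 1 z.2)%R%:E)%E.
have mW : measurable_fun setT W.
  apply: emeasurable_funM => //; apply/measurable_EFinP.
  by apply: measurable_funM;
    [apply: (measurableT_comp (measurable_normal_pdf 0 1) measurable_fst)
    |apply: (measurableT_comp (measurable_normal_pdf 0 1) measurable_snd)].
have W0 z : (0 <= W z)%E.
  by rewrite mule_ge0// lee_fin mulr_ge0// normal_pdf_ge0.
pose Fr (z : RR * RR) := F (c * z.1 + s * z.2, - s * z.1 + c * z.2)%R.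
have mFr : measurable_fun setT Fr.
  apply: (measurableT_comp mF); apply: measurable_fun_pair.
  - by apply: measurable_funD; apply: measurable_funM.
  - by apply: measurable_funD; apply: measurable_funM.
rewrite (ge0_integral_gaussian2 mFr (fun z => F0 _)) (ge0_integral_gaussian2 mF F0).
rewrite -(lebesgue_rotation cs mW W0).
apply: eq_integral => x _; apply: eq_integral => y _; rewrite /W/=.
congr (_ * _%:E)%E.
rewrite !stdnormal_pdfE mulrACA -expRD [RHS]mulrACA -expRD; congr (_ * expR _).
rewrite -[in LHS](mul1r (x ^+ 2)) -[in LHS](mul1r (y ^+ 2)) -cs; ring.
Qed.

End gaussian_rotation.

Section is_mean_transfer.
Context d1 d2 (T1 : measurableType d1) (T2 : measurableType d2) (R : realType).
Context (P1 : probability T1 R) (P2 : probability T2 R).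

Lemma is_mean_image (phi : T1 -> T2) (g : T2 -> R) a : measurable_fun setT phi ->
  (forall A, measurable A -> P2 A = P1 (phi @^-1` A)) -> measurable_fun setT g ->
  is_mean P2 g a <-> is_mean P1 (g \o phi) a.
Proof.
move=> mphi P2E mg; have mgE : measurable_fun setT (EFin \o g) by exact/measurable_EFinP.
have iE := integrable_image mphi P2E mgE.
by split => -[/iE i e]; split=> //; rewrite -e; [apply/esym|];
  exact: (integral_image mphi P2E mgE).
Qed.

Lemma is_mean_prod (f : T1 -> R) (g : T2 -> R) a b : is_mean P1 f a -> is_mean P2 g b ->
  is_mean (P1 \x P2) (fun z => f z.1 * g z.2)%R (a * b)%R.
Proof.
move=> [If fa] [Ig gb].
have mf := measurable_int _ If; have mg := measurable_int _ Ig.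
have mfg : measurable_fun setT (fun z : T1 * T2 => (f z.1 * g z.2)%:E).
  apply: (emeasurable_funM (f := fun z : T1 * T2 => (f z.1)%:E) (g := fun z : T1 * T2 => (g z.2)%:E)).
    exact: (measurableT_comp mf measurable_fst).
  exact: (measurableT_comp mg measurable_snd).
have ifg : (P1 \x P2).-integrable setT (fun z : T1 * T2 => (f z.1 * g z.2)%:E).
  apply/integrableP; split => //.
  have := @fubini_tonelli1 _ _ _ _ _ P1 P2 _ (measurableT_comp (@abse_measurable _ setT) mfg) (fun z => abse_ge0 _).
  rewrite /fubini_F /= => ->.
  rewrite (eq_integral (fun x => (\int[P2]_y `|(g y)%:E|) * `|(f x)%:E|)); last first.
    move=> x _; rewrite muleC -ge0_integralZl//; last exact: (measurableT_comp (@abse_measurable _ setT) mg).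
    by apply: eq_integral => y _; rewrite normrM EFinM.
  have [_ hf] := integrableP _ _ _ If; have [_ hg] := integrableP _ _ _ Ig.
  rewrite ge0_integralZl//; last 2 first.
  - exact: (measurableT_comp (@abse_measurable _ setT) mf).
  - exact: integral_ge0.
  by rewrite lte_mul_pinfty ?integral_ge0// ge0_fin_numE// integral_ge0.
split => //.
have := @integral12_prod_meas1 _ _ _ _ _ P1 P2 _ ifg.
rewrite /= => <-.
rewrite (eq_integral (fun x => b%:E * (f x)%:E)); last first.
  move=> x _; rewrite /fubini_F/= -gb muleC -integralZl//.
by rewrite integralZl// fa EFinM muleC.
Qed.

End is_mean_transfer.

Section gaussian_rotation_measure.
Local Open Scope ring_scope.
Context (R : realType).
Local Notation gamma := (normal_prob (0 : R) 1).
Local Notation RR := (measurableTypeR R).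

Lemma gaussian_rotation_measure (c s : R) (C : set (RR * RR)) : c ^+ 2 + s ^+ 2 = 1 ->
  measurable C ->
  (gamma \x gamma)%E [set z | C (c * z.1 + s * z.2, - s * z.1 + c * z.2)]
    = (gamma \x gamma)%E C.
Proof.
move=> cs mC.
have E2 A : measurable A -> (gamma \x gamma)%E A
    = (\int[gamma]_x \int[gamma]_y (\1_A (x, y))%:E)%E.
  move=> mA; rewrite -(setIT A) -integral_indic// setIT.
  have mA' : measurable_fun setT (fun z : RR * RR => (\1_A z : R)%:E).
    by apply/measurable_EFinP; exact: measurable_indic.
  by rewrite (@fubini_tonelli1 _ _ _ _ _ gamma gamma _ mA')// => z; rewrite lee_fin.
have mrot : measurable_fun setT (fun z : RR * RR => (c * z.1 + s * z.2, - s * z.1 + c * z.2) : RR * RR).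
  apply: measurable_fun_pair.
  - by apply: measurable_funD; apply: measurable_funM.
  - by apply: measurable_funD; apply: measurable_funM.
have mC' : measurable [set z : RR * RR | C (c * z.1 + s * z.2, - s * z.1 + c * z.2)].
  by rewrite -[X in measurable X]setTI; exact: mrot.
have mF : measurable_fun setT (fun z : RR * RR => (\1_C z : R)%:E).
  by apply/measurable_EFinP; exact: measurable_indic.
rewrite (E2 _ mC) (E2 _ mC') -(gaussian_rotation cs mF) => [|z]; last by rewrite lee_fin.
by apply: eq_integral => x _; apply: eq_integral.
Qed.

End gaussian_rotation_measure.

Section jointly_gaussian.
Local Open Scope ring_scope.
Context d (T : measurableType d) (R : realType) (P : probability T R).
Local Notation RR := (measurableTypeR R).
Local Notation gamma := (normal_prob (0 : R) 1).
Context (X S : {RV P >-> RR}).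

Definition triangular (m1 r m2 a s : R) (z : RR * RR) : RR * RR :=
  (m1 + r * z.1, m2 + a * z.1 + s * z.2).

Lemma measurable_triangular m1 r m2 a s : measurable_fun setT (triangular m1 r m2 a s).
Proof.
apply: measurable_fun_pair; first by apply: measurable_funD => //; apply: measurable_funM.
by repeat apply: measurable_funD => //; apply: measurable_funM.
Qed.

(** Rotating the two normal variables along the first row of [A] makes [X] depend on the first one
    only; the second is then noise independent of [X]. A zero row needs no rotation. *)
Lemma jointly_gaussian_triangular : jointly_gaussian X S ->
  exists m1 r m2 a s, 0 <= r /\ forall B, measurable B ->
    distribution P (rv_pair X S) B = (gamma \x gamma)%E (triangular m1 r m2 a s @^-1` B).
Proof.
move=> [b [A XSE]].
pose r := Num.sqrt (A 0 0 ^+ 2 + A 0 1 ^+ 2).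
have r2 : r ^+ 2 = A 0 0 ^+ 2 + A 0 1 ^+ 2 by rewrite sqr_sqrtr// addr_ge0 ?sqr_ge0.
have [c [s [cs rc rs]]] : exists c s, [/\ c ^+ 2 + s ^+ 2 = 1, r * c = A 0 0 & r * s = A 0 1].
  have [r0|r0] := eqVneq r 0.
    move/eqP: r2; rewrite r0 expr0n eq_sym paddr_eq0 ?sqr_ge0// !sqrf_eq0.
    move=> /andP[/eqP-> /eqP->].
    by exists 1, 0; rewrite expr1n expr0n addr0 !mul0r.
  exists (A 0 0 / r), (A 0 1 / r); split; last 2 first.
  - by rewrite mulrC divfK.
  - by rewrite mulrC divfK.
  by rewrite !expr_div_n -mulrDl -r2 divff// sqrf_eq0.
pose a := A 1 0 * c + A 1 1 * s; pose t := - A 1 0 * s + A 1 1 * c.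
exists (b 0 0), r, (b 1 0), a, t; split; first exact: sqrtr_ge0.
move=> B mB; rewrite (XSE B mB).
have mtri : measurable (triangular (b 0 0) r (b 1 0) a t @^-1` B).
  by rewrite -[X in measurable X]setTI; exact: measurable_triangular.
rewrite -(gaussian_rotation_measure cs mtri); congr ((gamma \x gamma)%E _).
apply/funext => z; rewrite /triangular /preimage/=; congr (B (_, _)).
  by rewrite -rc -rs; ring.
have -> : A 1 0 = A 1 0 * (c ^+ 2 + s ^+ 2) by rewrite cs mulr1.
have e : A 1 1 = A 1 1 * (c ^+ 2 + s ^+ 2) by rewrite cs mulr1.
rewrite [in LHS]e /a /t; ring.
Qed.

End jointly_gaussian.

Section is_mean_normal.
Local Open Scope ring_scope.
Context (R : realType).
Local Notation RR := (measurableTypeR R).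
Local Notation gamma := (normal_prob (0 : R) 1).

Lemma normal_prob_image (m s : R) (A : set RR) : s != 0 -> measurable A ->
  normal_prob m s A = gamma ((fun v : RR => s * v + m : RR) @^-1` A).
Proof.
move=> s0 mA.
have ma : measurable_fun setT (fun v : RR => s * v + m : RR).
  by apply: measurable_funD => //; exact: measurable_funM.
have mA' : measurable ((fun v : RR => s * v + m : RR) @^-1` A).
  by rewrite -[X in measurable X]setTI; exact: ma.
have mI : measurable_fun setT (fun x : RR => (\1_A x : R)%:E).
  by apply/measurable_EFinP; exact: measurable_indic.
have := ge0_integral_normal_std m s0 mI (fun x => ltac:(by rewrite lee_fin)).
move=> h; apply: (etrans (@measure_indicE _ _ _ (normal_prob m s) A mA)).
apply: (etrans h); apply: esym.
apply: (etrans (@measure_indicE _ _ _ gamma _ mA')).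
by apply: eq_integral.
Qed.

Lemma is_mean_gamma1 : is_mean gamma (fun v => v) 0.
Proof. split; [exact: integrable_id_normal|exact: integral_id_normal]. Qed.

Lemma is_mean_gamma2 : is_mean gamma (fun v => v ^+ 2) 1.
Proof. split; [exact: integrable_sqr_normal|exact: integral_sqr_normal]. Qed.

Lemma is_mean_normal1 (m s : R) : s != 0 -> is_mean (normal_prob m s) (fun v => v) m.
Proof.
move=> s0; apply/(is_mean_image (phi := fun v : RR => s * v + m : RR) (P1 := gamma)).
- by apply: measurable_funD => //; exact: measurable_funM.
- by move=> A mA; exact: normal_prob_image.
- by [].
by apply: (eq_is_mean (is_meanD (is_meanZ s is_mean_gamma1) (is_mean_cst _ m))) => //; ring.
Qed.

Lemma is_mean_normal2 (m s : R) : s != 0 ->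
  is_mean (normal_prob m s) (fun v => v ^+ 2) (m ^+ 2 + s ^+ 2).
Proof.
move=> s0; apply/(is_mean_image (phi := fun v : RR => s * v + m : RR) (P1 := gamma)).
- by apply: measurable_funD => //; exact: measurable_funM.
- by move=> A mA; exact: normal_prob_image.
- exact: measurable_funX.
apply: (eq_is_mean (is_meanD (is_meanD (is_meanZ (s ^+ 2) is_mean_gamma2)
  (is_meanZ (2 * s * m) is_mean_gamma1)) (is_mean_cst _ (m ^+ 2)))) => [v /=|]; ring.
Qed.

End is_mean_normal.

Section gaussian_regression.
Local Open Scope ring_scope.
Context d (T : measurableType d) (R : realType) (P : probability T R).
Local Notation RR := (measurableTypeR R).
Local Notation gamma := (normal_prob (0 : R) 1).
Context (X S : {RV P >-> RR}).

Let tri_means (m1 r m2 a s : R) :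
  let z1 (z : RR * RR) := m1 + r * z.1 in
  let z2 (z : RR * RR) := m2 + a * z.1 + s * z.2 in
  [/\ is_mean (gamma \x gamma)%E z1 m1,
      is_mean (gamma \x gamma)%E (fun z => z1 z ^+ 2) (m1 ^+ 2 + r ^+ 2),
      is_mean (gamma \x gamma)%E z2 m2,
      is_mean (gamma \x gamma)%E (fun z => z2 z ^+ 2) (m2 ^+ 2 + a ^+ 2 + s ^+ 2) &
      is_mean (gamma \x gamma)%E (fun z => z1 z * z2 z) (m1 * m2 + r * a)].
Proof.
have e1 := is_mean_gamma1 R; have e2 := is_mean_gamma2 R; have e0 := is_mean_cst gamma (1 : R).
have u1 := is_mean_prod e1 e0; have u2 := is_mean_prod e2 e0.
have v1 := is_mean_prod e0 e1; have v2 := is_mean_prod e0 e2.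
have uv := is_mean_prod e1 e1.
have c k := is_mean_cst (gamma \x gamma)%E (k : R).
split.
- apply: (eq_is_mean (is_meanD (c m1) (is_meanZ r u1))) => [z /=|]; ring.
- apply: (eq_is_mean (is_meanD (c (m1 ^+ 2)) (is_meanD (is_meanZ (2 * m1 * r) u1)
    (is_meanZ (r ^+ 2) u2)))) => [z /=|]; ring.
- apply: (eq_is_mean (is_meanD (c m2) (is_meanD (is_meanZ a u1) (is_meanZ s v1))))
    => [z /=|]; ring.
- apply: (eq_is_mean (is_meanD (c (m2 ^+ 2)) (is_meanD (is_meanD (is_meanZ (2 * m2 * a) u1)
    (is_meanZ (2 * m2 * s) v1)) (is_meanD (is_meanZ (a ^+ 2) u2)
    (is_meanD (is_meanZ (s ^+ 2) v2) (is_meanZ (2 * a * s) uv)))))) => [z /=|]; ring.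
- apply: (eq_is_mean (is_meanD (c (m1 * m2)) (is_meanD (is_meanD (is_meanZ (m1 * a + r * m2) u1)
    (is_meanZ (m1 * s) v1)) (is_meanD (is_meanZ (r * a) u2) (is_meanZ (r * s) uv)))))
    => [z /=|]; ring.
Qed.

Lemma is_mean_distribution d2 (T2 : measurableType d2) (Y : {mfun T >-> T2}) (m : probability T2 R)
    (g : T2 -> R) a : (forall B, measurable B -> distribution P Y B = m B) ->
  measurable_fun setT g -> is_mean m g a -> is_mean P (g \o Y) a.
Proof.
move=> YE mg h; apply/(is_mean_image (phi := Y) (P2 := m)) => //.
by move=> A mA; rewrite -YE.
Qed.

(** The means, second moments and covariance identify the parameters of the triangular form. The
    sign condition [0 <= r] gives [r = sigx], while [s] is known only through its square. *)
Lemma gaussian_regression (mux mus sigx sigs theta1 : R) :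
  jointly_gaussian X S ->
  (forall B : set RR, measurable B -> distribution P X B = normal_prob mux sigx B) ->
  (forall B : set RR, measurable B -> distribution P S B = normal_prob mus sigs B) ->
  0 < sigx -> 0 < sigs -> covariance P X S = theta1%:E ->
  exists2 s, s ^+ 2 = sigs ^+ 2 - theta1 ^+ 2 / sigx ^+ 2 &
    forall B, measurable B -> distribution P (rv_pair X S) B = (gamma \x gamma)%E
      (triangular mux sigx mus (theta1 / sigx) s @^-1` B).
Proof.
move=> /jointly_gaussian_triangular[m1 [r [m2 [a [s [r0 XSE]]]]]] hX hS sx0 ss0 hcov.
have sx := lt0r_neq0 sx0; have ss := lt0r_neq0 ss0.
have mtri := measurable_triangular m1 r m2 a s.
have XSm (g : RR * RR -> R) k : measurable_fun setT g ->
    is_mean (gamma \x gamma)%E (g \o triangular m1 r m2 a s) k -> is_mean P (fun w => g (X w, S w)) k.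
  move=> mg h; have /(_ h) h' := (@is_mean_image _ _ _ _ _ _ _ _ g k mtri XSE mg).2.
  exact: (@is_mean_distribution _ _ (rv_pair X S) (distribution P (rv_pair X S)) g k (fun _ _ => erefl) mg h').
have [/= h1 h2 h3 h4 h5] := tri_means m1 r m2 a s.
have msq : measurable_fun setT (fun v : RR => v ^+ 2) by exact: measurable_funX.
have X1 := XSm fst _ measurable_fst h1.
have X2 := XSm (fun z => z.1 ^+ 2) _ (measurableT_comp msq measurable_fst) h2.
have S1 := XSm snd _ measurable_snd h3.
have S2 := XSm (fun z => z.2 ^+ 2) _ (measurableT_comp msq measurable_snd) h4.
have XS := XSm (fun z => z.1 * z.2) _ (measurable_funM measurable_fst measurable_snd) h5.
have X1' : is_mean P (fun w => X w) mux.
  exact: (is_mean_distribution hX (@measurable_id _ _ setT) (is_mean_normal1 mux sx)).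
have S1' : is_mean P (fun w => S w) mus.
  exact: (is_mean_distribution hS (@measurable_id _ _ setT) (is_mean_normal1 mus ss)).
have X2' : is_mean P (fun w => X w ^+ 2) (mux ^+ 2 + sigx ^+ 2).
  exact: (is_mean_distribution hX msq (is_mean_normal2 mux sx)).
have S2' : is_mean P (fun w => S w ^+ 2) (mus ^+ 2 + sigs ^+ 2).
  exact: (is_mean_distribution hS msq (is_mean_normal2 mus ss)).
have em1 : m1 = mux by exact: (is_mean_uniq X1 X1').
have em2 : m2 = mus by exact: (is_mean_uniq S1 S1').
have er : m1 ^+ 2 + r ^+ 2 = mux ^+ 2 + sigx ^+ 2 by exact: (is_mean_uniq X2 X2').
have es : m2 ^+ 2 + a ^+ 2 + s ^+ 2 = mus ^+ 2 + sigs ^+ 2 by exact: (is_mean_uniq S2 S2').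
have rE : r = sigx.
  apply/eqP; rewrite -(@eqrXn2 _ 2%N)//; last exact: ltW.
  by apply/eqP; apply: (addrI (mux ^+ 2)); rewrite -er em1.
have raE : r * a = theta1.
  have : is_mean P (fun w => (X w - m1) * (S w - m2)) (r * a).
    apply: (eq_is_mean (is_meanD XS (is_meanD (is_meanZ (- m2) X1) (is_meanD (is_meanZ (- m1) S1)
      (is_mean_cst P (m1 * m2)))))) => [w /=|]; ring.
  move=> [_ e]; have h : (covariance P X S = \int[P]_w ((X w - m1) * (S w - m2))%R%:E)%E.
    rewrite unlock; have -> : fine 'E_P[X] = m1 by rewrite unlock X1'.2 em1.
    have -> : fine 'E_P[S] = m2 by rewrite unlock S1'.2 em2.
    by rewrite unlock.
  by move: hcov; rewrite h e => -[].

have aE : a = theta1 / sigx by rewrite -raE rE mulrAC divff// mul1r.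
exists s; last by move=> B mB; rewrite (XSE B mB) em1 em2 rE aE.
have {es} : a ^+ 2 + s ^+ 2 = sigs ^+ 2 by apply: (addrI (mus ^+ 2)); rewrite -es em2 addrA.
by rewrite aE expr_div_n => <-; rewrite addrC addKr.
Qed.

End gaussian_regression.

(** Meant for [n = k (X w)], which comes as a plain measure of mass one. Normalising it changes
    nothing but provides the structure that Fubini's theorem asks for. *)
Lemma probability_swap d2 d3 (T2 : measurableType d2)
    (T3 : measurableType d3) (R : realType) (n : {measure set T2 -> \bar R}) (m : probability T3 R)
    (f : T2 * T3 -> \bar R) : n setT = 1 -> (forall z, 0 <= f z) -> measurable_fun setT f ->
  \int[n]_y \int[m]_v f (y, v) = \int[m]_v \int[n]_y f (y, v).
Proof.
move=> n1 f0 mf.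
pose n' := mnormalize n (dirac point).
have n'E (g : T2 -> \bar R) : \int[n]_y g y = \int[n']_y g y.
  apply: eq_measure_integral => A mA _.
  by rewrite /= /mnormalize n1/= onee_eq0/= invr1 mule1.
rewrite n'E; under [RHS]eq_integral do rewrite n'E.
exact: (@sfinite_Fubini _ _ _ _ _ n' m f f0 mf).
Qed.

Lemma integral_probability_cst d1 (T1 : measurableType d1) (R : realType)
  (m : probability T1 R) (K : \bar R) : \int[m]__ K = K.
Proof.
rewrite (integral_cst m measurableT K) -[RHS]mule1; congr (_ * _).
exact: probability_setT.
Qed.

(** * The joint law of the hidden variable and the output *)

Section channel_output_law.
Context d (T : measurableType d) (R : realType) (P : probability T R).
Local Notation RR := (measurableTypeR R).
Local Notation gamma := (normal_prob (0 : R) 1).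
Context (X S : {RV P >-> RR}) (k : R.-pker RR ~> RR).
Local Notation Q := (channel_law P X k).

Lemma ge0_integral_channel_input_output (G : RR * RR -> \bar R) : measurable_fun setT G ->
  (forall z, 0 <= G z) ->
  \int[distribution Q (rv_pair (channel_input X k) (channel_output X k))]_z G z =
  \int[P]_w \int[k (X w)]_y G (X w, y).
Proof.
move=> mG G0.
rewrite (ge0_integral_distribution _ mG G0).
apply: (@ge0_integral_channel _ _ _ _ _ _ _ P X k
  (G \o rv_pair (channel_input X k) (channel_output X k))).
  exact: (measurableT_comp mG (measurable_funPT _)).
by move=> z; exact: G0.
Qed.

Lemma ge0_integral_channel_hidden_output (G : RR * RR -> \bar R) : measurable_fun setT G ->
  (forall z, 0 <= G z) ->
  \int[distribution Q (rv_pair (channel_hidden X S k) (channel_output X k))]_z G z =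
  \int[P]_w \int[k (X w)]_y G (S w, y).
Proof.
move=> mG G0.
rewrite (ge0_integral_distribution _ mG G0).
apply: (@ge0_integral_channel _ _ _ _ _ _ _ P X k
  (G \o rv_pair (channel_hidden X S k) (channel_output X k))).
  exact: (measurableT_comp mG (measurable_funPT _)).
by move=> z; exact: G0.
Qed.

Context (m1 r m2 a s : R) (r0 : r != 0%R).
Hypothesis XSE : forall B, measurable B ->
  distribution P (rv_pair X S) B = (gamma \x gamma) (triangular m1 r m2 a s @^-1` B).

Let ge0_integral_input_hidden (H : RR * RR -> \bar R) : measurable_fun setT H ->
  (forall z, 0 <= H z) ->
  \int[P]_w H (X w, S w) = \int[gamma]_u \int[gamma]_v H (triangular m1 r m2 a s (u, v)).
Proof.
move=> mH H0; have mtri := measurable_triangular m1 r m2 a s.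
have <- : \int[distribution P (rv_pair X S)]_z H z = \int[P]_w H (X w, S w).
  exact: (ge0_integral_distribution _ mH H0).
rewrite (ge0_integral_image mtri XSE mH H0).
exact: (@fubini_tonelli1 _ _ _ _ _ gamma gamma _ (measurableT_comp mH mtri) (fun=> H0 _)).
Qed.

(** The output is drawn from [X] alone, so the noise in [S = (a / r) X + (m2 - a / r * m1) + s Z] is
    independent of the pair [(X, Y)]. This is where the Markov chain enters. *)
Lemma channel_hidden_output_law (A : set (RR * RR)) : measurable A ->
  distribution Q (rv_pair (channel_hidden X S k) (channel_output X k)) A =
  (distribution Q (rv_pair (channel_input X k) (channel_output X k)) \x gamma)
    (affine_noise (a / r) (m2 - a / r * m1) s @^-1` A).
Proof.
move=> mA; have maff := measurable_affine_noise (a / r) (m2 - a / r * m1) s.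
set nu := distribution Q (rv_pair (channel_input X k) (channel_output X k)).
have mB : measurable (affine_noise (a / r) (m2 - a / r * m1) s @^-1` A).
  by rewrite -[X in measurable X]setTI; exact: maff.
have mI : measurable_fun setT (fun z : RR * RR => (\1_A z : R)%:E).
  by apply/measurable_EFinP; exact: measurable_indic.
have I0 (z : RR * RR) : 0 <= (\1_A z : R)%:E by rewrite lee_fin.
have mG : measurable_fun setT (fun z => (\1_A (affine_noise (a / r) (m2 - a / r * m1) s z) : R)%:E).
  exact: (measurableT_comp mI maff).
rewrite (@measure_indicE _ _ _ (distribution Q (rv_pair (channel_hidden X S k) (channel_output X k))) A mA).
rewrite (ge0_integral_channel_hidden_output mI I0).
rewrite (@measure_indicE _ _ _ (nu \x gamma) _ mB).
transitivity (\int[nu]_z \int[gamma]_v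
    (\1_A (affine_noise (a / r) (m2 - a / r * m1) s (z, v)) : R)%:E); last first.
  exact/esym/(@fubini_tonelli1 _ _ _ _ _ nu gamma _ mG (fun=> I0 _)).
rewrite ge0_integral_channel_input_output; last 2 first.
- exact: (@measurable_fun_fubini_tonelli_F _ _ _ _ _ gamma _ mG (fun=> I0 _)).
- by move=> z; apply: integral_ge0 => v _; exact: I0.
pose H (z : RR * RR) := \int[k z.1]_y (\1_A (z.2, y) : R)%:E.
have mH : measurable_fun setT H.
  have mh : measurable_fun setT (fun z : (RR * RR) * RR => (\1_A (z.1.2, z.2) : R)%:E).
    apply: (measurableT_comp mI); apply: measurable_fun_pair => //.
    by apply: measurableT_comp => //; exact: measurable_snd.
  exact: (@measurable_channel_integral _ _ _ (RR * RR)%type RR RR R fst k _ mh (fun=> I0 _)).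
have H0 z : 0 <= H z by apply: integral_ge0 => y _; exact: I0.
rewrite (ge0_integral_input_hidden mH H0).
(* [L] replaces [S] by the regression on [X] plus fresh noise. It ignores [z.2], so its average
   under the triangular form is that of [H]. *)
pose L (z : RR * RR) := \int[gamma]_v H (z.1, a / r * z.1 + (m2 - a / r * m1) + s * v)%R.
have mL : measurable_fun setT L.
  have mh : measurable_fun setT (fun z : (RR * RR) * RR =>
      H (z.1.1, a / r * z.1.1 + (m2 - a / r * m1) + s * z.2)%R).
    apply: (measurableT_comp mH); apply: measurable_fun_pair.
      by apply: measurableT_comp => //; exact: measurable_fst.
    repeat apply: measurable_funD => //; apply: measurable_funM => //.
    by apply: measurableT_comp => //; exact: measurable_fst.
  exact: (@measurable_fun_fubini_tonelli_F _ _ _ _ _ gamma _ mh (fun=> H0 _)).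
have L0 z : 0 <= L z by apply: integral_ge0 => y _; exact: H0.
transitivity (\int[P]_w L (X w, S w)).
  rewrite (ge0_integral_input_hidden mL L0); apply: eq_integral => u _.
  rewrite /L /=; apply/esym; apply: (etrans (integral_probability_cst gamma _)).
  apply: eq_integral => t _; congr (H (_, _)).
  by rewrite /=; field.
apply: eq_integral => w _; rewrite /L/= /H/=.
apply/esym/(@probability_swap _ _ _ _ _ (k (X w)) gamma
  (fun z => (\1_A ((a / r * X w + (m2 - a / r * m1) + s * z.2)%R, z.1))%:E)).
- exact: prob_kernel.
- by move=> z; exact: I0.
- apply: (measurableT_comp mI); apply: measurable_fun_pair => //.
  by apply: measurable_funD => //; apply: measurable_funM.
Qed.

End channel_output_law.

(** * Lower bounds on the rate *)

Section gaussian_converse.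
Local Open Scope ring_scope.
Context (R : realType).
Local Notation RR := (measurableTypeR R).
Local Notation leb := (@lebesgue_measure R).
Local Notation gamma := (normal_prob (0 : R) 1).

Lemma ln_normal_peak (s : R) : s != 0 ->
  ln (normal_peak s) = - ln (s ^+ 2) / 2 - ln (pi *+ 2) / 2.
Proof.
move=> s0; have s2 : 0 < s ^+ 2 by rewrite exprn_even_gt0.
have p2 : 0 < (pi *+ 2 : R) by rewrite mulrn_wgt0// pi_gt0.
have sp := mulr_gt0 s2 p2.
rewrite /normal_peak -mulrnAr lnV; last by rewrite posrE sqrtr_gt0.
have -> : ln (Num.sqrt (s ^+ 2 * (pi *+ 2))) = ln (s ^+ 2 * (pi *+ 2)) / 2.
  rewrite -[X in _ = ln X / 2](sqr_sqrtr (ltW sp)) lnXn ?sqrtr_gt0//.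
  by rewrite -(mulr_natr (ln _)) mulfK// pnatr_eq0.
by rewrite lnM ?posrE//; field.
Qed.

Lemma ln_normal_pdf (m s x : R) : s != 0 ->
  ln (normal_pdf m s x) = ln (normal_peak s) - (x - m) ^+ 2 / (2 * s ^+ 2).
Proof.
move=> s0; rewrite normal_pdfE// lnM ?posrE ?normal_peak_gt0 ?expR_gt0//.
by rewrite /normal_fun expRK mulNr -(mulr_natl (s ^+ 2)).
Qed.

Context (PX mu : probability RR R) (nu nuS : probability (RR * RR)%type R).
Context (mx sx al be s : R) (sx0 : 0 < sx) (al0 : al != 0).
Hypothesis PXE : forall A : set RR, measurable A -> PX A = normal_prob mx sx A.
Hypothesis nu1 : forall A : set RR, measurable A -> nu (fst @^-1` A) = PX A.
Hypothesis nu2 : forall B : set RR, measurable B -> nu (snd @^-1` B) = mu B.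
Hypothesis nuSE : forall A, measurable A ->
  nuS A = (nu \x gamma)%E (affine_noise al be s @^-1` A).
Local Notation I := (expected_log_density nu (prod_measure PX mu)).
Local Notation hSY := (- expected_log_density nuS (prod_measure leb mu))%E.
(** [sig2], [hS] and [rho2] are the variance of [S], its differential entropy and the squared
    correlation of [X] and [S]. *)
Let sig2 := al ^+ 2 * sx ^+ 2 + s ^+ 2.
Let hS := (1 + ln sig2 + ln (pi *+ 2)) / 2.
Let rho2 := al ^+ 2 * sx ^+ 2 / sig2.

Lemma is_mean_input (g : R -> R) a : measurable_fun setT (g : RR -> RR) ->
  is_mean (normal_prob mx sx) g a -> is_mean nu (fun z => g z.1) a.
Proof.
move=> mg h.
have nE (A : set RR) : measurable A -> normal_prob mx sx A = nu (fst @^-1` A).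
  by move=> mA; rewrite nu1// PXE.
exact: ((@is_mean_image _ _ _ _ _ nu (normal_prob mx sx) fst g a measurable_fst nE mg).1 h).
Qed.

Lemma is_mean_input_sqr : is_mean nu (fun z => (z.1 - mx) ^+ 2) (sx ^+ 2).
Proof.
have sx1 : sx != 0 by rewrite gt_eqF.
apply: (is_mean_input (g := fun x => (x - mx) ^+ 2)).
  by apply: measurable_funX; exact: measurable_funB.
apply: (eq_is_mean (is_meanD (is_mean_normal2 mx sx1) (is_meanD
  (is_meanZ (- 2 * mx) (is_mean_normal1 mx sx1)) (is_mean_cst _ (mx ^+ 2))))) => [v /=|]; ring.
Qed.

Lemma is_mean_input_ln : is_mean nu (fun z => ln (normal_pdf mx sx z.1))
  (ln (normal_peak sx) - 2^-1).
Proof.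
have sx1 : sx != 0 by rewrite gt_eqF.
apply: (eq_is_mean (is_meanD (is_mean_cst _ (ln (normal_peak sx)))
  (is_meanZ (- (2 * sx ^+ 2)^-1) is_mean_input_sqr))) => [z|].
  by rewrite ln_normal_pdf//; field.
by field.
Qed.

(** Gibbs' inequality with trial density 1, the density of an independent pair. *)
Lemma information_ge0 : (0 <= I)%E.
Proof.
have := @gibbs _ _ _ nu (prod_measure PX mu) (fun=> 1) (@measurable_cst _ _ _ _ _ _) (fun=> ltr01).
rewrite ln1 (integral_probability_cst nu (0%:E : \bar R)); apply.
  by have -> := integral_probability_cst (PX \x mu)%E (1%:E : \bar R).
exact: integrable0.
Qed.

Let sx2 : 0 < sx ^+ 2. Proof. by rewrite exprn_gt0. Qed.
Let al2 : 0 < al ^+ 2. Proof. by rewrite exprn_even_gt0. Qed.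
Let sig2_gt0 : 0 < sig2.
Proof. by rewrite ltr_wpDr ?sqr_ge0// mulr_gt0. Qed.

(** The conditional density of [X] given [Y] in the backward channel [X = Y + N(0, D)], taken
    relative to the law of [X]. *)
Definition test_density (D : R) (z : RR * RR) : R :=
  normal_pdf z.2 (Num.sqrt D) z.1 / normal_pdf mx sx z.1.

Lemma test_density_gt0 D z : 0 < D -> 0 < test_density D z.
Proof.
by move=> D0; rewrite divr_gt0// normal_pdf_gt0// gt_eqF// sqrtr_gt0.
Qed.

Lemma measurable_test_density D : 0 < D -> measurable_fun setT (test_density D).
Proof.
move=> D0; have sD : Num.sqrt D != 0 by rewrite gt_eqF// sqrtr_gt0.
apply: measurable_funM.
  rewrite (_ : (fun _ => _) = (fun z : RR * RR => normal_pdf 0 (Num.sqrt D) (z.1 - z.2))).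
    by apply: (measurableT_comp (measurable_normal_pdf 0 (Num.sqrt D))); exact: measurable_funB.
  by apply/funext => z; exact: normal_pdf_translate.
apply: (measurableT_comp (f := fun x : RR => (normal_pdf mx sx x)^-1)); last exact: measurable_fst.
apply: measurable_inv_gt0; first exact: measurable_normal_pdf.
by move=> x; apply: normal_pdf_gt0; rewrite gt_eqF.
Qed.

Lemma integral_test_density D (G : RR -> \bar R) y : 0 < D -> measurable_fun setT G ->
  (forall x, 0 <= G x)%E ->
  (\int[PX]_x (G x * (test_density D (x, y))%:E) = \int[normal_prob y (Num.sqrt D)]_x G x)%E.
Proof.
move=> D0 mG G0; rewrite (ge0_integral_input PXE); last 2 first.
- apply: emeasurable_funM => //; apply/measurable_EFinP.
  exact: (measurableT_comp (measurable_test_density D0) (measurable_pair2 y)).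
- by move=> x; rewrite mule_ge0// lee_fin ltW// test_density_gt0.
rewrite (integral_normal_prob y (Num.sqrt D) mG); apply: eq_integral => x _.
by rewrite -muleA -EFinM /test_density divfK// gt_eqF// normal_pdf_gt0// gt_eqF.
Qed.

Lemma is_mean_ln_test_density D M : 0 < D ->
  is_mean nu (fun z => (z.1 - z.2) ^+ 2) M ->
  is_mean nu (fun z => ln (test_density D z)) ((ln (sx ^+ 2 / D) + 1 - M / D) / 2).
Proof.
move=> D0 dM; have sx1 : sx != 0 by rewrite gt_eqF.
have sD : Num.sqrt D != 0 by rewrite gt_eqF// sqrtr_gt0.
have sD2 : Num.sqrt D ^+ 2 = D by rewrite sqr_sqrtr// ltW.
apply: (eq_is_mean (is_meanD (is_mean_cst _ (ln (normal_peak (Num.sqrt D))))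
  (is_meanD (is_meanZ (- (2 * D)^-1) dM) (is_meanZ (- 1) is_mean_input_ln)))).
  move=> z; rewrite /test_density lnM ?posrE ?invr_gt0 ?normal_pdf_gt0//.
  by rewrite lnV ?posrE ?normal_pdf_gt0// (ln_normal_pdf _ _ sD) sD2; ring.
rewrite !ln_normal_peak// sD2 lnM ?posrE ?invr_gt0// lnV ?posrE//.
by field; exact: lt0r_neq0.
Qed.

Lemma information_ge_distortion (D : R) : 0 < D ->
  (\int[nu]_z ((z.1 - z.2) ^+ 2)%:E <= D%:E)%E -> ((ln (sx ^+ 2 / D) / 2)%:E <= I)%E.
Proof.
move=> D0 leD.
have id : nu.-integrable setT (EFin \o (fun z : RR * RR => (z.1 - z.2) ^+ 2)).
  apply/integrableP; split.
    by apply/measurable_EFinP; apply: measurable_funX; exact: measurable_funB.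
  under eq_integral do rewrite /= ger0_norm ?sqr_ge0//.
  exact: (le_lt_trans leD (ltry _)).
have dM := integrable_is_mean id; set M := Rintegral _ _ _ in dM.
have MD : M <= D by rewrite -lee_fin -dM.2.
have lM := is_mean_ln_test_density D0 dM.
have mr := measurable_test_density D0.
have := @gibbs _ _ _ nu (prod_measure PX mu) (test_density D) mr (fun z => test_density_gt0 z D0).
(* The trial variance is the budget [D], since the actual distortion [M] may be zero; the excess
   [1 - M / D] is nonnegative and is dropped. *)
rewrite lM.2 => gi; apply: (@le_trans _ _ ((ln (sx ^+ 2 / D) + 1 - M / D) / 2)%:E); last first.
  apply: gi; last exact: lM.1.
  rewrite ge0_integral_prod_measure; last 2 first.
  - exact/measurable_EFinP.
  - by move=> z; rewrite lee_fin ltW// test_density_gt0.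
  have -> : (\int[mu]_y \int[PX]_x (test_density D (x, y))%:E = \int[mu]__ 1)%E; last first.
    by rewrite integral_probability_cst.
  apply: eq_integral => y _.
  rewrite -(integral_probability_cst (normal_prob y (Num.sqrt D)) 1%E).
  rewrite -(integral_test_density (G := cst 1%E) y D0)//.
  by apply: eq_integral => x _; rewrite mul1e.
rewrite lee_fin ler_pM2r ?invr_gt0// -addrA lerDl subr_ge0.
by rewrite ler_pdivrMr// mul1r.
Qed.

(** The bound is the entropy of the noise [s Z], since [1 - rho2 = s^2 / sig2]. *)
Lemma output_entropy_lb : s != 0 ->
  ((hS + ln (1 - rho2) / 2)%:E <= hSY)%E.
Proof.
move=> s0; have h := output_entropy_ge nu2 nuSE s0.
have s2 : 0 < s ^+ 2 by rewrite exprn_even_gt0.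
rewrite leeNr; apply: (le_trans h); rewrite lee_fin ln_normal_peak//.
have -> : 1 - rho2 = s ^+ 2 / sig2.
  by rewrite /rho2 -[X in X - _](divff (lt0r_neq0 sig2_gt0)) -mulrBl /sig2 addrC addKr.
rewrite lnM ?posrE ?invr_gt0// lnV ?posrE// /hS.
rewrite (_ : - ln (s ^+ 2) / 2 - ln (pi *+ 2) / 2 - 1 / 2 = - ((1 + ln sig2 + ln (pi *+ 2)) / 2 + (ln (s ^+ 2) - ln sig2) / 2))//.
by field.
Qed.

(** Think of [w] and [g] as the conditional variances of [S] and [X] relative to their variances in
    the Gaussian case: they satisfy [w = 1 - rho2 + rho2 * g]. An infinite information needs no
    proof. *)
Lemma information_ge_entropy (C g : R) : 0 < g <= 1 ->
  g = 1 - rho2^-1 * (1 - expR (2 * (C - hS))) -> (hSY <= C%:E)%E -> ((- (ln g / 2))%:E <= I)%E.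
Proof.
move=> /andP[g0 g1] gE hC; have := information_ge0.
case iE: I => [i| |] // _; last by rewrite leey.
have sx1 : sx != 0 by rewrite gt_eqF.
have rho0 : 0 < rho2 by rewrite divr_gt0// mulr_gt0.
have wE : expR (2 * (C - hS)) = 1 - rho2 + rho2 * g.
  by rewrite gE; field; rewrite lt0r_neq0.
set w := expR _ in wE gE; have w0 : 0 < w by exact: expR_gt0.
have CE : C = hS + ln w / 2 by rewrite /w expRK; field.
have h1 : ((- C)%R%:E <= expected_log_density nuS (prod_measure leb mu))%E.
  by rewrite EFinN leeNl.
have eE := is_mean_input_ln.
rewrite lee_fin.
have l_al : ln `|al| = ln (al ^+ 2) / 2.
  by rewrite -(real_normK (num_real al)) lnXn ?normr_gt0// -(mulr_natr (ln _)) mulfK// pnatr_eq0.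
have [s0|s0] := eqVneq s 0.
  have := noiseless_output_entropy nu2 nuSE s0 sx1 al0 PXE iE eE.
  move: h1 => /[swap] ->; rewrite lee_fin ln_normal_peak// CE l_al.
  have sigE : sig2 = al ^+ 2 * sx ^+ 2 by rewrite /sig2 s0 expr0n addr0.
  have r1 : rho2 = 1 by rewrite /rho2 -sigE divff// gt_eqF.
  have -> : w = g by rewrite wE r1 subrr add0r mul1r.
  rewrite /hS sigE lnM ?posrE// => h; rewrite -subr_ge0; move: h; rewrite -subr_ge0 => h.
  by apply: (le_trans h); rewrite le_eqVlt; apply/orP; left; apply/eqP; field.
have s2 : 0 < s ^+ 2 by rewrite exprn_even_gt0.
(* The share of the conditional variance of [S] contributed by [X] in the Gaussian case. With this
   value all logarithms combine into [lam * (i + ln g / 2) >= 0]. *)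
pose lam := rho2 * g / w.
have lamE : 1 - lam = s ^+ 2 / (sig2 * w).
  have e : w - rho2 * g = s ^+ 2 / sig2.
    rewrite wE addrK /rho2 -[X in X - _](divff (lt0r_neq0 sig2_gt0)) -mulrBl /sig2.
    by rewrite addrC addKr.
  rewrite /lam -[X in X - _](divff (lt0r_neq0 w0)) -mulrBl e invfM; ring.
have lam0 : 0 < lam by rewrite divr_gt0// mulr_gt0.
have lam1 : 0 < 1 - lam by rewrite lamE divr_gt0// mulr_gt0.
have lam01 : 0 < lam < 1 by rewrite lam0 -subr_gt0.
have [nsq _] := @is_mean_input (fun x => x ^+ 2) _
  (@measurable_funX _ _ _ _ id 2 (@measurable_id _ _ setT)) (is_mean_normal2 mx sx1).
have := conditional_entropy_power sx1 al0 s0 PXE nu2 nuSE nsq lam01 iE eE.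
move=> /(le_trans h1); rewrite lee_fin => h2.
have {h2} : 0 <= lam * (i + ln g / 2).
  have slam : Num.sqrt lam != 0 by rewrite gt_eqF// sqrtr_gt0.
  have pl : (normal_peak (Num.sqrt lam))^-1 \is Num.pos.
    by rewrite posrE invr_gt0; exact: normal_peak_gt0.
  move: h2; rewrite /smoothing_const lnM ?posrE ?expR_gt0//.
  rewrite expRK (@lnV _ (normal_peak (Num.sqrt lam))); last by rewrite posrE normal_peak_gt0.
  rewrite (ln_normal_peak sx1) (ln_normal_peak slam).
  rewrite (ln_normal_peak (@oner_neq0 R)) expr1n ln1 (sqr_sqrtr (ltW lam0)) l_al CE /hS.
  have lndiv (x y : R) : 0 < x -> 0 < y -> ln (x / y) = ln x - ln y.
    by move=> x0 y0; rewrite lnM ?posrE ?invr_gt0// lnV.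
  have ll : ln lam = ln (al ^+ 2) + ln (sx ^+ 2) - ln sig2 + ln g - ln w.
    have as0 := mulr_gt0 al2 sx2.
    rewrite /lam (lndiv _ _ (mulr_gt0 rho0 g0) w0) lnM ?posrE// /rho2 (lndiv _ _ as0 sig2_gt0).
    by rewrite (@lnM _ (al ^+ 2)) ?posrE.
  have l1 : ln ((1 - lam) / s ^+ 2) = - ln sig2 - ln w.
    rewrite lamE mulrAC divff ?gt_eqF// mul1r lnV ?posrE ?mulr_gt0// lnM ?posrE//.
    by rewrite opprD.
  rewrite ll l1 => h; rewrite -subr_ge0 in h; apply: (le_trans h).
  by rewrite le_eqVlt; apply/orP; left; apply/eqP; field; exact: lt0r_neq0.
by rewrite pmulr_rge0// -lerBlDr sub0r.
Qed.

End gaussian_converse.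

(** * Test channels *)

Section gaussian_achievability.
Local Open Scope ring_scope.
Context (R : realType).
Local Notation RR := (measurableTypeR R).
Local Notation leb := (@lebesgue_measure R).
Local Notation gamma := (normal_prob (0 : R) 1).

Lemma is_mean_ge0 d (T : measurableType d) (P : probability T R) (f : T -> R) a :
  measurable_fun setT f -> (forall x, 0 <= f x) -> (\int[P]_x (f x)%:E = a%:E)%E ->
  is_mean P f a.
Proof.
move=> mf f0 fa; split => //; apply/integrableP; split; first exact/measurable_EFinP.
under eq_integral do rewrite /= ger0_norm//.
by rewrite fa ltry.
Qed.

Context (mu : probability RR R) (nu nuS : probability (RR * RR)%type R) (al be s : R).
Hypothesis nuSE : forall A, measurable A ->
  nuS A = (nu \x gamma)%E (affine_noise al be s @^-1` A).

(* An estimator m of the input with mean square error D yields a Gaussian trial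
   conditional density for S given Y. *)
Lemma output_entropy_ub (m : RR -> RR) (D : R) : measurable_fun setT m ->
  is_mean nu (fun z => (z.1 - m z.2) ^+ 2) D -> 0 < al ^+ 2 * D + s ^+ 2 ->
  (- expected_log_density nuS (prod_measure leb mu) <=
   ((1 + ln (al ^+ 2 * D + s ^+ 2) + ln (pi *+ 2)) / 2)%:E)%E.
Proof.
move=> mm uD; set v := al ^+ 2 * D + s ^+ 2 => v0.
have sv : Num.sqrt v != 0 by rewrite gt_eqF// sqrtr_gt0.
have sv2 : Num.sqrt v ^+ 2 = v by rewrite sqr_sqrtr// ltW.
pose c (y : RR) : R := al * m y + be.
have mc : measurable_fun setT c.
  by apply: measurable_funD => //; apply: measurable_funM.
have mq : measurable_fun setT (fun z : RR * RR => z.1 - c z.2 : RR).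
  by apply: measurable_funB; [exact: measurable_fst|exact: (measurableT_comp mc measurable_snd)].
have mq2 : measurable_fun setT (fun z : RR * RR => (z.1 - c z.2) ^+ 2).
  exact: (@measurable_funX _ _ _ _ _ 2 mq).
have qv : is_mean nuS (fun z => (z.1 - c z.2) ^+ 2) v.
  apply: is_mean_ge0 => //; first by move=> z; exact: sqr_ge0.
  rewrite (ge0_integral_output nuSE); last 2 first.
  - exact/measurable_EFinP.
  - by move=> z; rewrite lee_fin sqr_ge0.
  have [_ <-] : is_mean nu (fun z => al ^+ 2 * (z.1 - m z.2) ^+ 2 + s ^+ 2) v.
    exact: (is_meanD (is_meanZ (al ^+ 2) uD) (is_mean_cst _ (s ^+ 2))).
  apply: eq_integral => -[x y] _.
  have [_ <-] : is_mean gamma (fun w => (al * x + be + s * w - c y) ^+ 2)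
      (al ^+ 2 * (x - m y) ^+ 2 + s ^+ 2).
    apply: (eq_is_mean (is_meanD (is_mean_cst _ (al ^+ 2 * (x - m y) ^+ 2)) (is_meanD
      (is_meanZ (2 * al * (x - m y) * s) (is_mean_gamma1 R))
      (is_meanZ (s ^+ 2) (is_mean_gamma2 R))))) => [w /=|]; last by ring.
    by rewrite /c; ring.
  by [].
pose r (z : RR * RR) := normal_pdf (c z.2) (Num.sqrt v) z.1.
have mr : measurable_fun setT r.
  rewrite (_ : r = (fun z : RR * RR => normal_pdf 0 (Num.sqrt v) (z.1 - c z.2))).
    exact: (measurableT_comp (measurable_normal_pdf 0 (Num.sqrt v)) mq).
  by apply/funext => z; exact: normal_pdf_translate.
have r0 z : 0 < r z by exact: normal_pdf_gt0.
have lr : is_mean nuS (fun z => ln (r z)) (- (1 + ln v + ln (pi *+ 2)) / 2).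
  apply: (eq_is_mean (is_meanD (is_mean_cst _ (ln (normal_peak (Num.sqrt v))))
    (is_meanZ (- (2 * v)^-1) qv))).
    by move=> z; rewrite /r (ln_normal_pdf _ _ sv) sv2; field; exact: lt0r_neq0.
  by rewrite ln_normal_peak// sv2; field; exact: lt0r_neq0.
rewrite leeNl -EFinN -mulNr -lr.2.
apply: (@gibbs _ _ _ nuS (prod_measure leb mu) r mr r0); last exact: lr.1.
rewrite ge0_integral_prod_measure; last 2 first.
- exact/measurable_EFinP.
- by move=> z; rewrite lee_fin ltW.
rewrite -(integral_probability_cst mu 1%E) le_eqVlt; apply/orP; left; apply/eqP.
by apply: eq_integral => y _; rewrite /r /=; exact: (integral_normal_pdf (c y) (Num.sqrt v)).
Qed.

End gaussian_achievability.

(** * Forward and backward forms of the Gaussian test channel *)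

Section gaussian_test_channel.
Local Open Scope ring_scope.
Context (R : realType).
Local Notation RR := (measurableTypeR R).
Local Notation leb := (@lebesgue_measure R).

Lemma measurable_normal_pdf_mean (c : RR -> RR) (s : R) : s != 0 -> measurable_fun setT c ->
  measurable_fun setT (fun z : RR * RR => normal_pdf (c z.1) s z.2).
Proof.
move=> s0 mc.
rewrite (_ : (fun _ => _) = (fun z : RR * RR => normal_pdf 0 s (z.2 - c z.1))).
  apply: (measurableT_comp (measurable_normal_pdf 0 s)).
  by apply: measurable_funB; [exact: measurable_snd|exact: (measurableT_comp mc measurable_fst)].
by apply/funext => z; exact: normal_pdf_translate.
Qed.

Lemma ge0_integral_normal_normal (m1 s1 : R) (c : RR -> RR) (s2 : R) (G : RR * RR -> \bar R) :
  s2 != 0 -> measurable_fun setT c -> measurable_fun setT G -> (forall z, 0 <= G z)%E ->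
  (\int[normal_prob m1 s1]_x \int[normal_prob (c x) s2]_y G (x, y) =
   \int[leb]_x \int[leb]_y (G (x, y) * (normal_pdf m1 s1 x * normal_pdf (c x) s2 y)%R%:E))%E.
Proof.
move=> s20 mc mG G0.
pose K (z : RR * RR) := (G z * (normal_pdf (c z.1) s2 z.2)%:E)%E.
have mp := measurable_normal_pdf_mean s20 mc.
have mK : measurable_fun setT K by apply: emeasurable_funM => //; exact/measurable_EFinP.
have K0 z : (0 <= K z)%E by rewrite mule_ge0// lee_fin normal_pdf_ge0.
have e x : (\int[normal_prob (c x) s2]_y G (x, y) = \int[leb]_y K (x, y))%E.
  by rewrite (integral_normal_prob (c x) s2 (measurableT_comp mG (measurable_pair1 x))).
rewrite (eq_integral (fun x => \int[leb]_y K (x, y))%E); last by move=> x _; exact: e.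
have mIK : measurable_fun setT (fun x : RR => \int[leb]_y K (x, y))%E.
  exact: (@measurable_fun_fubini_tonelli_F _ _ _ _ _ leb K mK K0).
rewrite (integral_normal_prob m1 s1 mIK); apply: eq_integral => x _.
rewrite -ge0_integralZr//.
- by apply: eq_integral => y _; rewrite -muleA -EFinM mulrC.
- exact: (measurableT_comp mK (measurable_pair1 x)).
- by rewrite lee_fin normal_pdf_ge0.
Qed.

(** Bayes' rule between the forward channel, which shrinks [x] towards [mx] and adds noise, and the
    backward one, where [Y] has variance [sx^2 - D] and [X = Y + N(0, D)]. On logarithms it is an
    identity of quadratic polynomials. *)
Lemma normal_pdf_bayes (mx sx D x y : R) : 0 < sx -> 0 < D < sx ^+ 2 ->
  normal_pdf mx sx x * normal_pdf ((1 - D / sx ^+ 2) * x + D / sx ^+ 2 * mx)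
    (Num.sqrt (D * (1 - D / sx ^+ 2))) y
  = normal_pdf mx (Num.sqrt (sx ^+ 2 - D)) y * normal_pdf y (Num.sqrt D) x.
Proof.
move=> sx0 /andP[D0 Dsx]; have sx2 : 0 < sx ^+ 2 by rewrite exprn_gt0.
have a0 : 0 < 1 - D / sx ^+ 2 by rewrite subr_gt0 ltr_pdivrMr// mul1r.
have sD0 : 0 < sx ^+ 2 - D by rewrite subr_gt0.
have Da0 := mulr_gt0 D0 a0.
have ss (t : R) : 0 < t -> Num.sqrt t != 0 by move=> t0; rewrite gt_eqF// sqrtr_gt0.
have sx1 : sx != 0 by rewrite gt_eqF.
set a := 1 - D / sx ^+ 2 in a0 Da0 *.
have p1 := normal_pdf_gt0 mx x sx1.
have p2 := normal_pdf_gt0 (a * x + D / sx ^+ 2 * mx) y (ss _ Da0).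
have p3 := normal_pdf_gt0 mx y (ss _ sD0).
have p4 := normal_pdf_gt0 y x (ss _ D0).
apply: ln_inj.
- by rewrite posrE; exact: mulr_gt0 p1 p2.
- by rewrite posrE; exact: mulr_gt0 p3 p4.
rewrite (lnM p1 p2) (lnM p3 p4).
rewrite (ln_normal_pdf _ _ sx1) (ln_normal_pdf _ _ (ss _ Da0)).
rewrite (ln_normal_pdf _ _ (ss _ sD0)) (ln_normal_pdf _ _ (ss _ D0)).
rewrite (ln_normal_peak sx1) (ln_normal_peak (ss _ Da0)) (ln_normal_peak (ss _ sD0)).
rewrite (ln_normal_peak (ss _ D0)) (sqr_sqrtr (ltW Da0)) (sqr_sqrtr (ltW D0)) (sqr_sqrtr (ltW sD0)).
have aE : a = (sx ^+ 2 - D) / sx ^+ 2 by rewrite mulrBl divff// gt_eqF.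
have l1 : ln (D * a) = ln D + ln (sx ^+ 2 - D) - ln (sx ^+ 2).
  have i2 : (sx ^+ 2)^-1 \is Num.pos by rewrite posrE invr_gt0.
  by rewrite (lnM D0 a0) aE (lnM sD0 i2) (lnV sx2) addrA.
rewrite l1 aE; move: (sx ^+ 2) sx2 sD0 => q q0 qD.
by field; rewrite !lt0r_neq0.
Qed.

(** A channel must be given forwards, but distortion and information are immediate from the backward
    form. *)
Lemma noise_substitution (mx sx D : R) (G : RR * RR -> \bar R) : 0 < sx -> 0 < D < sx ^+ 2 ->
  measurable_fun setT G -> (forall z, 0 <= G z)%E ->
  (\int[normal_prob mx sx]_x \int[normal_prob ((1 - D / sx ^+ 2) * x + D / sx ^+ 2 * mx)
      (Num.sqrt (D * (1 - D / sx ^+ 2)))]_y G (x, y)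
   = \int[normal_prob mx (Num.sqrt (sx ^+ 2 - D))]_y \int[normal_prob y (Num.sqrt D)]_x G (x, y))%E.
Proof.
move=> sx0 Dsx mG G0; have /andP[D0 Ds] := Dsx; have sx2 : 0 < sx ^+ 2 by rewrite exprn_gt0.
have a0 : 0 < 1 - D / sx ^+ 2 by rewrite subr_gt0 ltr_pdivrMr// mul1r.
have Da0 : Num.sqrt (D * (1 - D / sx ^+ 2)) != 0 by rewrite gt_eqF// sqrtr_gt0 mulr_gt0.
have sD : Num.sqrt D != 0 by rewrite gt_eqF// sqrtr_gt0.
have mc : measurable_fun setT (fun x : RR => (1 - D / sx ^+ 2) * x + D / sx ^+ 2 * mx : RR).
  by apply: measurable_funD => //; apply: measurable_funM.
rewrite (ge0_integral_normal_normal mx sx Da0 mc mG G0).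
pose G' (z : RR * RR) := G (z.2, z.1).
have mG' : measurable_fun setT G'.
  by apply: (measurableT_comp mG); apply: measurable_fun_pair; [exact: measurable_snd|exact: measurable_fst].
rewrite (ge0_integral_normal_normal mx (Num.sqrt (sx ^+ 2 - D)) sD (@measurable_id _ _ setT) mG' (fun=> G0 _)).
pose K (z : RR * RR) := (G z * (normal_pdf mx sx z.1 *
  normal_pdf ((1 - D / sx ^+ 2) * z.1 + D / sx ^+ 2 * mx) (Num.sqrt (D * (1 - D / sx ^+ 2))) z.2)%R%:E)%E.
have mK : measurable_fun setT K.
  apply: emeasurable_funM => //; apply/measurable_EFinP; apply: measurable_funM.
    exact: (measurableT_comp (measurable_normal_pdf mx sx) measurable_fst).
  exact: (measurable_normal_pdf_mean Da0 mc).
have K0 z : (0 <= K z)%E by rewrite mule_ge0// lee_fin mulr_ge0// normal_pdf_ge0.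
apply: (etrans (@fubini_tonelli _ _ _ _ R leb leb K mK K0)).
apply: eq_integral => y _; apply: eq_integral => x _.
by rewrite /K /G' /= normal_pdf_bayes.
Qed.

End gaussian_test_channel.

Section test_channel_information.
Local Open Scope ring_scope.
Context (R : realType).
Local Notation RR := (measurableTypeR R).
Context (PX mu : probability RR R) (nu : probability (RR * RR)%type R) (mx sx : R) (sx0 : 0 < sx).
Hypothesis PXE : forall A : set RR, measurable A -> PX A = normal_prob mx sx A.
Hypothesis nu1 : forall A : set RR, measurable A -> nu (fst @^-1` A) = PX A.
Hypothesis nu2 : forall B : set RR, measurable B -> nu (snd @^-1` B) = mu B.

Let mI (A : set (RR * RR)) : measurable A -> measurable_fun setT (fun z => (\1_A z : R)%:E).
Proof. by move=> mA; apply/measurable_EFinP; exact: measurable_indic. Qed.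

Let I0 (A : set (RR * RR)) z : (0 <= (\1_A z : R)%:E)%E.
Proof. by rewrite lee_fin. Qed.

Lemma information_eq_integral (f : RR * RR -> R) a : measurable_fun setT f ->
  (forall z, 0 < f z) ->
  (forall G, measurable_fun setT G -> (forall z, 0 <= G z)%E ->
    (\int[nu]_z G z = \int[mu]_y \int[PX]_x (G (x, y) * (f (x, y))%:E))%E) ->
  is_mean nu (fun z => ln (f z)) a -> expected_log_density nu (prod_measure PX mu) = a%:E.
Proof.
move=> mf f0 nuf [_ <-].
rewrite (expected_log_densityE (f := fun z => (f z)%:E)).
- by apply: eq_integral => z _; rewrite lne_EFin.
- exact/measurable_EFinP.
- by move=> z; rewrite lee_fin ltW.
move=> A mA; rewrite (measure_indicE nu mA) (nuf _ (mI mA) (I0 A)).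
have mG : measurable_fun setT (fun z => (\1_A z : R)%:E * (f z)%:E)%E.
  by apply: emeasurable_funM; [exact: mI|exact/measurable_EFinP].
rewrite [RHS]integral_mkcond.
transitivity (\int[prod_measure PX mu]_z ((\1_A z : R)%:E * (f z)%:E))%E.
  apply/esym; apply: (ge0_integral_prod_measure PX mu mG) => z.
  by rewrite mule_ge0// lee_fin ltW.
apply: eq_integral => z _; rewrite patchE indicE.
by case: ifP => zA; rewrite ?mul1e ?mul0e.
Qed.

Lemma constant_channel_information (m : R) :
  (forall G, measurable_fun setT G -> (forall z, 0 <= G z)%E ->
    (\int[nu]_z G z = \int[PX]_x G (x, m))%E) ->
  expected_log_density nu (prod_measure PX mu) = 0%E.
Proof.
move=> nuG.
have muE (g : RR -> \bar R) : measurable_fun setT g -> (forall y, 0 <= g y)%E ->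
    (\int[mu]_y g y = g m)%E.
  move=> mg g0; rewrite (ge0_integral_image (m1 := nu) measurable_snd _ mg g0); last first.
    by move=> B mB; exact: (esym (nu2 mB)).
  rewrite (nuG (g \o snd) (measurableT_comp mg measurable_snd)) => [|z]; last exact: g0.
  exact: (integral_probability_cst PX (g m)).
apply: (@information_eq_integral (cst 1) 0) => //.
  move=> G mG G0; rewrite (nuG G mG G0) muE.
  - by apply: eq_integral => x _; rewrite mule1.
  - have mG1 : measurable_fun setT (fun z => G z * 1%:E)%E by apply: emeasurable_funM.
    apply: (@measurable_fun_fubini_tonelli_G _ _ _ _ _ PX _ mG1) => z.
    by rewrite mule_ge0// lee_fin.
  - by move=> y; apply: integral_ge0 => x _; rewrite mule_ge0// lee_fin.
by apply: (eq_is_mean (is_mean_cst nu 0)) => // z; rewrite /= ln1.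
Qed.

(** In the backward form [test_density] is the exact density of [(X, Y)], so the bound obtained from
    Gibbs' inequality is attained. *)
Lemma gaussian_channel_information (D : R) : 0 < D ->
  (forall G, measurable_fun setT G -> (forall z, 0 <= G z)%E ->
    (\int[nu]_z G z = \int[normal_prob mx (Num.sqrt (sx ^+ 2 - D))]_y
       \int[normal_prob y (Num.sqrt D)]_x G (x, y))%E) ->
  is_mean nu (fun z => (z.1 - z.2) ^+ 2) D /\
  expected_log_density nu (prod_measure PX mu) = (ln (sx ^+ 2 / D) / 2)%:E.
Proof.
move=> D0 nuG; have sD : Num.sqrt D != 0 by rewrite gt_eqF// sqrtr_gt0.
have md : measurable_fun setT (fun z : RR * RR => (z.1 - z.2) ^+ 2 : R).
  exact: (@measurable_funX _ _ _ _ (fun z : RR * RR => z.1 - z.2) 2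
    (measurable_funB measurable_fst measurable_snd)).
have dD : is_mean nu (fun z => (z.1 - z.2) ^+ 2) D.
  apply: is_mean_ge0 => //; first by move=> z; exact: sqr_ge0.
  rewrite nuG; last 2 first.
  - exact/measurable_EFinP.
  - by move=> z; rewrite lee_fin sqr_ge0.
  rewrite -(integral_probability_cst (normal_prob mx (Num.sqrt (sx ^+ 2 - D))) D%:E).
  apply: eq_integral => y _.
  have [_ <-] : is_mean (normal_prob y (Num.sqrt D)) (fun x => (x - y) ^+ 2) D.
    apply: (eq_is_mean (is_meanD (is_mean_normal2 y sD) (is_meanD
      (is_meanZ (- 2 * y) (is_mean_normal1 y sD)) (is_mean_cst _ (y ^+ 2))))).
      by move=> x /=; ring.
    by rewrite sqr_sqrtr ?ltW//; ring.
  by [].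
split => //.
have muE (g : RR -> \bar R) : measurable_fun setT g -> (forall y, 0 <= g y)%E ->
    (\int[mu]_y g y = \int[normal_prob mx (Num.sqrt (sx ^+ 2 - D))]_y g y)%E.
  move=> mg g0; rewrite (ge0_integral_image (m1 := nu) measurable_snd _ mg g0); last first.
    by move=> B mB; exact: (esym (nu2 mB)).
  rewrite (nuG (g \o snd) (measurableT_comp mg measurable_snd)) => [|z]; last exact: g0.
  by apply: eq_integral => y _; exact: (integral_probability_cst _ (g y)).
apply: (@information_eq_integral (test_density mx sx D)).
- exact: measurable_test_density.
- by move=> z; exact: test_density_gt0.
- move=> G mG G0; rewrite (nuG G mG G0) muE.
  + apply: eq_integral => y _.
    by rewrite (integral_test_density sx0 PXE y D0 (measurableT_comp mG (measurable_pair2 y)) (fun=> G0 _)).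
  + have mG1 : measurable_fun setT (fun z => G z * (test_density mx sx D z)%:E)%E.
      by apply: emeasurable_funM => //; apply/measurable_EFinP; exact: measurable_test_density.
    apply: (@measurable_fun_fubini_tonelli_G _ _ _ _ _ PX _ mG1) => z.
    by rewrite mule_ge0// lee_fin ltW// test_density_gt0.
  + by move=> y; apply: integral_ge0 => x _; rewrite mule_ge0// lee_fin ltW// test_density_gt0.
apply: (eq_is_mean (is_mean_ln_test_density sx0 PXE nu1 D0 dD)) => //.
by rewrite divff ?gt_eqF// addrK.
Qed.

End test_channel_information.

Section gaussian_channel.
Local Open Scope ring_scope.
Context (R : realType) (a b c : R).
Local Notation RR := (measurableTypeR R).
Local Notation gamma := (normal_prob (0 : R) 1).

(** The proof [c0] is an argument so that the kernel structure, whose measurability proof uses it,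
    can be attached to this term. *)
Definition gaussian_channel (c0 : c != 0) (x : RR) : {measure set RR -> \bar R} :=
  normal_prob (a * x + b) c.

Hypothesis c0 : c != 0.

Let measurable_gaussian_channel (A : set RR) : measurable A ->
  measurable_fun setT (gaussian_channel c0 ^~ A).
Proof.
move=> mA; rewrite /gaussian_channel.
have mI : measurable_fun setT (fun x : RR => (\1_A x : R)%:E).
  by apply/measurable_EFinP; exact: measurable_indic.
rewrite (_ : (fun x => _) = (fun x : RR => \int[gamma]_v (\1_A (c * v + (a * x + b)) : R)%:E)%E).
  have mh : measurable_fun setT (fun z : RR * RR => (\1_A (c * z.2 + (a * z.1 + b)) : R)%:E).
    apply: (measurableT_comp mI); repeat apply: measurable_funD => //; exact: measurable_funM.
  by apply: (@measurable_fun_fubini_tonelli_F _ _ _ _ _ gamma _ mh) => z; rewrite lee_fin.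
apply/funext => x; apply: (etrans (@measure_indicE _ _ _ (normal_prob (a * x + b) c) A mA)).
by apply: (ge0_integral_normal_std _ c0 mI) => y; rewrite lee_fin.
Qed.

HB.instance Definition _ :=
  isKernel.Build _ _ _ _ _ (gaussian_channel c0) measurable_gaussian_channel.

Let gaussian_channel_setT x : gaussian_channel c0 x setT = 1%E.
Proof. exact: probability_setT. Qed.

HB.instance Definition _ :=
  Kernel_isProbability.Build _ _ _ _ _ (gaussian_channel c0) gaussian_channel_setT.

End gaussian_channel.

Lemma diff_entropy_normal d (T : measurableType d) (R : realType) (P : probability T R)
    (S : {RV P >-> measurableTypeR R}) (m s : R) : (0 < s)%R ->
  (forall B : set (measurableTypeR R), measurable B -> distribution P S B = normal_prob m s B) ->
  diff_entropy S = ((1 + ln (s ^+ 2) + ln (pi *+ 2)) / 2)%R%:E.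
Proof.
move=> s0 hS; have s1 : s != 0%R by rewrite gt_eqF.
rewrite /diff_entropy (@expected_log_densityE _ (measurableTypeR R) R (distribution P S)
  (@lebesgue_measure R) (fun x : measurableTypeR R => (normal_pdf m s x)%:E)).
- have lS : is_mean (distribution P S) (fun x => ln (normal_pdf m s x))
      (- ((1 + ln (s ^+ 2) + ln (pi *+ 2)) / 2))%R.
    have h : is_mean (normal_prob m s) (fun x => ln (normal_pdf m s x))
        (- ((1 + ln (s ^+ 2) + ln (pi *+ 2)) / 2))%R.
      apply: (eq_is_mean (is_meanD (is_mean_cst _ (ln (normal_peak s) - m ^+ 2 / (2 * s ^+ 2))%R)
        (is_meanD (is_meanZ (- (2 * s ^+ 2)^-1) (is_mean_normal2 m s1))
        (is_meanZ (m / s ^+ 2) (is_mean_normal1 m s1))))%R).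
        by move=> x; rewrite ln_normal_pdf//; field.
      by rewrite ln_normal_peak//; field.
    have mln : measurable_fun setT (fun x : measurableTypeR R => ln (normal_pdf m s x)).
      by apply: measurableT_comp; [exact: measurable_ln|exact: measurable_normal_pdf].
    have hS' (B : set (measurableTypeR R)) : measurable B ->
        normal_prob m s B = distribution P S (id @^-1` B) by move=> mB; rewrite hS.
    exact: ((@is_mean_image _ _ _ _ _ (distribution P S) (normal_prob m s) id _ _
      (@measurable_id _ _ setT) hS' mln).1 h).
  have [_ e] := lS; rewrite -[RHS]oppeK -[X in _ = - X]EFinN -e; congr (- _).
  by apply: eq_integral => x _; rewrite lne_EFin// normal_pdf_gt0.
- exact: measurable_normal_pdfE.
- by move=> x; rewrite lee_fin normal_pdf_ge0.
- by move=> A mA; exact: (hS A mA).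
Qed.

(** * Rate bounds and test channels for the Gaussian source *)

Section gaussian_source.
Local Open Scope ring_scope.
Context d (T : measurableType d) (R : realType) (P : probability T R).
Local Notation RR := (measurableTypeR R).
Local Notation gamma := (normal_prob (0 : R) 1).
Context (X S : {RV P >-> RR}) (mux mus sigx a s : R) (sigx0 : 0 < sigx) (a0 : a != 0).
Hypothesis hX : forall B : set RR, measurable B -> distribution P X B = normal_prob mux sigx B.
Hypothesis XSE : forall B, measurable B -> distribution P (rv_pair X S) B =
  (gamma \x gamma)%E (triangular mux sigx mus a s @^-1` B).
Local Notation channel := (R.-pker RR ~> RR).
Let al := a / sigx.
Let sig2 := al ^+ 2 * sigx ^+ 2 + s ^+ 2.
Let hS := (1 + ln sig2 + ln (pi *+ 2)) / 2.
Let rho2 := al ^+ 2 * sigx ^+ 2 / sig2.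
Local Notation Q k := (channel_law P X k).
Local Notation nu k := (distribution (Q k) (rv_pair (channel_input X k) (channel_output X k))).
Local Notation nuS k := (distribution (Q k) (rv_pair (channel_hidden X S k) (channel_output X k))).
Local Notation PX k := (distribution (Q k) (channel_input X k)).
Local Notation mu k := (distribution (Q k) (channel_output X k)).
Local Notation info k := (mutual_information (channel_input X k) (channel_output X k)).

Let al0 : al != 0. Proof. by rewrite mulf_neq0// invr_eq0 gt_eqF. Qed.

Let sigx1 : sigx != 0. Proof. by rewrite gt_eqF. Qed.

Let nuE (k : channel) (G : RR * RR -> \bar R) : measurable_fun setT G ->
  (forall z, 0 <= G z)%E ->
  (\int[nu k]_z G z = \int[normal_prob mux sigx]_x \int[k x]_y G (x, y))%E.
Proof.
move=> mG G0; apply: (etrans (ge0_integral_channel_input_output X k mG G0)).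
have mh : measurable_fun setT (fun x : RR => \int[k x]_y G (x, y))%E.
  exact: (@measurable_fun_integral_finite_kernel _ _ _ _ _ G k G0 mG).
have h0 x : (0 <= \int[k x]_y G (x, y))%E by exact: integral_ge0.
have <- := ge0_integral_distribution X mh h0.
by apply: eq_measure_integral => A mA _; exact: hX.
Qed.

Let nu1 (k : channel) (A : set RR) : measurable A -> nu k (fst @^-1` A) = PX k A.
Proof. by []. Qed.

Let nu2 (k : channel) (A : set RR) : measurable A -> nu k (snd @^-1` A) = mu k A.
Proof. by []. Qed.

Let PXE (k : channel) (A : set RR) : measurable A -> PX k A = normal_prob mux sigx A.
Proof.
move=> mA; have mA' : measurable (@fst RR RR @^-1` A).
  by rewrite -[X in measurable X]setTI; exact: measurable_fst.
rewrite -(nu1 k mA) (measure_indicE (nu k) mA') nuE; last 2 first.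
- by apply/measurable_EFinP; exact: measurable_indic.
- by move=> z; rewrite lee_fin.
rewrite (measure_indicE (normal_prob mux sigx) mA); apply: eq_integral => x _.
rewrite (eq_integral (cst (\1_A x : R)%:E))//.
by rewrite integral_cst// prob_kernel mule1.
Qed.

Let nuSE (k : channel) A : measurable A ->
  nuS k A = (nu k \x gamma)%E (affine_noise al (mus - al * mux) s @^-1` A).
Proof. exact: (channel_hidden_output_law k sigx1 XSE). Qed.

Let distortionE (k : channel) :
  ('E_(Q k) [fun w => ((channel_input X k w - channel_output X k w) ^+ 2)%R]
   = \int[nu k]_z ((z.1 - z.2) ^+ 2)%:E)%E.
Proof.
have md : measurable_fun setT (fun z : RR * RR => ((z.1 - z.2) ^+ 2 : R)%:E).
  apply/measurable_EFinP; exact: (@measurable_funX _ _ _ _ (fun z : RR * RR => z.1 - z.2) 2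
    (measurable_funB measurable_fst measurable_snd)).
rewrite unlock (ge0_integral_distribution _ md)// => z.
by rewrite lee_fin sqr_ge0.
Qed.

Lemma rate_ge_distortion (k : channel) D C : 0 < D -> feasible X S D C k ->
  ((ln (sigx ^+ 2 / D) / 2)%:E <= info k)%E.
Proof.
move=> D0 [+ _]; rewrite distortionE => h.
exact: (information_ge_distortion (mu k) sigx0 (PXE k) (nu1 k) D0 h).
Qed.

Lemma rate_ge_entropy (k : channel) D C g : 0 < g <= 1 ->
  g = 1 - rho2^-1 * (1 - expR (2 * (C - hS))) -> feasible X S D C k ->
  ((- (ln g / 2))%:E <= info k)%E.
Proof.
move=> g01 gE [_ h].
exact: (information_ge_entropy sigx0 al0 (PXE k) (nu1 k) (nu2 k) (nuSE k) g01 gE h).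
Qed.

Lemma feasible_entropy_lb (k : channel) D C : s != 0 -> feasible X S D C k ->
  hS + ln (1 - rho2) / 2 <= C.
Proof.
move=> s0 [_ h]; rewrite -lee_fin; apply: le_trans h.
exact: (output_entropy_lb sigx0 al0 (nu2 k) (nuSE k) s0).
Qed.

(** Two errors are kept apart: [D] bounds the distortion of [Y] itself, while [D'] is the error of
    the estimate [m] of [X] from [Y] and controls [h(S|Y)]. *)
Lemma feasible_estimator (k : channel) (m : RR -> RR) D D' C : measurable_fun setT m ->
  (\int[nu k]_z ((z.1 - z.2) ^+ 2)%:E <= D%:E)%E ->
  is_mean (nu k) (fun z => (z.1 - m z.2) ^+ 2) D' ->
  0 < al ^+ 2 * D' + s ^+ 2 <= sig2 * expR (2 * (C - hS)) -> feasible X S D C k.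
Proof.
move=> mm hD mD /andP[v0 v1]; split; first by rewrite distortionE.
have ub : (cond_diff_entropy (channel_hidden X S k) (channel_output X k) <=
    ((1 + ln (al ^+ 2 * D' + s ^+ 2) + ln (pi *+ 2)) / 2)%:E)%E.
  exact: (output_entropy_ub (mu k) (nuSE k) mm mD v0).
apply: (le_trans ub); rewrite lee_fin.
have sig0 : 0 < sig2 by rewrite ltr_wpDr ?sqr_ge0// mulr_gt0// exprn_even_gt0.
have : ln (al ^+ 2 * D' + s ^+ 2) <= ln sig2 + 2 * (C - hS).
  have w0 := expR_gt0 (2 * (C - hS)).
  have <- : ln (sig2 * expR (2 * (C - hS))) = ln sig2 + 2 * (C - hS).
    by rewrite (lnM sig0 w0) expRK.
  by rewrite ler_ln ?posrE//; exact: mulr_gt0.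
move=> h; rewrite -subr_ge0; move: h; rewrite -subr_ge0 => h.
have -> : C - (1 + ln (al ^+ 2 * D' + s ^+ 2) + ln (pi *+ 2)) / 2 =
    (ln sig2 + 2 * (C - hS) - ln (al ^+ 2 * D' + s ^+ 2)) / 2.
  by rewrite /hS; field.
by rewrite divr_ge0.
Qed.

Lemma constant_channel_rate D C : sigx ^+ 2 <= D -> hS <= C ->
  exists2 k : channel, feasible X S D C k & info k = 0%E.
Proof.
move=> sD hC; pose k : channel := kdirac (@measurable_cst _ _ RR RR setT mux).
have nuG G : measurable_fun setT G -> (forall z, 0 <= G z)%E ->
    (\int[nu k]_z G z = \int[normal_prob mux sigx]_x G (x, mux))%E.
  move=> mG G0; rewrite (nuE k mG G0); apply: eq_integral => x _.
  apply: (etrans (@integral_dirac _ _ (mux : RR) R setT measurableT (fun y => G (x, y))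
    (measurableT_comp mG (measurable_pair1 x)))).
  by rewrite diracT mul1e.
have md (c : RR) : measurable_fun setT (fun z : RR * RR => ((z.1 - c) ^+ 2 : R)).
  apply: measurable_funX; apply: measurable_funB => //; exact: measurable_fst.
have e : is_mean (nu k) (fun z => (z.1 - mux) ^+ 2) (sigx ^+ 2).
  exact: (is_mean_input_sqr sigx0 (PXE k) (nu1 k)).
exists k.
  apply: (@feasible_estimator k (cst mux) D (sigx ^+ 2)) => //.
  - rewrite nuG; last 2 first.
    + apply/measurable_EFinP; exact: (@measurable_funX _ _ _ _ (fun z : RR * RR => z.1 - z.2) 2
        (measurable_funB measurable_fst measurable_snd)).
    + by move=> z; rewrite lee_fin sqr_ge0.
    have md' : measurable_fun setT (fun z : RR * RR => ((z.1 - mux) ^+ 2 : R)%:E).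
      by apply/measurable_EFinP; exact: md.
    have h2 := nuG _ md' (fun z => ltac:(by rewrite lee_fin sqr_ge0)).
    have -> : (\int[normal_prob mux sigx]_x ((x - mux) ^+ 2)%:E = (sigx ^+ 2)%:E)%E.
      by rewrite -e.2 h2.
    by rewrite lee_fin.
  - rewrite -/sig2; have sig0 : 0 < sig2 by rewrite ltr_wpDr ?sqr_ge0// mulr_gt0// exprn_even_gt0.
    rewrite sig0 /=; apply: ler_peMr; first exact: ltW.
    by rewrite -[leLHS]expR0 ler_expR mulr_ge0// subr_ge0.
apply: (constant_channel_information (nu2 k) (m := mux)) => G mG G0.
by rewrite (nuG G mG G0); apply: eq_measure_integral => A mA _; exact/esym/PXE.
Qed.

(** [D'] may lie strictly below the budget [D], which is what an active entropy constraint
    requires. *)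
Lemma gaussian_channel_rate D D' C : 0 < D' < sigx ^+ 2 -> D' <= D ->
  al ^+ 2 * D' + s ^+ 2 <= sig2 * expR (2 * (C - hS)) ->
  exists2 k : channel, feasible X S D C k & info k = (ln (sigx ^+ 2 / D') / 2)%:E.
Proof.
move=> D0s DD hC; have /andP[D0 Ds] := D0s.
have sx2 : 0 < sigx ^+ 2 by rewrite exprn_gt0.
have c0 : Num.sqrt (D' * (1 - D' / sigx ^+ 2)) != 0.
  by rewrite gt_eqF// sqrtr_gt0 mulr_gt0// subr_gt0 ltr_pdivrMr// mul1r.
pose k : channel := gaussian_channel (1 - D' / sigx ^+ 2) (D' / sigx ^+ 2 * mux) c0.
have nuG G : measurable_fun setT G -> (forall z, 0 <= G z)%E ->
    (\int[nu k]_z G z = \int[normal_prob mux (Num.sqrt (sigx ^+ 2 - D'))]_y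
       \int[normal_prob y (Num.sqrt D')]_x G (x, y))%E.
  by move=> mG G0; exact: (etrans (nuE k mG G0) (noise_substitution mux sigx0 D0s mG G0)).
have [dD iE] := gaussian_channel_information sigx0 (PXE k) (nu1 k) (nu2 k) D0 nuG.
exists k => //; apply: (@feasible_estimator k id D D') => //.
- by rewrite dD.2 lee_fin.
- by rewrite hC andbT ltr_wpDr ?sqr_ge0// mulr_gt0// exprn_even_gt0.
Qed.

(** Serves the case [g = 0]: the rate is then infinite for every feasible channel, so feasibility is
    all that is needed. *)
Lemma identity_channel_feasible D C : 0 <= D -> s != 0 ->
  s ^+ 2 <= sig2 * expR (2 * (C - hS)) ->
  exists k : channel, feasible X S D C k.
Proof.
move=> D0 s0 hC; pose k : channel := kdirac (@measurable_id _ RR setT).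
have d0 : (\int[nu k]_z ((z.1 - z.2) ^+ 2)%:E = 0)%E.
  have md : measurable_fun setT (fun z : RR * RR => ((z.1 - z.2) ^+ 2 : R)%:E).
    apply/measurable_EFinP; exact: (@measurable_funX _ _ _ _ (fun z : RR * RR => z.1 - z.2) 2
      (measurable_funB measurable_fst measurable_snd)).
  rewrite (nuE k md) => [|z]; last by rewrite lee_fin sqr_ge0.
  apply: integral0_eq => x _.
  apply: (etrans (@integral_dirac _ _ x R setT measurableT _ (measurableT_comp md (measurable_pair1 x)))).
  by rewrite diracT mul1e /= subrr expr0n.
exists k; apply: (@feasible_estimator k id D 0) => //.
- by rewrite d0 lee_fin.
- apply: is_mean_ge0 => //; last by move=> z; exact: sqr_ge0.
  exact: (@measurable_funX _ _ _ _ (fun z : RR * RR => z.1 - z.2) 2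
    (measurable_funB measurable_fst measurable_snd)).
- by rewrite mulr0 add0r hC andbT exprn_even_gt0.
Qed.

End gaussian_source.

Lemma is_min_rateP d (T : measurableType d) (R : realType) (P : probability T R)
    (X S : {RV P >-> measurableTypeR R}) (D C : R) (r : \bar R) :
  (exists2 k, feasible X S D C k & mutual_information (channel_input X k) (channel_output X k) = r) ->
  (forall k, feasible X S D C k ->
    r <= mutual_information (channel_input X k) (channel_output X k)) ->
  is_min_rate X S D C r.
Proof. by move=> [k Fk kr] lb; split; [exists k|move=> _ [k' Fk' <-]; exact: lb]. Qed.

(** The value [-oo] of [lne] at 0 makes [Cmin = -oo] when [rho^2 = 1], so that no [C] is infeasible,
    and makes the rate [+oo] when [g = 0]. *)
Theorem theorem2 (R : realType) (d : measure_display) (T : measurableType d)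
  (P : probability T R) (X S : {RV P >-> measurableTypeR R})
  (mux mus sigx sigs theta1 D C : R)
  (hXS : jointly_gaussian X S)
  (hX : forall B : set (measurableTypeR R), measurable B ->
     distribution P X B = normal_prob mux sigx B)
  (hS : forall B : set (measurableTypeR R), measurable B ->
     distribution P S B = normal_prob mus sigs B)
  (sigx_gt0 : (0 < sigx)%R) (sigs_gt0 : (0 < sigs)%R)
  (hcov : covariance P X S = theta1%:E) (theta1_neq0 : theta1 != 0%R)
  (D_gt0 : (0 < D)%R) :
  let rho := (theta1 / (sigs * sigx))%R in
  let h := diff_entropy S in
  let Cmin := (2^-1)%:E * lne (1 - theta1 ^+ 2 / (sigs ^+ 2 * sigx ^+ 2))%:E + h in
  let g := (1 - (rho ^+ 2)^-1 * (1 - expR (- 2 * fine h + 2 * C)))%R in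
  (C%:E < Cmin -> feasible X S D C = set0) /\
  (Cmin <= C%:E ->
    (h < C%:E /\ (sigx ^+ 2 < D)%R -> is_min_rate X S D C 0) /\
    (~ (h < C%:E /\ (sigx ^+ 2 < D)%R) ->
      ((D <= sigx ^+ 2 * g)%R ->
         is_min_rate X S D C ((2^-1)%:E * lne (sigx ^+ 2 / D)%:E)) /\
      ((sigx ^+ 2 * g < D)%R ->
         is_min_rate X S D C (- ((2^-1)%:E * lne g%:E))))).
Proof.
move=> rho h Cmin g.
have [s s2 XSE] := gaussian_regression hXS hX hS sigx_gt0 sigs_gt0 hcov.
have sigx1 : sigx != 0%R by rewrite gt_eqF.
have sigs1 : sigs != 0%R by rewrite gt_eqF.
have a0 : (theta1 / sigx != 0)%R by rewrite mulf_neq0// invr_eq0.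
have sx2 : (0 < sigx ^+ 2)%R by rewrite exprn_gt0.
have ss2 : (0 < sigs ^+ 2)%R by rewrite exprn_gt0.
have alE : ((theta1 / sigx / sigx) ^+ 2 * sigx ^+ 2 = theta1 ^+ 2 / sigx ^+ 2)%R by field.
have sigE : ((theta1 / sigx / sigx) ^+ 2 * sigx ^+ 2 + s ^+ 2 = sigs ^+ 2)%R.
  by rewrite alE s2 addrC subrK.
have rhoE : ((theta1 / sigx / sigx) ^+ 2 * sigx ^+ 2 / sigs ^+ 2 = rho ^+ 2)%R.
  by rewrite /rho; field; rewrite sigx1.
have rho0 : (0 < rho ^+ 2)%R.
  by rewrite exprn_even_gt0//= mulf_neq0// invr_eq0 mulf_neq0.
pose hS0 := ((1 + ln (sigs ^+ 2) + ln (pi *+ 2)) / 2)%R.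
have hE : h = hS0%:E := diff_entropy_normal sigs_gt0 hS.
(* The entropy power allowed by level [c], relative to that of [S]. It increases with [c], and
   [w C = 1 - rho^2 + rho^2 * g] turns conditions on [C] into conditions on [g]. *)
pose w c := expR (2 * (c - hS0))%R.
have qE : (1 - theta1 ^+ 2 / (sigs ^+ 2 * sigx ^+ 2) = 1 - rho ^+ 2)%R.
  by rewrite /rho; congr (1 - _)%R; field; rewrite sigx1.
have s2E : (s ^+ 2 = sigs ^+ 2 * (1 - rho ^+ 2))%R.
  by rewrite s2 /rho; field; rewrite sigx1.
have gE : (g = 1 - (rho ^+ 2)^-1 * (1 - w C))%R.
  by rewrite /g hE /= /w; congr (1 - _ * (1 - expR _))%R; ring.
have wE : (w C = 1 - rho ^+ 2 + rho ^+ 2 * g)%R by rewrite gE mulrBr mulr1 mulrA divff ?gt_eqF// mul1r; ring.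
have w_gt1 c : (1 < w c)%R = (hS0 < c)%R.
  by rewrite -[X in (X < _)%R]expR0 ltr_expR pmulr_rgt0// subr_gt0.
have w_lt1 c : (w c < 1)%R = (c < hS0)%R.
  by rewrite -[X in (_ < X)%R]expR0 ltr_expR pmulr_rlt0// subr_lt0.
have g_gt1 : (1 < g)%R = (hS0 < C)%R.
  rewrite -w_gt1 wE -subr_gt0 -[RHS]subr_gt0.
  rewrite (_ : (1 - rho ^+ 2 + rho ^+ 2 * g - 1 = rho ^+ 2 * (g - 1))%R); last by ring.
  by rewrite pmulr_rgt0.
have q_gt0 : s != 0%R -> (0 < 1 - rho ^+ 2)%R.
  by move=> s0; rewrite -(pmulr_rgt0 _ ss2) -s2E exprn_even_gt0.
have q_eq0 : s = 0%R -> (1 - rho ^+ 2 = 0)%R.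
  move=> s0; move/eqP: s2E; rewrite s0 expr0n/= eq_sym mulf_eq0 (gt_eqF ss2) /=.
  by move/eqP.
have lbS k : s != 0%R -> feasible X S D C k -> (hS0 + ln (1 - rho ^+ 2) / 2 <= C)%R.
  by move=> s0; have := feasible_entropy_lb (k := k) (D := D) (C := C) sigx_gt0 a0 XSE s0;
    rewrite sigE rhoE; apply.
have CminE : s != 0%R -> Cmin = (hS0 + ln (1 - rho ^+ 2) / 2)%:E.
  move=> s0; rewrite /Cmin qE hE lne_EFin; last exact: q_gt0.
  by rewrite -EFinM -EFinD addrC mulrC.
split.
  have [s0|s0] := eqVneq s 0%R.
    by rewrite /Cmin qE (q_eq0 s0) le0_lneNy// hE gt0_muleNy ?addNye ?lte_fin ?invr_gt0.
  rewrite (CminE s0) lte_fin => CC; rewrite -subset0 => k Fk.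
  by move: (lbS k s0 Fk); rewrite leNgt CC.
move=> hC.
have w0 c : (0 < w c)%R by exact: expR_gt0.
have g0s : s = 0%R -> (0 < g)%R.
  move=> s0; rewrite -(pmulr_rgt0 _ rho0); have := w0 C.
  by rewrite wE (q_eq0 s0) add0r.
(* For [s != 0], [Cmin <= C] says [1 - rho^2 <= w C], that is [0 <= g]. *)
have g0 : (0 <= g)%R.
  have [s0|s0] := eqVneq s 0%R; first by rewrite ltW// g0s.
  have q0 := q_gt0 s0; move: hC; rewrite (CminE s0) lee_fin => hC.
  rewrite -(pmulr_rge0 _ rho0) -(lerD2l (1 - rho ^+ 2)) addr0 -wE.
  rewrite -[leLHS]lnK ?posrE// ler_expR -ler_pdivrMl// mulrC lerBrDr addrC.
  exact: hC.
(* A larger level [C'] is allowed because the entropy bound needs a positive [e], which [C] itself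
   fails to give when [g = 0]. *)
have rate_E k C' e : (0 < e <= 1)%R -> (C <= C')%R ->
    (e = 1 - (rho ^+ 2)^-1 * (1 - w C'))%R -> feasible X S D C k ->
    (- (ln e / 2))%R%:E <= mutual_information (channel_input X k) (channel_output X k).
  move=> e01 CC eE [F1 F2].
  have Fk : feasible X S D C' k by split => //; apply: (le_trans F2); rewrite lee_fin.
  have := rate_ge_entropy (k := k) (D := D) (C := C') (g := e) sigx_gt0 a0 hX XSE e01.
  by rewrite sigE rhoE; apply.
have const : (sigx ^+ 2 <= D)%R -> (hS0 <= C)%R -> exists2 k, feasible X S D C k &
    mutual_information (channel_input X k) (channel_output X k) = 0%E.
  move=> sD hSC; have := constant_channel_rate (D := D) (C := C) sigx_gt0 a0 hX XSE sD.
  by rewrite sigE; apply.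
(* In units of [sigs^2] the conditional variance of [S] is [1 - rho^2 + rho^2 * D' / sigx^2], so the
   entropy constraint becomes [D' <= sigx^2 * g]. *)
have gauss D' : (0 < D' < sigx ^+ 2)%R -> (D' <= D)%R -> (D' <= sigx ^+ 2 * g)%R ->
    exists2 k, feasible X S D C k &
    mutual_information (channel_input X k) (channel_output X k) = (ln (sigx ^+ 2 / D') / 2)%R%:E.
  move=> D's D'D D'g.
  have := gaussian_channel_rate (D := D) (D' := D') (C := C) sigx_gt0 a0 hX XSE D's D'D.
  rewrite sigE; apply; rewrite -/hS0 -/(w C) wE s2E.
  have -> : ((theta1 / sigx / sigx) ^+ 2 = sigs ^+ 2 * (rho ^+ 2 / sigx ^+ 2))%R.
    by rewrite -rhoE; field; rewrite sigx1.
  rewrite -mulrA -mulrDr ler_pM2l// addrC lerD2l -mulrA ler_pM2l//.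
  by rewrite ler_pdivrMl.
split.
  move=> [hC1 sD]; apply: is_min_rateP; last by move=> k _; exact: information_ge0.
  by apply: const; [exact: ltW|move: hC1; rewrite hE lte_fin => /ltW].
move=> nh.
have nh' : (hS0 < C)%R -> (D <= sigx ^+ 2)%R.
  by move=> hC1; rewrite leNgt; apply/negP => sD; apply: nh; split => //; rewrite hE lte_fin.
split.
  move=> Dg.
  have Ds : (D <= sigx ^+ 2)%R.
    have [g1|g1] := leP g 1%R; last by apply: nh'; rewrite -g_gt1.
    by apply: (le_trans Dg); rewrite ler_piMr// ltW.
  have -> : (2^-1)%:E * lne (sigx ^+ 2 / D)%:E = (ln (sigx ^+ 2 / D) / 2)%R%:E.
    by rewrite lne_EFin ?divr_gt0// -EFinM mulrC.
  apply: is_min_rateP; last first.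
    by move=> k Fk; exact: (rate_ge_distortion sigx_gt0 hX D_gt0 Fk).
  (* At [D = sigx^2] the Gaussian channel degenerates and the constant one replaces it. *)
  move: Ds; rewrite le_eqVlt => /orP[/eqP DE|Ds].
    have -> : (ln (sigx ^+ 2 / D) / 2 = 0)%R by rewrite DE divff ?gt_eqF// ln1 mul0r.
    apply: const; first by rewrite DE.
    rewrite leNgt -w_lt1 wE -leNgt -lerBlDl subKr -[leLHS]mulr1 ler_pM2l//.
    by rewrite -(ler_pM2l sx2) mulr1 -[leLHS]DE.
  by apply: gauss => //; rewrite D_gt0.
move=> Dg.
(* If [g > 1] then [C > h(S)], so being outside case (i) gives [D <= sigx^2 < sigx^2 * g], against
   [Dg]. *)
have g1 : (g <= 1)%R.
  rewrite leNgt; apply/negP => g1; have := nh'; rewrite -g_gt1 => /(_ g1).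
  rewrite leNgt => /negP; apply; apply: lt_trans Dg.
  by rewrite ltr_pMr.
move: g0; rewrite le_eqVlt => /orP[/eqP g0|g0]; last first.
  have -> : - ((2^-1)%:E * lne g%:E) = (- (ln g / 2))%R%:E.
    by rewrite lne_EFin// -EFinM mulrC.
  apply: is_min_rateP; last first.
    by move=> k Fk; apply: (rate_E k C) => //; rewrite g0.
  move: g1; rewrite le_eqVlt => /orP[/eqP g1|g1].
    rewrite g1 ln1 mul0r oppr0; apply: const; first by move: Dg; rewrite g1 mulr1 => /ltW.
    by rewrite leNgt -w_lt1 wE g1 mulr1 subrK ltxx.
  have -> : (- (ln g / 2) = ln (sigx ^+ 2 / (sigx ^+ 2 * g)) / 2)%R.
    by rewrite invfM mulrA divff ?gt_eqF// mul1r lnV ?posrE// mulNr.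
  apply: gauss => //; last exact: ltW.
  by rewrite mulr_gt0//= gtr_pMr.
(* Without noise [w C = g], which is an exponential and cannot vanish. *)
have s0 : s != 0%R by apply/eqP => s0; move: (g0s s0); rewrite -g0 ltxx.
have q0 := q_gt0 s0.
have -> : - ((2^-1)%:E * lne g%:E) = +oo.
  by rewrite -g0 le0_lneNy// gt0_muleNy// lte_fin invr_gt0.
(* For each [M] the level is raised to the [C'] whose [g] is [exp (- 2 M)]. A channel feasible at
   [C] stays feasible at [C'], where its rate is at least [M]. *)
have info_oo k : feasible X S D C k ->
    mutual_information (channel_input X k) (channel_output X k) = +oo.
  move=> Fk; have lbM (M : R) : (0 <= M)%R ->
      M%:E <= mutual_information (channel_input X k) (channel_output X k).
    move=> M0; pose e := expR (- (2 * M))%R; have e0 : (0 < e)%R by exact: expR_gt0.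
    have e1 : (e <= 1)%R by rewrite /e -[leRHS]expR0 ler_expR oppr_le0 mulr_ge0.
    have -> : (M = - (ln e / 2))%R by rewrite /e expRK; field.
    have v0 : (0 < 1 - rho ^+ 2 + rho ^+ 2 * e)%R by rewrite addr_gt0// mulr_gt0.
    pose C' := (hS0 + ln (1 - rho ^+ 2 + rho ^+ 2 * e) / 2)%R.
    have wC' : (w C' = 1 - rho ^+ 2 + rho ^+ 2 * e)%R.
      rewrite /w (_ : (2 * (C' - hS0) = ln (1 - rho ^+ 2 + rho ^+ 2 * e))%R) ?lnK//.
      by rewrite /C'; field.
    apply: (rate_E k C') => //; first by rewrite e0.
      have : (w C <= w C')%R by rewrite wC' wE -g0 mulr0 addr0 lerDl mulr_ge0// ltW.
      by rewrite ler_expR ler_pM2l// lerD2r.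
    rewrite wC'; have -> : (1 - (1 - rho ^+ 2 + rho ^+ 2 * e) = rho ^+ 2 * (1 - e))%R by ring.
    by rewrite mulrA mulVf ?gt_eqF// mul1r subKr.
  case: mutual_information lbM => [r lb|//|/(_ 0%R (lexx _))//].
  have := lb (`|r| + 1)%R; rewrite lee_fin addr_ge0// => /(_ isT).
  by rewrite leNgt (le_lt_trans (ler_norm r))// ltrDl.
have [k Fk] : exists k, feasible X S D C k.
  apply: (identity_channel_feasible (D := D) (C := C) sigx_gt0 a0 hX XSE (ltW D_gt0) s0).
  by rewrite sigE -/hS0 -/(w C) wE -g0 mulr0 addr0 s2E.
by apply: is_min_rateP => [|k' Fk']; [exists k => //; exact: info_oo|rewrite info_oo].
Qed.
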